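(* Assume the boundary operators $B_j$, $j=1,\dots,mN$, satisfy the regularity condition $b^j_\beta\in C^{2m+\alpha-m_j}(\partial\Omega)$ and the normality condition stated in the context. Then there exists a linear bounded operator $E$ such that for all $\theta'\in[0,\alpha]$: $$g_j\in C^{2m+\theta'-m_j}(\partial\Omega),\ j=1,\dots,mN\ \Longrightarrow\ E(g_1,\dots,g_{mN})\in C^{2m+\theta'}(\overline\Omega)$$ (with $E$ bounded from $\prod_{j=1}^{mN}C^{2m+\theta'-m_j}(\partial\Omega)$ to $C^{2m+\theta'}(\overline\Omega)=C^{2m+\theta'}(\overline\Omega;\mathbb R^N)$), and $$B_jE(g_1,\dots,g_{mN})=g_j\ \text{ on }\partial\Omega,\qquad j=1,\dots,mN.$$
   Context: $m,n,N\in\mathbb N$, $0<\alpha<1$, $\Omega\subset\mathbb R^n$ is a bounded domain of class $C^{2m+\alpha}$ with outer unit normal $\nu$. The boundary operators act on $\mathbb R^N$-valued functions $u$ by $$(B_ju)(x)=\sum_{|\beta|\le m_j}b^j_\beta(x)\nabla^\beta u(x),\quad x\in\partial\Omega,\ j=1,\dots,mN,$$ where $b^j_\beta(x)$ are $N$-dimensional row vectors and $0\le m_1\le m_2\le\dots\le m_{mN}\le2m-1$. *Normality condition*: for every $k\in\{0,\dots,2m-1\}$, with $\{j_1,\dots,j_{n_k}\}=\{j:m_j=k\}$, and every $x\in\partial\Omega$, the $n_k\times N$ matrix with rows $\sum_{|\beta|=k}b^{j_i}_\beta(x)\nu(x)^\beta$, $i=1,\dots,n_k$, is surjective. *)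

(* Defs.v *)
From HB Require Import structures.
From mathcomp Require Import all_boot all_order all_algebra.
From mathcomp Require Import all_classical all_reals all_analysis.

Set Implicit Arguments.
Unset Strict Implicit.
Unset Printing Implicit Defensive.

Import Order.TTheory GRing.Theory Num.Theory.
Import numFieldNormedType.Exports.

Local Open Scope classical_set_scope.
Local Open Scope ring_scope.

(* Throughout, [`|x|] on ['rV[R]_n] and ['cV[R]_N] is the library's sup norm.
   It is equivalent to the Euclidean norm, so the Hoelder spaces, the classes
   of domains and the boundedness of operators are the usual ones.  Only the
   unit normal needs the Euclidean length, which is then written out.         *)

(* [pder [:: i1; ..; ik] u] is d_i1 (.. (d_ik u)). *)
Definition pder (R : realType) (n : nat) (V : normedModType R)
    (s : seq 'I_n) (u : 'rV[R]_n -> V) : 'rV[R]_n -> V :=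
  foldr (fun i f x => 'D_(delta_mx ord0 i) f x) u s.

(* Multi-indices with entries at most [K]; those of length at most [K] are
   all of this form. *)
Definition mindex (n K : nat) : finType := {ffun 'I_n -> 'I_K.+1}.

Definition mlen (n K : nat) (b : mindex n K) : nat := (\sum_(i < n) b i)%N.

Definition mseq (n K : nat) (b : mindex n K) : seq 'I_n :=
  flatten [seq nseq (b i) i | i <- enum 'I_n].

Definition mpow (R : realType) (n K : nat) (v : 'rV[R]_n) (b : mindex n K) : R :=
  \prod_(i < n) v ord0 i ^+ b i.

(* u in C^k(closure D), for D open.  Elements of C^k(closure D) are represented
   by total functions, whose values outside [closure D] are irrelevant.  All
   iterated partial derivatives are required, in every order of
   differentiation. *)
Definition Ck_closure (R : realType) (n : nat) (V : normedModType R)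
    (D : set 'rV[R]_n) (k : nat) (u : 'rV[R]_n -> V) : Prop :=
  [/\ {within closure D, continuous u},
      forall (s : seq 'I_n) (i : 'I_n) (x : 'rV[R]_n), (size s < k)%N -> D x ->
        derivable (pder s u) x (delta_mx ord0 i) &
      forall s : seq 'I_n, (size s <= k)%N ->
        exists2 f : 'rV[R]_n -> V, {within closure D, continuous f} &
          forall x, D x -> f x = pder s u x].

(* The value on [closure D] of the continuous extension of a derivative. *)
Definition bder (R : realType) (n : nat) (V : normedModType R)
    (D : set 'rV[R]_n) (s : seq 'I_n) (u : 'rV[R]_n -> V) (x : 'rV[R]_n) : V :=
  lim (pder s u y @[y --> within D (nbhs x)]).

Definition sup_norm (R : realType) (n : nat) (V : normedModType R)
    (D : set 'rV[R]_n) (f : 'rV[R]_n -> V) : \bar R :=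
  ereal_sup [set `|f x|%:E | x in D].

(* The pairs x = y contribute 0 / 0 = 0. *)
Definition hseminorm (R : realType) (n : nat) (V : normedModType R)
    (D : set 'rV[R]_n) (theta : R) (f : 'rV[R]_n -> V) : \bar R :=
  ereal_sup [set (`|f z.1 - f z.2| / `|z.1 - z.2| `^ theta)%:E | z in D `*` D].

(* The norm of C^(k+theta)(closure D); for theta = 0 it is the C^k norm.  Sups
   over D and over closure D agree by continuity. *)
Definition holder_norm (R : realType) (n : nat) (V : normedModType R)
    (D : set 'rV[R]_n) (k : nat) (theta : R) (u : 'rV[R]_n -> V) : \bar R :=
  (\sum_(b : mindex n k | (mlen b <= k)%N) sup_norm D (pder (mseq b) u) +
   (if theta == 0%R then 0
    else \sum_(b : mindex n k | mlen b == k)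
           hseminorm D theta (pder (mseq b) u)))%E.

Definition holder (R : realType) (n : nat) (V : normedModType R)
    (D : set 'rV[R]_n) (k : nat) (theta : R) (u : 'rV[R]_n -> V) : Prop :=
  Ck_closure D k u /\ (holder_norm D k theta u < +oo)%E.

Definition bdry (R : realType) (n : nat) (D : set 'rV[R]_n) : set 'rV[R]_n :=
  closure D `\` D°.

(* The unit cell of R^n, a cube for the sup norm. *)
Definition cell (R : realType) (n : nat) : set 'rV[R]_n := ball 0 1.

Record chart (R : realType) (n : nat) : Type := Chart {
  cdom : set 'rV[R]_n.+1 ;
  cmap : 'rV[R]_n.+1 -> 'rV[R]_n.+1 ;
  cinv : 'rV[R]_n.+1 -> 'rV[R]_n.+1 }.

(* A C^(k+alpha) diffeomorphism, together with its inverse, of an open set onto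
   the unit cell, that carries D to the part with positive 0-th coordinate.
   For D open this forces the boundary of D to correspond to the part with zero
   0-th coordinate. *)
Definition is_chart (R : realType) (n : nat) (D : set 'rV[R]_n.+1)
    (k : nat) (alpha : R) (c : chart R n) : Prop :=
  [/\ open (cdom c),
      forall x, cdom c x -> cell (cmap c x) /\ cinv c (cmap c x) = x,
      forall y, cell y -> cdom c (cinv c y) /\ cmap c (cinv c y) = y,
      holder (cdom c) k alpha (cmap c) /\ holder (@cell R n.+1) k alpha (cinv c) &
      forall x, cdom c x -> (D x <-> 0 < cmap c x ord0 ord0)].

(* The boundary of D is of class C^(k+alpha), witnessed by the finite atlas c.
   For D bounded a finite atlas is the same as a chart around each boundary
   point, by compactness. *)
Definition is_atlas (R : realType) (n : nat) (D : set 'rV[R]_n.+1)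
    (k : nat) (alpha : R) (p : nat) (c : 'I_p -> chart R n) : Prop :=
  (forall i, is_chart D k alpha (c i)) /\
  (forall x, bdry D x -> exists i, cdom (c i) x).

Definition bounded_domain (R : realType) (n : nat) (D : set 'rV[R]_n) : Prop :=
  [/\ open D, connected D, D !=set0 & bounded_set D].

Definition local_rep (R : realType) (n : nat) (V : normedModType R)
    (c : chart R n) (g : 'rV[R]_n.+1 -> V) : 'rV[R]_n -> V :=
  fun y => g (cinv c (row_mx (0 : 'rV[R]_1) y)).

(* C^(k+theta)(boundary of D) in local coordinates.  Its elements are
   represented by total functions; membership and norm only involve their
   values on the boundary, as [cinv] maps the closed face of the cell there. *)
Definition holder_bdry (R : realType) (n : nat) (V : normedModType R)
    (p : nat) (c : 'I_p -> chart R n) (k : nat) (theta : R)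
    (g : 'rV[R]_n.+1 -> V) : Prop :=
  forall i, holder (@cell R n) k theta (local_rep (c i) g).

Definition holder_bdry_norm (R : realType) (n : nat) (V : normedModType R)
    (p : nat) (c : 'I_p -> chart R n) (k : nat) (theta : R)
    (g : 'rV[R]_n.+1 -> V) : \bar R :=
  (\sum_(i < p) holder_norm (@cell R n) k theta (local_rep (c i) g))%E.

Definition dotv (R : realType) (n : nat) (v w : 'rV[R]_n) : R :=
  \sum_(i < n) v ord0 i * w ord0 i.

(* Of Euclidean length 1, orthogonal to the velocities at x of all curves in
   the boundary through x, and pointing out of D. *)
Definition outer_unit_normal (R : realType) (n : nat) (D : set 'rV[R]_n)
    (x v : 'rV[R]_n) : Prop :=
  [/\ dotv v v = 1,
      forall gam : R -> 'rV[R]_n, gam 0 = x ->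
        (\forall t \near (0 : R), bdry D (gam t)) -> derivable gam 0 1 ->
        dotv v ('D_1 gam 0) = 0 &
      \forall t \near (0 : R)^'+, ~ closure D (x + t *: v)].

(* [B_j], [j < m * N], of order [mo j], with coefficients [b j beta]; those
   with [mlen beta > mo j] are not used. *)
Definition bdry_op (R : realType) (m n N : nat) (D : set 'rV[R]_n)
    (mo : 'I_(m * N) -> nat)
    (b : 'I_(m * N) -> mindex n (2 * m) -> 'rV[R]_n -> 'rV[R]_N)
    (j : 'I_(m * N)) (u : 'rV[R]_n -> 'cV[R]_N) (x : 'rV[R]_n) : R :=
  \sum_(beta : mindex n (2 * m) | (mlen beta <= mo j)%N)
     (b j beta x *m bder D (mseq beta) u x) ord0 ord0.

Definition normal_mx (R : realType) (m n N : nat)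
    (mo : 'I_(m * N) -> nat)
    (b : 'I_(m * N) -> mindex n (2 * m) -> 'rV[R]_n -> 'rV[R]_N)
    (nu : 'rV[R]_n -> 'rV[R]_n) (k : nat) (x : 'rV[R]_n) :
    'M[R]_(#|[pred j | mo j == k]|, N) :=
  \matrix_(i < #|[pred j | mo j == k]|)
     \sum_(beta : mindex n (2 * m) | mlen beta == k)
        mpow (nu x) beta *: b (enum_val i) beta x.

Definition normality (R : realType) (m n N : nat) (D : set 'rV[R]_n)
    (mo : 'I_(m * N) -> nat)
    (b : 'I_(m * N) -> mindex n (2 * m) -> 'rV[R]_n -> 'rV[R]_N)
    (nu : 'rV[R]_n -> 'rV[R]_n) : Prop :=
  forall (k : nat) (x : 'rV[R]_n), (k < 2 * m)%N -> bdry D x ->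
  forall w : 'cV[R]_(#|[pred j | mo j == k]|),
  exists v : 'cV[R]_N, normal_mx mo b nu k x *m v = w.

(* Main.v *)
(* The operator is built order by order.  Suppose E_k satisfies B_j E_k g = g_j
   for all j with m_j < k; then so does E_(k+1) g = E_k g + W_k (g - B E_k g) for
   m_j <= k, where all derivatives of W_k g of order < k vanish on the boundary
   and B_j W_k g = g_j for m_j = k.

   To construct W_k near a boundary point, flatten the boundary by a chart.  On a
   function whose derivatives of order < k vanish there, B_j with m_j = k is the
   principal symbol at the conormal applied to the k-th normal derivative.  By
   normality this symbol has a right inverse of class C^(2m+alpha-k) near the
   point.  Two solutions W, W' with cut-offs psi, psi' are glued to
   W + (1 - psi) W', and compactness of the boundary does the rest.

   In the half space one needs a linear lift of a tangential function h of class
   C^(l+theta) to a function of class C^(l+k+theta) with k-th normal derivative h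
   and vanishing lower ones.  It is the k-th iterate of f |-> x_0 A_n .. A_1 A_0 f
   on h, where (A_i f)(x) is the integral over u in [0, 1] of f(x - u x_0 e_i).
   Since x_0 A_i d_i f = f - f(. - x_0 e_i), the factor x_0 makes up for one
   derivative.  Nothing in the construction depends on theta. *)

Require Import Defs.
From HB Require Import structures.
From mathcomp Require Import all_boot all_order all_algebra.
From mathcomp Require Import all_classical all_reals all_analysis.
From mathcomp Require Import ring lra.

Set Implicit Arguments.
Unset Strict Implicit.
Unset Printing Implicit Defensive.

Import Order.TTheory GRing.Theory Num.Theory.
Import numFieldNormedType.Exports.

Local Open Scope classical_set_scope.
Local Open Scope ring_scope.

(** * Calculus along the coordinate axes *)

(** The obvious lift x_0^k h / k! has the right normal derivative, but only the smoothness of h,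
    which is k orders short of what W_k must have. The averages smooth h at the scale x_0 and leave
    its trace alone. Segments along the axes are chosen because every estimate then comes down to
    the one-variable fundamental theorem of calculus, with the same formulas for all theta in
    [0, 1]. At theta = 0 a Hoelder bound gives no continuity, so uniform continuity is carried along
    with each class. Solutions are built on the whole space: charts and averages make sense on both
    sides of the boundary, and the traces are values of ordinary derivatives. Vanishing of the
    derivatives of order less than k makes the scheme close. It hides the lower order terms of B_j,
    makes cut-offs act like scalars, and keeps from a chart only the gradient of its 0-th
    coordinate. That gradient spans the normal direction, and the symbol is homogeneous, so
    normality passes to the chart. *)

Definition axis (R : realType) d (i : 'I_d) : 'rV[R]_d := delta_mx ord0 i.

HB.lock
Definition pd (R : realType) d (i : 'I_d) (f : 'rV[R]_d -> R) : 'rV[R]_d -> R :=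
  fun x => 'D_(axis R i) f x.

Lemma pdE (R : realType) d (i : 'I_d) (f : 'rV[R]_d -> R) x :
  pd i f x = 'D_(axis R i) f x.
Proof. by rewrite pd.unlock. Qed.

Lemma is_derive_pd (R : realType) d (i : 'I_d) (f : 'rV[R]_d -> R) x :
  derivable f x (axis R i) -> is_derive x (axis R i) f (pd i f x).
Proof. by move=> df; rewrite pdE; apply/derivableP. Qed.

Lemma pd_val (R : realType) d (i : 'I_d) (f : 'rV[R]_d -> R) x l :
  is_derive x (axis R i) f l -> pd i f x = l.
Proof. by rewrite pdE => -[]. Qed.

(* Convexity with respect to coordinate boxes: balls of the sup norm have it. *)
Definition boxy (R : realType) d (D : set 'rV[R]_d) := forall x y z : 'rV[R]_d, D x -> D y ->
  (forall i, Num.min (x ord0 i) (y ord0 i) <= z ord0 i <=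
             Num.max (x ord0 i) (y ord0 i)) -> D z.

Definition unifc (R : realType) d (D : set 'rV[R]_d) (f : 'rV[R]_d -> R) :=
  forall e, 0 < e -> exists2 del, 0 < del &
    forall x y, D x -> D y -> `|x - y| < del -> `|f x - f y| < e.

Section Norms.
Variables (R : realType) (d : nat).
Implicit Types (x y z v : 'rV[R]_d) (D : set 'rV[R]_d) (i : 'I_d).

Lemma axisE i j : axis R i ord0 j = (i == j)%:R.
Proof. by rewrite mxE eqxx eq_sym. Qed.

Lemma rV_norm_le v (r : R) : 0 <= r ->
  `|v| <= r <-> forall i, `|v ord0 i| <= r.
Proof.
move=> r0; split=> [vr i|h].
  apply: le_trans vr; rewrite [leRHS]/Num.Def.normr/= mx_normrE.
  by apply: le_trans; last exact: (@le_bigmax _ _ _ _ _ (ord0, i)).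
rewrite /Num.Def.normr/= mx_normrE (bigmax_le _ r0)//= => -[a i] _.
by rewrite /= ord1.
Qed.

Lemma rV_norm_coord v i : `|v ord0 i| <= `|v|.
Proof. exact: ((rV_norm_le v (normr_ge0 v)).1 (lexx _) i). Qed.

Lemma norm_axis i : `|axis R i| = 1.
Proof.
apply/eqP; rewrite eq_le; apply/andP; split.
  by apply/rV_norm_le => // j; rewrite axisE; case: eqP => _; rewrite ?normr1 ?normr0.
by apply: le_trans (rV_norm_coord (axis R i) i); rewrite axisE eqxx normr1.
Qed.

Lemma boxyI D1 D2 : boxy D1 -> boxy D2 -> boxy (D1 `&` D2).
Proof. by move=> b1 b2 x y z [? ?] [? ?] h; split; [apply: (b1 x y)|apply: (b2 x y)]. Qed.

Lemma boxy_coord (P : 'I_d -> R -> Prop) :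
  (forall i a b c, P i a -> P i b -> Num.min a b <= c <= Num.max a b -> P i c) ->
  boxy [set x : 'rV[R]_d | forall i, P i (x ord0 i)].
Proof. by move=> h x y z Px Py xyz i; apply: (h i _ _ _ (Px i) (Py i)). Qed.

Lemma minmax_dist (a b c e r : R) : `|a - e| <= r -> `|b - e| <= r ->
  Num.min a b <= c <= Num.max a b -> `|c - e| <= r.
Proof.
rewrite !ler_norml /Num.min /Num.max; case: ltP => _ /andP[? ?] /andP[? ?] /andP[? ?];
by apply/andP; split; lra.
Qed.

Lemma boxy_cball x (r : R) : boxy [set z | `|z - x| <= r].
Proof.
have [r0|r0] := leP 0 r; last first.
  by move=> u w z /= h; move: (le_lt_trans h r0); rewrite normr_lt0.
have -> : [set z | `|z - x| <= r] = [set z : 'rV[R]_d | forall i, `|z ord0 i - x ord0 i| <= r].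
  apply/seteqP; split => z /=.
    by move=> /(rV_norm_le _ r0) h i; move: (h i); rewrite !mxE.
  by move=> h; apply/(rV_norm_le _ r0) => i; rewrite !mxE.
apply: (@boxy_coord (fun i a => `|a - x ord0 i| <= r)) => i a b c.
exact: minmax_dist.
Qed.

Lemma ball_norm x (r : R) z : ball x r z <-> `|z - x| < r.
Proof. by rewrite -ball_normE /ball_ /= distrC. Qed.

Lemma boxy_ball x (r : R) : boxy (ball x r).
Proof.
move=> u w z /ball_norm ux /ball_norm wx h; apply/ball_norm.
apply: (@le_lt_trans _ _ (Num.max `|u - x| `|w - x|)); last first.
  by rewrite gt_max ux wx.
by apply: (@boxy_cball x _ u w) => //=; rewrite le_max lexx ?orbT.
Qed.

Lemma line_is_derive (f : 'rV[R]_d -> R) x i (a : R) :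
  derivable f (x + a *: axis R i) (axis R i) ->
  is_derive a 1 (fun t : R => f (x + t *: axis R i)) (pd i f (x + a *: axis R i)).
Proof.
move=> df.
have E : (fun h : R => h^-1 *: ((f \o shift (x + a *: axis R i)) (h *: axis R i) -
    f (x + a *: axis R i))) =
  (fun h : R => h^-1 *: (((fun t : R => f (x + t *: axis R i)) \o shift a) (h *: 1) -
    (fun t : R => f (x + t *: axis R i)) a)).
  apply/funext => h /=; congr (_ *: (f _ - _)).
  by rewrite [h%:A]mulr1 scalerDl addrCA.
by apply: DeriveDef; rewrite ?pdE /derivable /derive -E.
Qed.

Lemma axis_mvt (f : 'rV[R]_d -> R) x i (a b : R) : a < b ->
  (forall t, a <= t <= b -> derivable f (x + t *: axis R i) (axis R i)) ->
  exists2 t, a < t < b &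
    f (x + b *: axis R i) - f (x + a *: axis R i) =
    pd i f (x + t *: axis R i) * (b - a).
Proof.
move=> ab df.
have h t : a <= t <= b -> is_derive t 1 (fun t : R => f (x + t *: axis R i))
    (pd i f (x + t *: axis R i)).
  by move=> /df; apply: line_is_derive.
have [|t|t tab E] := @MVT R (fun t : R => f (x + t *: axis R i))
   (fun t => pd i f (x + t *: axis R i)) a b ab.
- by move=> t; rewrite in_itv /= => /andP[? ?]; apply: h; rewrite !ltW.
- apply: derivable_within_continuous => u; rewrite in_itv/= => uab.
  by case: (h u uab).
by exists t.
Qed.

Lemma axis_lip (f : 'rV[R]_d -> R) x i (h M : R) :
  (forall t, Num.min 0 h <= t <= Num.max 0 h ->
     derivable f (x + t *: axis R i) (axis R i) /\
     `|pd i f (x + t *: axis R i)| <= M) ->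
  `|f (x + h *: axis R i) - f x| <= M * `|h|.
Proof.
move=> H; case: (ltgtP h 0) => [h0|h0|->]; last first.
- by rewrite scale0r addr0 subrr normr0 mulr0.
- rewrite minElt maxElt h0 in H.
  have [t /H[//]|t /andP[t0 t1] E] := @axis_mvt f x i 0 h h0.
  rewrite scale0r addr0 subr0 in E; rewrite E normrM ler_wpM2r//.
  by case: (H t) => //; rewrite !ltW.
- rewrite minElt maxElt ltNge (ltW h0) /= in H.
  have [t /H[//]|t /andP[t0 t1] E] := @axis_mvt f x i h 0 h0.
  rewrite scale0r addr0 sub0r in E; rewrite -normrN opprB E normrM normrN ler_wpM2r//.
  by case: (H t) => //; rewrite !ltW.
Qed.

(** The points are joined by a path that changes one coordinate at a time; [boxy] keeps this path in
    D. Each of the d pieces is a one-variable mean value estimate, so partial derivatives are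
    enough. *)
Lemma box_lip D (f : 'rV[R]_d -> R) (M : R) : boxy D ->
  (forall z i, D z -> derivable f z (axis R i) /\ `|pd i f z| <= M) ->
  forall x y, D x -> D y -> `|f x - f y| <= d%:R * M * `|x - y|.
Proof.
move=> bD H x y Dx Dy.
have [d0|d0] := posnP d.
  have -> : x = y by apply/rowP => i; move: (ltn_ord i); rewrite {2}d0.
  by rewrite !subrr !normr0 mulr0.
have M0 : 0 <= M by case: (H x (Ordinal d0) Dx) => _; apply: le_trans.
pose z k : 'rV[R]_d := \row_i (if (i < k)%N then x ord0 i else y ord0 i).
have zd : z d = x by apply/rowP => i; rewrite mxE ltn_ord.
have z0 : z 0%N = y by apply/rowP => i; rewrite mxE.
have step k (kd : (k < d)%N) : `|f (z k.+1) - f (z k)| <= M * `|x - y|.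
  pose i := Ordinal kd.
  have -> : z k.+1 = z k + (x ord0 i - y ord0 i) *: axis R i.
    apply/rowP => j; rewrite !mxE ltnS leq_eqVlt eqxx andTb.
    have [jk|jk] := eqVneq (j : nat) k.
      have -> : j = i by apply/val_inj.
      by rewrite eqxx /= ltnn mulr1 addrC subrK.
    have -> : (j == i) = false by apply/eqP => ji; move: jk; rewrite ji eqxx.
    by rewrite /= mulr0 addr0.
  apply: le_trans (_ : M * `|x ord0 i - y ord0 i| <= _); last first.
    by rewrite ler_wpM2l//; move: (rV_norm_coord (x - y) i); rewrite !mxE.
  apply: axis_lip => t ht; apply: H; apply: (bD x y) => // j.
  rewrite !mxE eqxx andTb.
  have [ji|ji] := eqVneq j i; last first.
    rewrite mulr0 addr0; case: ifP => _; rewrite ge_min le_max lexx ?orbT//.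
  rewrite ji /= ltnn mulr1.
  move: ht; rewrite /Num.min /Num.max; case: (ltP 0); case: (ltP (x _ _)) => ? ? /andP[? ?];
    by apply/andP; split; lra.
rewrite -zd -z0 -(telescope_sumr (fun k => f (z k)) (leq0n d)) zd z0.
apply: le_trans (ler_norm_sum _ _ _) _.
apply: (@le_trans _ _ (\sum_(0 <= k < d) M * `|x - y|)).
  by apply: ler_sum_nat => k /andP[_ kd]; apply: step.
by rewrite sumr_const_nat subn0 -mulrA mulr_natl.
Qed.

End Norms.

Lemma addKx (V : zmodType) (x v : V) : x + v - x = v.
Proof. by rewrite addrAC subrr add0r. Qed.

Section Calculus.
Variables (R : realType) (d : nat).
Implicit Types (x y z v : 'rV[R]_d) (D : set 'rV[R]_d) (i : 'I_d).

Lemma is_derive_coord x v i :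
  is_derive x v (fun z : 'rV[R]_d => z ord0 i) (v ord0 i).
Proof.
have C : (fun h : R => h^-1 *: (((fun z : 'rV[R]_d => z ord0 i) \o shift x) (h *: v) -
    x ord0 i)) @ 0^' --> v ord0 i.
  apply: (@cvg_trans _ (cst (v ord0 i) @ (0:R)^')); last exact: cvg_cst.
  apply: near_eq_cvg; near=> h; rewrite /= !mxE addrK /GRing.scale /= mulrA mulVf ?mul1r//.
  by near: h; exact: nbhs_dnbhs_neq.
apply: DeriveDef; first by apply/cvg_ex; exists (v ord0 i).
by apply/cvg_lim.
Unshelve. all: by end_near. Qed.

Lemma is_derive_lin (a : 'I_d -> R) x v :
  is_derive x v (fun z : 'rV[R]_d => \sum_i z ord0 i * a i) (\sum_i v ord0 i * a i).
Proof.
have -> : (fun z : 'rV[R]_d => \sum_i z ord0 i * a i) =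
    \sum_i (fun z : 'rV[R]_d => a i *: (z ord0 i)).
  by apply/funext => z; rewrite fct_sumE; apply: eq_bigr => i _; rewrite mulrC.
have -> : \sum_i v ord0 i * a i = \sum_i a i *: v ord0 i.
  by apply: eq_bigr => i _; rewrite mulrC.
have h i : is_derive x v (fun z : 'rV[R]_d => a i *: (z ord0 i)) (a i *: v ord0 i).
  exact: is_deriveZ (is_derive_coord x v i).
exact: is_derive_sum.
Qed.

(** This is [box_lip] for f minus its linear part at x, on the intersection of D with the closed
    ball of radius |v|, where the partial derivatives of the difference are at most e. *)
Lemma taylor1 D (f : 'rV[R]_d -> R) (e : R) x v : boxy D ->
  (forall z i, D z -> derivable f z (axis R i)) -> D x -> D (x + v) ->
  (forall z i, D z -> `|z - x| <= `|v| -> `|pd i f z - pd i f x| <= e) ->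
  `|f (x + v) - f x - \sum_i v ord0 i * pd i f x| <= d%:R * e * `|v|.
Proof.
move=> bD df Dx Dxv H.
pose g z := f z - \sum_i z ord0 i * pd i f x.
have bD' := boxyI bD (@boxy_cball R d x `|v|).
have dg z i : D z -> is_derive z (axis R i) g (pd i f z - pd i f x).
  move=> Dz.
  have -> : pd i f x = \sum_j (axis R i) ord0 j * pd j f x.
    rewrite (bigD1 i)//= axisE eqxx mul1r big1 ?addr0// => j ji.
    by rewrite axisE eq_sym (negbTE ji) mul0r.
  apply: is_deriveB; first exact/is_derive_pd/df.
  exact: is_derive_lin.
have := @box_lip R d _ g e bD' _ (x + v) x.
rewrite addKx.
have -> : g (x + v) - g x = f (x + v) - f x - \sum_i v ord0 i * pd i f x.
  have E : \sum_i (x + v) ord0 i * pd i f x =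
      \sum_i x ord0 i * pd i f x + \sum_i v ord0 i * pd i f x.
    by rewrite -big_split; apply: eq_bigr => i _; rewrite mxE mulrDl.
  by rewrite /g E; lra.
apply.
- move=> z i [Dz zx]; have [d1 d2] := dg z i Dz; split => //.
  by rewrite pdE d2; apply: H.
- by split => //=; rewrite addKx.
- by split => //=; rewrite subrr normr0.
Qed.

End Calculus.

(** Chain rule for f with continuous partial derivatives and for a single directional derivative of
    Phi: the increment of Phi is h times a quotient tending to l, and [taylor1] expands f along
    it. *)
Lemma is_derive_comp_axis (R : realType) (V : normedModType R) d
  (f : 'rV[R]_d -> R) (Phi : V -> 'rV[R]_d) (x v : V) (l : 'rV[R]_d) :
  (forall e : R, 0 < e -> exists2 r : R, 0 < r & forall z : 'rV[R]_d, ball (Phi x) r z ->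
    forall j, derivable f z (axis R j) /\ `|pd j f (Phi x) - pd j f z| < e) ->
  is_derive x v Phi l ->
  is_derive x v (fun z => f (Phi z)) (\sum_j l ord0 j * pd j f (Phi x)).
Proof.
move=> df [dPhi El].
pose q (h : R) := h^-1 *: (Phi (h *: v + x) - Phi x).
have ql : q h @[h --> 0^'] --> l by rewrite -El; exact: dPhi.
suff C : (fun h : R => h^-1 *: (((fun z => f (Phi z)) \o shift x) (h *: v) -
    f (Phi x))) @ 0^' --> \sum_j l ord0 j * pd j f (Phi x).
  by apply: DeriveDef; [apply/cvg_ex; eexists; exact: C|apply/cvg_lim].
pose s (w : 'rV[R]_d) := \sum_j w ord0 j * pd j f (Phi x).
have sl : s (q h) @[h --> 0^'] --> s l.
  apply: (@cvg_big _ _ +%R) => [|j _]; first exact: add_continuous.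
  apply: (cvgM _ (cvg_cst _)).
  apply: (@cvg_comp _ _ _ q (fun w : 'rV[R]_d => w ord0 j) _ (nbhs l)) => //.
  exact: coord_continuous.
apply/cvgrPdist_le => e e0.
have e2 : 0 < e / 2 by rewrite divr_gt0.
(* Near 0 the quotient satisfies |q h| <= |l| + 1, so the Taylor remainder is at most e / 2 times
   |h|; the last 1 keeps K positive when d = 0. *)
pose K := d%:R * (`|l| + 1) + 1.
have K0 : 0 < K.
  by rewrite ltr_wpDl// mulr_ge0// addr_ge0.
have eK : 0 < e / 2 / K by rewrite divr_gt0.
have [r r0 hr] := df _ eK.
near=> h.
have h0 : h != 0 by near: h; exact: nbhs_dnbhs_neq.
have qh : `|q h| <= `|l| + 1.
  have : `|l - q h| < 1 by near: h; move/cvgrPdist_lt : ql; apply.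
  move=> /ltW hq; have -> : q h = l - (l - q h) by rewrite opprB addrC subrK.
  by apply: le_trans (ler_normB _ _) _; rewrite lerD2l.
have Eh : Phi (h *: v + x) = Phi x + h *: q h.
  by rewrite /q scalerA divff// scale1r [RHS]addrC subrK.
have hs : `|h *: q h| < r.
  rewrite normrZ; apply: le_lt_trans (_ : `|h| * (`|l| + 1) < _).
    by rewrite ler_wpM2l.
  rewrite -ltr_pdivlMr; last by rewrite ltr_wpDl.
  near: h; apply: dnbhs0_lt; rewrite divr_gt0//; by rewrite ltr_wpDl.
have T := @taylor1 R d (ball (Phi x) r) f (e / 2 / K) (Phi x) (h *: q h)
  (@boxy_ball _ _ _ _).
have {}T : `|f (Phi x + h *: q h) - f (Phi x) - h * s (q h)| <=
    d%:R * (e / 2 / K) * `|h *: q h|.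
  have -> : h * s (q h) = \sum_i (h *: q h) ord0 i * pd i f (Phi x).
    by rewrite /s mulr_sumr; apply: eq_bigr => i _; rewrite [in RHS]mxE mulrA.
  apply: T.
  - by move=> z i /hr /(_ i)[].
  - exact: ballxx.
  - by apply/ball_norm; rewrite addKx.
  - by move=> z i /hr /(_ i)[_ /ltW]; rewrite distrC.
rewrite /= Eh.
have -> : \sum_j l ord0 j * pd j f (Phi x) = s l by [].
rewrite -(subrKA (s (q h))); apply: (le_trans (ler_normD _ _)).
rewrite [leRHS](splitr e) lerD//.
  by near: h; move/cvgrPdist_le : sl; apply.
rewrite -(ler_pM2l (_ : 0 < `|h|)) ?normr_gt0// -normrM mulrBr.
rewrite [h * (_ *: _)]mulrA divff// mul1r distrC.
apply: le_trans T _; rewrite normrZ mulrCA ler_wpM2l//.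
apply: (@le_trans _ _ (d%:R * (e / 2 / K) * (`|l| + 1))).
  by rewrite ler_wpM2l// mulr_ge0// ltW.
rewrite mulrAC -[leRHS](divfK (lt0r_neq0 K0)) [leRHS]mulrC ler_wpM2r// ?ltW//.
by rewrite /K ltrDl.
Unshelve. all: by end_near. Qed.

(** * Symmetry of second derivatives *)

Section Schwarz.
Variables (R : realType) (d : nat).
Implicit Types (x y z v : 'rV[R]_d) (i : 'I_d).

Lemma is_derive_translate (f : 'rV[R]_d -> R) x v w l :
  is_derive (x + w) v f l -> is_derive x v (fun z => f (z + w)) l.
Proof.
move=> [df <-].
have E : (fun h : R => h^-1 *: ((f \o shift (x + w)) (h *: v) - f (x + w))) =
  (fun h : R => h^-1 *: (((fun z => f (z + w)) \o shift x) (h *: v) - f (x + w))).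
  by apply/funext => h /=; rewrite addrA.
by apply: DeriveDef; rewrite /derivable /derive -E.
Qed.

Lemma mixed_difference (f : 'rV[R]_d -> R) x i j (r h : R) : 0 < h -> 2 * h < r ->
  (forall z, ball x r z -> derivable f z (axis R i) /\
                           derivable (pd i f) z (axis R j)) ->
  exists2 z, ball x r z &
    f (x + h *: axis R i + h *: axis R j) - f (x + h *: axis R i) -
      (f (x + h *: axis R j) - f x) = pd j (pd i f) z * (h * h).
Proof.
move=> h0 hr H.
have B a b : 0 <= a <= h -> 0 <= b <= h ->
    ball x r (x + a *: axis R i + b *: axis R j).
  move=> /andP[a0 ah] /andP[b0 bh]; apply/ball_norm.
  rewrite -(addrA x) addKx; apply: le_lt_trans (ler_normD _ _) _.
  by rewrite !normrZ !norm_axis !mulr1 !ger0_norm//; lra.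
pose F z := f (z + h *: axis R j) - f z.
have dF a : 0 <= a <= h -> is_derive (x + a *: axis R i) (axis R i) F
   (pd i f (x + a *: axis R i + h *: axis R j) - pd i f (x + a *: axis R i)).
  move=> ah; apply: is_deriveB.
    apply: is_derive_translate; apply/is_derive_pd.
    by apply: (H _ _).1; apply: B => //; rewrite lexx ltW.
  apply/is_derive_pd; apply: (H _ _).1.
  by have := B a 0 ah; rewrite scale0r addr0; apply; rewrite lexx ltW.
have [|a ah E1] := @axis_mvt R d F x i 0 h h0; first by move=> t /dF[].
have ah' : 0 <= a <= h by case/andP: ah => *; rewrite !ltW.
rewrite scale0r addr0 subr0 (pd_val (dF a ah')) in E1.
have [|b bh E2] := @axis_mvt R d (pd i f) (x + a *: axis R i) j 0 h h0.
  by move=> t th; apply: (H _ _).2; apply: B.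
exists (x + a *: axis R i + b *: axis R j).
  by apply: B => //; case/andP: bh => *; rewrite !ltW.
rewrite scale0r addr0 subr0 in E2.
by rewrite mulrA -E2 -E1 /F.
Qed.

(** The second difference does not change when i and j are exchanged, and by [mixed_difference] it
    is h * h times either mixed derivative at some nearby point. Continuity of both at x gives
    equality. *)
Lemma schwarz (f : 'rV[R]_d -> R) x i j :
  (forall e : R, 0 < e -> exists2 r : R, 0 < r & forall z : 'rV[R]_d, ball x r z ->
    [/\ derivable f z (axis R i), derivable f z (axis R j),
     derivable (pd i f) z (axis R j) & derivable (pd j f) z (axis R i)] /\
    `|pd j (pd i f) x - pd j (pd i f) z| < e /\
    `|pd i (pd j f) x - pd i (pd j f) z| < e) ->
  pd j (pd i f) x = pd i (pd j f) x.
Proof.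
move=> df; apply/eqP; rewrite -subr_eq0 -normr_le0.
apply/ler_addgt0Pr => e e0; rewrite add0r.
have e2 : 0 < e / 2 by rewrite divr_gt0.
have [r r0 hr] := df _ e2.
pose h := r / 3.
have h0 : 0 < h by rewrite divr_gt0.
have h2 : 2 * h < r by rewrite /h; lra.
have [|z1 /hr[_ [z1h _]] E1] := @mixed_difference f x i j r h h0 h2.
  by move=> z /hr[[]].
have [|z2 /hr[_ [_ z2h]] E2] := @mixed_difference f x j i r h h0 h2.
  by move=> z /hr[[]].
have E : pd j (pd i f) z1 = pd i (pd j f) z2.
  apply: (mulIf (lt0r_neq0 (mulr_gt0 h0 h0))).
  apply: etrans (esym E1) (etrans _ E2).
  have K (a b c c' : R) : a - b - (c - c') = a - c - (b - c') by ring.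
  by rewrite (addrAC x); apply: K.
rewrite E in z1h; rewrite distrC in z2h.
rewrite -(subrKA (pd i (pd j f) z2)).
apply: le_trans (ler_normD _ _) _; rewrite [leRHS]splitr.
by apply: lerD; apply: ltW.
Qed.

End Schwarz.

(** * Hoelder classes *)

Lemma open_ball (R : realType) d (D : set 'rV[R]_d) x : open D -> D x ->
  exists2 r : R, 0 < r & forall z, ball x r z -> D z.
Proof.
move=> oD Dx; have /nbhs_ballP[r /= r0 h] : nbhs x D by apply: open_nbhs_nbhs.
by exists r.
Qed.

(** One constant M serves the sup and the Hoelder quotient. Uniform continuity has no modulus tied
    to M: a bounded operator only has to preserve it. *)
Definition lv (R : realType) d (D : set 'rV[R]_d) (theta M : R) (f : 'rV[R]_d -> R) :=
  [/\ 0 <= M, forall x, D x -> `|f x| <= M,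
      forall x y, D x -> D y -> `|f x - f y| <= M * `|x - y| `^ theta & unifc D f].

(* All partial derivatives up to the order [k] are uniformly continuous, bounded
   by [M] and [theta]-Hoelder with constant [M]; for [theta = 0] only the
   uniform continuity matters. *)
Fixpoint hcls (R : realType) d (D : set 'rV[R]_d) (theta : R) (k : nat) (M : R)
    (f : 'rV[R]_d -> R) : Prop :=
  lv D theta M f /\
  match k with
  | 0 => True
  | k'.+1 => forall i, (forall x, D x -> derivable f x (axis R i)) /\
                       hcls D theta k' M (pd i f)
  end.

Section LvTheory.
Variables (R : realType) (d : nat) (D : set 'rV[R]_d) (theta : R).
Hypothesis theta01 : 0 <= theta <= 1.
Implicit Types (f g : 'rV[R]_d -> R) (M : R) (x y z : 'rV[R]_d).

Let th0 : 0 <= theta. Proof. by case/andP: theta01. Qed.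
Let th1 : theta <= 1. Proof. by case/andP: theta01. Qed.

Lemma lv_le M M' f : M <= M' -> lv D theta M f -> lv D theta M' f.
Proof.
move=> MM [M0 b h u]; split => //; first exact: le_trans MM.
- by move=> x Dx; apply: le_trans (b x Dx) MM.
- move=> x y Dx Dy; apply: le_trans (h x y Dx Dy) _.
  by apply: ler_wpM2r => //; apply: powR_ge0.
Qed.

Lemma lv_sub (D' : set 'rV[R]_d) M f : D' `<=` D -> lv D theta M f -> lv D' theta M f.
Proof.
move=> sD [M0 b h u]; split => //.
- by move=> x /sD; apply: b.
- by move=> x y /sD Dx /sD; apply: h.
- move=> e e0; have [r r0 hr] := u e e0; exists r => // x y /sD Dx /sD Dy.
  exact: hr.
Qed.

Lemma lv_ext M f g : {in D, f =1 g} -> lv D theta M f -> lv D theta M g.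
Proof.
move=> fg [M0 b h u].
have E x : D x -> g x = f x by move=> Dx; rewrite fg ?inE.
split => //.
- by move=> x Dx; rewrite E//; apply: b.
- by move=> x y Dx Dy; rewrite !E//; apply: h.
- move=> e e0; have [r r0 hr] := u e e0; exists r => // x y Dx Dy.
  by rewrite !E//; apply: hr.
Qed.

Lemma lvD M M' f g : lv D theta M f -> lv D theta M' g ->
  lv D theta (M + M') (fun x => f x + g x).
Proof.
move=> [M0 b h u] [M0' b' h' u']; split => //; first exact: addr_ge0.
- by move=> x Dx; apply: le_trans (ler_normD _ _) _; apply: lerD; auto.
- move=> x y Dx Dy; rewrite opprD addrACA mulrDl.
  by apply: le_trans (ler_normD _ _) _; apply: lerD; auto.
- move=> e e0; have e2 : 0 < e / 2 by rewrite divr_gt0.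
  have [r r0 hr] := u _ e2; have [s s0 hs] := u' _ e2.
  exists (Num.min r s); first by rewrite lt_min r0.
  move=> x y Dx Dy; rewrite lt_min => /andP[xr xs].
  rewrite opprD addrACA (splitr e).
  by apply: le_lt_trans (ler_normD _ _) _; apply: ltrD; auto.
Qed.

Lemma lvM M M' f g : lv D theta M f -> lv D theta M' g ->
  lv D theta (2 * M * M') (fun x => f x * g x).
Proof.
move=> [M0 b h u] [M0' b' h' u'].
have E x y : f x * g x - f y * g y = f x * (g x - g y) + (f x - f y) * g y.
  by ring.
have MM : 0 <= M * M' by rewrite mulr_ge0.
split => //; first by rewrite -mulrA mulr_ge0.
- move=> x Dx; rewrite normrM; apply: (@le_trans _ _ (M * M')).
    by apply: ler_pM => //; auto.
  by rewrite -mulrA mulr_natl mulr2n lerDl.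
- move=> x y Dx Dy; rewrite E -(mulrA 2) [2 * _]mulr_natl mulr2n (mulrDl (M * M')).
  apply: le_trans (ler_normD _ _) _; apply: lerD; rewrite normrM.
    by rewrite -mulrA; apply: ler_pM => //; auto.
  by rewrite mulrAC; apply: ler_pM => //; auto.
- move=> e e0; have e2 : 0 < e / 2 by rewrite divr_gt0.
  have e3 : 0 < e / 2 / (M + 1) by rewrite divr_gt0// ltr_wpDl.
  have e4 : 0 < e / 2 / (M' + 1) by rewrite divr_gt0// ltr_wpDl.
  have [r r0 hr] := u _ e4; have [s s0 hs] := u' _ e3.
  exists (Num.min r s); first by rewrite lt_min r0.
  move=> x y Dx Dy; rewrite lt_min => /andP[xr xs].
  rewrite E (splitr e); apply: le_lt_trans (ler_normD _ _) _.
  apply: ltrD; rewrite normrM.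
    apply: (@le_lt_trans _ _ ((M + 1) * `|g x - g y|)).
      by apply: ler_wpM2r => //; apply: le_trans (b _ Dx) _; rewrite lerDl.
    by rewrite mulrC -ltr_pdivlMr ?ltr_wpDl//; apply: hs.
  apply: (@le_lt_trans _ _ (`|f x - f y| * (M' + 1))).
    by apply: ler_wpM2l => //; apply: le_trans (b' _ Dy) _; rewrite lerDl.
  by rewrite -ltr_pdivlMr ?ltr_wpDl//; apply: hr.
Qed.

Lemma lv_cst a : lv D theta `|a| (fun=> a).
Proof.
split => //; first by move=> x y _ _; rewrite subrr normr0 mulr_ge0// powR_ge0.
by move=> e e0; exists 1 => // x y _ _ _; rewrite subrr normr0.
Qed.

Lemma powR_ge_min (r : R) : 0 <= r -> r <= 1 -> r <= r `^ theta.
Proof.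
rewrite le_eqVlt => /predU1P[<-|r0 r1]; first by rewrite powR_ge0.
by apply: ger1_powR => //; rewrite r0.
Qed.

Lemma powR_ge1 (r : R) : 1 <= r -> 1 <= r `^ theta.
Proof. by move=> r1; rewrite -(powRr0 r) ler_powR. Qed.

(** At distance at most 1 the Lipschitz bound is stronger than the Hoelder bound; beyond distance 1
    the oscillation 2 * M suffices. *)
Lemma lv_lip L M f : 0 <= L -> (forall x, D x -> `|f x| <= M) -> 0 <= M ->
  (forall x y, D x -> D y -> `|f x - f y| <= L * `|x - y|) ->
  lv D theta (L + 2 * M) f.
Proof.
move=> L0 b M0 l; have M2 : 0 <= 2 * M by rewrite mulr_ge0.
split => //; first exact: addr_ge0.
- move=> x Dx; apply: le_trans (b x Dx) _; rewrite mulr_natl mulr2n.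
  by rewrite addrA lerDr addr_ge0.
- move=> x y Dx Dy; have [xy|/ltW xy] := leP `|x - y| 1.
    apply: le_trans (l x y Dx Dy) _; apply: ler_pM => //; last exact: powR_ge_min.
    by rewrite lerDl.
  apply: (@le_trans _ _ (2 * M)).
    apply: le_trans (ler_normB _ _) _; rewrite mulr_natl mulr2n.
    by apply: lerD; auto.
  rewrite -[X in X <= _]mulr1; apply: ler_pM => //; last exact: powR_ge1.
  by rewrite lerDr.
- move=> e e0; exists (e / (L + 1)); first by rewrite divr_gt0// ltr_wpDl.
  move=> x y Dx Dy; rewrite ltr_pdivlMr ?ltr_wpDl// mulrC => h.
  apply: le_lt_trans (l x y Dx Dy) (le_lt_trans _ h).
  by apply: ler_wpM2r => //; rewrite lerDl.
Qed.

Lemma lv_theta (alpha M : R) f : theta <= alpha -> lv D alpha M f -> lv D theta (2 * M) f.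
Proof.
move=> ta [M0 b h u]; have M2 : 0 <= 2 * M by rewrite mulr_ge0.
have MM : M <= 2 * M by rewrite mulr_natl mulr2n lerDl.
split => //.
- by move=> x Dx; apply: le_trans (b x Dx) _.
- move=> x y Dx Dy; have [xy|/ltW xy] := leP `|x - y| 1.
    apply: le_trans (h x y Dx Dy) _; apply: ler_pM => //.
    have := normr_ge0 (x - y); rewrite le_eqVlt => /predU1P[<-|xy0]; last first.
      by apply: ger_powR => //; rewrite xy0.
    have [t0|t0] := eqVneq alpha 0.
      have t1 : theta <= 0 by rewrite -t0.
      by have -> : theta = 0 by [apply/eqP; rewrite eq_le t1 th0]; rewrite t0.
    by rewrite powR0// powR_ge0.
  apply: (@le_trans _ _ (2 * M)).
    apply: le_trans (ler_normB _ _) _; rewrite mulr_natl mulr2n.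
    by apply: lerD; auto.
  rewrite -[X in X <= _]mulr1; apply: ler_pM => //; exact: powR_ge1.
Qed.

End LvTheory.

Section HclsTheory.
Variables (R : realType) (d : nat) (D : set 'rV[R]_d) (theta : R).
Hypothesis theta01 : 0 <= theta <= 1.
Hypothesis oD : open D.
Implicit Types (f g : 'rV[R]_d -> R) (M : R) (x y z : 'rV[R]_d) (i j : 'I_d).

Lemma hcls_lv k M f : hcls D theta k M f -> lv D theta M f.
Proof. by case: k => [|k] []. Qed.

Lemma hcls_ge0 k M f : hcls D theta k M f -> 0 <= M.
Proof. by move/hcls_lv => []. Qed.

Lemma hcls_bound k M f x : hcls D theta k M f -> D x -> `|f x| <= M.
Proof. by move/hcls_lv => [_ h _ _]; apply: h. Qed.

Lemma hcls_derivable k M f x i : hcls D theta k.+1 M f -> D x ->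
  derivable f x (axis R i).
Proof. by case=> _ /(_ i)[h _]; apply: h. Qed.

Lemma hcls_pd k M f i : hcls D theta k.+1 M f -> hcls D theta k M (pd i f).
Proof. by case=> _ /(_ i)[]. Qed.

Lemma hcls_le k M M' f : M <= M' -> hcls D theta k M f -> hcls D theta k M' f.
Proof.
move=> MM; elim: k f => [|k IH] f [l h]; split => //; try exact: lv_le l.
by move=> i; have [h1 h2] := h i; split => //; apply: IH.
Qed.

Lemma hcls_leq k k' M f : (k' <= k)%N -> hcls D theta k M f -> hcls D theta k' M f.
Proof.
elim: k' k f => [|k' IH] [|k] f // kk [l h]; split => // i.
by have [h1 h2] := h i; split => //; apply: IH h2.
Qed.

Lemma eq_on_near f g x : {in D, f =1 g} -> D x -> \forall y \near x, f y = g y.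
Proof.
move=> fg Dx; have : nbhs x D by apply: open_nbhs_nbhs.
by apply: filterS => y Dy; apply: fg; rewrite inE.
Qed.

Lemma eq_on_derivable f g x (v : 'rV[R]_d) : {in D, f =1 g} -> D x ->
  derivable f x v -> derivable g x v.
Proof. by move=> fg Dx; apply: near_eq_derivable; apply: eq_on_near. Qed.

Lemma eq_on_pd f g i : {in D, f =1 g} -> {in D, pd i f =1 pd i g}.
Proof.
move=> fg x; rewrite inE !pdE => Dx.
by apply: near_eq_derive; apply: eq_on_near.
Qed.

Lemma hcls_ext k M f g : {in D, f =1 g} -> hcls D theta k M f -> hcls D theta k M g.
Proof.
elim: k f g => [|k IH] f g fg [l h]; split => //; try exact: lv_ext l.
move=> i; have [h1 h2] := h i; split.
  by move=> x Dx; apply: (eq_on_derivable fg) => //; apply: h1.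
by apply: IH h2; apply: eq_on_pd.
Qed.

Lemma is_derive_pdD f g x i : derivable f x (axis R i) -> derivable g x (axis R i) ->
  is_derive x (axis R i) (fun x => f x + g x) (pd i f x + pd i g x).
Proof. by move=> /is_derive_pd df /is_derive_pd dg; apply: is_deriveD. Qed.

Lemma is_derive_pdM f g x i : derivable f x (axis R i) -> derivable g x (axis R i) ->
  is_derive x (axis R i) (fun x => f x * g x) (pd i f x * g x + f x * pd i g x).
Proof.
move=> /is_derive_pd df /is_derive_pd dg.
have -> : pd i f x * g x + f x * pd i g x = f x *: pd i g x + g x *: pd i f x.
  by rewrite addrC [pd i f x * _]mulrC.
exact: is_deriveM.
Qed.

(** The usual way into a class of order k.+1: it is enough to exhibit the first derivatives on D and
    to place them in class k. *)
Lemma hclsS_intro k M f (df : 'I_d -> 'rV[R]_d -> R) : lv D theta M f ->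
  (forall i x, D x -> is_derive x (axis R i) f (df i x)) ->
  (forall i, hcls D theta k M (df i)) -> hcls D theta k.+1 M f.
Proof.
move=> l H1 H2; split => // i; split; first by move=> x /(H1 i)[].
by apply: hcls_ext (H2 i) => x; rewrite inE => Dx; rewrite (pd_val (H1 i x Dx)).
Qed.

Lemma hclsD k M M' f g : hcls D theta k M f -> hcls D theta k M' g ->
  hcls D theta k (M + M') (fun x => f x + g x).
Proof.
elim: k f g => [|k IH] f g hf hg.
  by split => //; apply: lvD; apply: (@hcls_lv 0).
apply: (@hclsS_intro _ _ _ (fun i x => pd i f x + pd i g x)).
- by apply: lvD; apply: (@hcls_lv k.+1).
- by move=> i x Dx; apply: is_derive_pdD; apply: hcls_derivable Dx; eassumption.
- by move=> i; apply: IH; apply: hcls_pd.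
Qed.

(** The Leibniz rule doubles the constant with each order; the initial factor 2 comes from the
    Hoelder bound of a product. *)
Lemma hclsM k M M' f g : hcls D theta k M f -> hcls D theta k M' g ->
  hcls D theta k (2 ^+ k.+1 * M * M') (fun x => f x * g x).
Proof.
elim: k f g => [|k IH] f g hf hg.
  by split => //; rewrite expr1; apply: lvM; apply: (@hcls_lv 0).
have M0 := hcls_ge0 hf; have M0' := hcls_ge0 hg.
have E : 2 ^+ k.+2 * M * M' = 2 ^+ k.+1 * M * M' + 2 ^+ k.+1 * M * M'.
  by rewrite [2 ^+ k.+2]exprS; ring.
apply: (@hclsS_intro _ _ _ (fun i x => pd i f x * g x + f x * pd i g x)).
- apply: (@lv_le _ _ _ _ (2 * M * M')).
    rewrite ler_wpM2r// ler_wpM2r// exprS -[X in X <= _]mulr1 ler_wpM2l//.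
    by rewrite exprn_ege1// ler1n.
  by apply: lvM; apply: (@hcls_lv k.+1).
- by move=> i x Dx; apply: is_derive_pdM; apply: hcls_derivable Dx; eassumption.
- move=> i; rewrite E; apply: hclsD; apply: IH.
  + exact: hcls_pd.
  + exact: hcls_leq hg.
  + exact: hcls_leq hf.
  + exact: hcls_pd.
Qed.

Lemma hcls_cst k a : hcls D theta k `|a| (fun=> a).
Proof.
elim: k a => [|k IH] a; first by split => //; apply: lv_cst.
apply: (@hclsS_intro _ _ _ (fun i x => 0)); first exact: lv_cst.
by move=> i; apply: hcls_le (IH 0); rewrite normr0.
Qed.

Lemma hclsZ k M a f : hcls D theta k M f -> hcls D theta k (`|a| * M) (fun x => a * f x).
Proof.
have lvZ g : lv D theta M g -> lv D theta (`|a| * M) (fun x => a * g x).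
  move=> [M0 b h u]; split; first by rewrite mulr_ge0.
  - by move=> x Dx; rewrite normrM ler_wpM2l//; apply: b.
  - by move=> x y Dx Dy; rewrite -mulrBr normrM -mulrA ler_wpM2l//; apply: h.
  - move=> e e0; have [|r r0 hr] := u (e / (`|a| + 1)).
      by rewrite divr_gt0// ltr_wpDl.
    exists r => // x y Dx Dy xy; rewrite -mulrBr normrM.
    apply: (@le_lt_trans _ _ ((`|a| + 1) * `|g x - g y|)).
      by rewrite ler_wpM2r// lerDl.
    by rewrite mulrC -ltr_pdivlMr ?ltr_wpDl//; apply: hr.
elim: k f => [|k IH] f hf; first by split => //; apply: lvZ; apply: (@hcls_lv 0).
apply: (@hclsS_intro _ _ _ (fun i x => a * pd i f x)).
- by apply: lvZ; apply: (@hcls_lv k.+1).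
- move=> i x Dx; apply: (@is_deriveZ R _ _ f a x (axis R i)).
  by apply: is_derive_pd; apply: hcls_derivable hf Dx.
- by move=> i; apply: IH; apply: hcls_pd.
Qed.

Lemma hcls_sum k (I : Type) (r : seq I) (P : pred I) (M : I -> R) (f : I -> 'rV[R]_d -> R) :
  (forall i : I, P i -> hcls D theta k (M i) (f i)) ->
  hcls D theta k (\sum_(i <- r | P i) M i) (fun x => \sum_(i <- r | P i) f i x).
Proof.
move=> h; elim: r => [|i r IH].
  apply: (@hcls_ext _ _ (fun=> 0)); first by move=> x _; rewrite big_nil.
  by rewrite big_nil; apply: hcls_le (hcls_cst k 0); rewrite normr0.
case Pi : (P i).
  apply: (@hcls_ext _ _ (fun x => f i x + \sum_(i <- r | P i) f i x)).
    by move=> x _; rewrite big_cons Pi.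
  by rewrite big_cons Pi; apply: hclsD => //; apply: h.
apply: hcls_ext (_ : hcls _ _ _ _ (fun x => \sum_(i <- r | P i) f i x)).
  by move=> x _; rewrite big_cons Pi.
by rewrite big_cons Pi.
Qed.

Lemma hcls_theta k (alpha M : R) f : theta <= alpha -> hcls D alpha k M f ->
  hcls D theta k (2 * M) f.
Proof.
move=> ta; elim: k f => [|k IH] f [l h]; (split; first exact: lv_theta l) => // i.
by have [h1 h2] := h i; split => //; apply: IH.
Qed.

Lemma hcls_lipschitz k M f : boxy D -> hcls D theta k.+1 M f ->
  forall x y, D x -> D y -> `|f x - f y| <= d%:R * M * `|x - y|.
Proof.
move=> bD hf; apply: box_lip => // z i Dz; split; first exact: hcls_derivable hf Dz.
by apply: (hcls_bound (hcls_pd i hf)).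
Qed.

Lemma hcls_C1 k M f y : hcls D theta k.+1 M f -> D y ->
  forall e : R, 0 < e -> exists2 r : R, 0 < r & forall z : 'rV[R]_d, ball y r z ->
    forall j, derivable f z (axis R j) /\ `|pd j f y - pd j f z| < e.
Proof.
move=> hf Dy e e0; have [r r0 hr] := open_ball oD Dy.
have H (j : 'I_d) : exists s : R, 0 < s /\ forall x, D x -> `|y - x| < s ->
    `|pd j f y - pd j f x| < e.
  have [_ _ _ u] := hcls_lv (hcls_pd j hf); have [s s0 hs] := u e e0.
  by exists s; split => // x Dx; apply: hs.
have [s hs] := choice H.
exists (\big[Num.min/r]_j s j).
  by apply/bigmin_gtP; split => // j _; case: (hs j).
move=> z; rewrite ball_norm => /bigmin_gtP zr j.
have Dz : D z by apply: hr; rewrite ball_norm; case: zr.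
split; first exact: hcls_derivable hf Dz.
by apply: (hs j).2 => //; rewrite distrC; apply: zr.2.
Qed.

End HclsTheory.

Lemma hcls_sub (R : realType) d (D D' : set 'rV[R]_d) theta k M f : D' `<=` D ->
  hcls D theta k M f -> hcls D' theta k M f.
Proof.
move=> sD; elim: k f => [|k IH] f [l h]; (split; first exact: lv_sub l) => // i.
by have [h1 h2] := h i; split; [move=> x /sD; exact: h1|exact: IH].
Qed.

Arguments hcls R d D theta k M f : simpl never.

(** * Compositions, inverses and cut-offs *)

Lemma is_derive_rV (R : realType) (V : normedModType R) d (Phi : V -> 'rV[R]_d)
    (x v : V) (l : 'rV[R]_d) :
  (forall j, is_derive x v (fun z => Phi z ord0 j) (l ord0 j)) ->
  is_derive x v Phi l.
Proof.
move=> h; have dP : derivable Phi x v.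
  by apply/derivable_mxP => i j; rewrite ord1; case: (h j).
apply: DeriveDef => //; rewrite derive_mx//; apply/rowP => j; rewrite mxE.
by case: (h j).
Qed.

(** Phi carries a Lipschitz constant and bounds on its derivatives, but no bound on its values: the
    projection [tail] of an unbounded slab has to qualify. *)
Definition regmap (R : realType) d d' (D : set 'rV[R]_d) (D' : set 'rV[R]_d')
    (theta : R) (k : nat) (L : R) (Phi : 'rV[R]_d -> 'rV[R]_d') : Prop :=
  [/\ 0 <= L, forall x, D x -> D' (Phi x),
      forall x y, D x -> D y -> `|Phi x - Phi y| <= L * `|x - y| &
      match k with
      | 0 => True
      | k'.+1 => forall i j, (forall x, D x -> derivable (fun z => Phi z ord0 j) x (axis R i)) /\
         hcls D theta k' L (pd i (fun z => Phi z ord0 j))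
      end].

Section Comp.
Variables (R : realType) (d d' : nat) (D : set 'rV[R]_d) (D' : set 'rV[R]_d').
Variable theta : R.
Hypothesis theta01 : 0 <= theta <= 1.
Hypotheses (oD : open D) (oD' : open D').

Lemma regmap_leq k L Phi : regmap D D' theta k.+1 L Phi -> regmap D D' theta k L Phi.
Proof.
move=> [L0 m l h]; split => //; case: k h => // k h i j; have [h1 h2] := h i j.
by split => //; apply: hcls_leq h2.
Qed.

Lemma lv_comp L M (f : 'rV[R]_d' -> R) Phi : regmap D D' theta 0 L Phi ->
  lv D' theta M f -> lv D theta ((L + 1) * M) (fun x => f (Phi x)).
Proof.
move=> [L0 m l _] [M0 b h u]; have [th0 th1] := andP theta01.
have L1 : 0 < L + 1 by rewrite ltr_wpDl.
have ML : M <= (L + 1) * M by rewrite mulrDl mul1r lerDr mulr_ge0.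
split; first by rewrite mulr_ge0// ltW.
- by move=> x Dx; apply: le_trans ML; apply: b; apply: m.
- move=> x y Dx Dy; apply: le_trans (h _ _ (m _ Dx) (m _ Dy)) _.
  rewrite mulrAC [_ * M]mulrC; apply: ler_wpM2l => //.
  apply: (@le_trans _ _ (((L + 1) * `|x - y|) `^ theta)).
    apply: ge0_ler_powR => //; rewrite ?nnegrE//.
      by rewrite mulr_ge0// ltW.
    by apply: le_trans (l x y Dx Dy) _; rewrite ler_wpM2r// lerDl.
  rewrite powRM//; last exact: ltW.
  apply: ler_wpM2r; first exact: powR_ge0.
  by apply: ler1_powR => //; rewrite lerDr.
- move=> e e0; have [r r0 hr] := u e e0.
  exists (r / (L + 1)); first by rewrite divr_gt0.
  move=> x y Dx Dy; rewrite ltr_pdivlMr// mulrC => xy; apply: hr; try exact: m.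
  apply: le_lt_trans (l x y Dx Dy) (le_lt_trans _ xy).
  by rewrite ler_wpM2r// lerDl.
Qed.

Lemma is_derive_comp k L M (f : 'rV[R]_d' -> R) Phi i x :
  regmap D D' theta k.+1 L Phi -> hcls D' theta k.+1 M f -> D x ->
  is_derive x (axis R i) (fun x => f (Phi x))
    (\sum_j pd j f (Phi x) * pd i (fun z => Phi z ord0 j) x).
Proof.
move=> [L0 m l h] hf Dx.
pose w : 'rV[R]_d' := \row_j pd i (fun z => Phi z ord0 j) x.
have -> : \sum_j pd j f (Phi x) * pd i (fun z => Phi z ord0 j) x =
    \sum_j w ord0 j * pd j f (Phi x).
  by apply: eq_bigr => j _; rewrite mxE mulrC.
have H := hcls_C1 oD' hf (m _ Dx).
apply: is_derive_comp_axis; first exact: H.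
apply: is_derive_rV => j; rewrite mxE; apply: is_derive_pd.
by have [h1 _] := h i j; apply: h1.
Qed.

(** Induction on k through the chain rule and [hclsM]. The constant depends on k and L but not on f,
    so composition with a chart is a bounded operator. *)
Lemma hcls_comp k L : exists2 C, 0 <= C & forall M f Phi,
  regmap D D' theta k L Phi -> hcls D' theta k M f ->
  hcls D theta k (C * M) (fun x => f (Phi x)).
Proof.
have [L0|Ln] := leP 0 L; last first.
  by exists 0 => // M f Phi [L0]; move: (le_lt_trans L0 Ln); rewrite ltxx.
elim: k => [|k [C C0 IH]].
  exists (L + 1); first by rewrite addr_ge0.
  by move=> M f Phi hP [l _]; split => //; apply: lv_comp.
pose K : R := 2 ^+ k.+1 * C * L.
have K0 : 0 <= K by rewrite !mulr_ge0.
exists (L + 1 + d'%:R * K); first by rewrite !addr_ge0// mulr_ge0.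
move=> M f Phi hP hf; have M0 := hcls_ge0 hf.
apply: (@hclsS_intro _ _ _ _ oD _ _ _
  (fun i x => \sum_j pd j f (Phi x) * pd i (fun z => Phi z ord0 j) x)).
- apply: (@lv_le _ _ _ _ ((L + 1) * M)).
    by rewrite ler_wpM2r// lerDl mulr_ge0.
  apply: lv_comp; last exact: hcls_lv hf.
  by case: hP.
- by move=> i x Dx; apply: is_derive_comp hP hf Dx.
- move=> i; have hP' := regmap_leq hP.
  apply: (@hcls_le _ _ _ _ _ (\sum_(j < d') (2 ^+ k.+1 * (C * M) * L))).
    rewrite sumr_const card_ord -[X in X <= _]mulr_natl.
    have -> : 2 ^+ k.+1 * (C * M) * L = K * M by rewrite /K; ring.
    by rewrite mulrA ler_wpM2r// lerDr addr_ge0.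
  apply: hcls_sum => // j _; apply: hclsM => //.
    by apply: IH hP' _; apply: hcls_pd.
  by case: hP => _ _ _ /(_ i j)[].
Qed.

End Comp.

Section Reg.
Variables (R : realType) (d : nat) (D : set 'rV[R]_d) (theta : R).
Hypothesis theta01 : 0 <= theta <= 1.
Hypothesis oD : open D.
Implicit Types (f g : 'rV[R]_d -> R) (M : R) (x y z : 'rV[R]_d) (i j : 'I_d).

(** The qualitative version is for what is fixed once (charts, coefficients, cut-offs); explicit
    bounds are kept for the data, on which operators act. *)
Definition reg k f := exists M, hcls D theta k M f.

Lemma reg_cst k a : reg k (fun=> a).
Proof. by exists `|a|; apply: hcls_cst. Qed.

Lemma regD k f g : reg k f -> reg k g -> reg k (fun x => f x + g x).
Proof. by move=> [M hf] [M' hg]; eexists; apply: hclsD hf hg. Qed.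

Lemma regM k f g : reg k f -> reg k g -> reg k (fun x => f x * g x).
Proof. by move=> [M hf] [M' hg]; eexists; apply: hclsM hf hg. Qed.

Lemma regB k f g : reg k f -> reg k g -> reg k (fun x => f x - g x).
Proof.
move=> hf hg; have : reg k (fun x => f x + (-1) * g x).
  by apply: regD => //; apply: regM => //; apply: reg_cst.
by congr reg; apply/funext => x; rewrite mulN1r.
Qed.

Lemma reg_sum k (I : Type) (r : seq I) (P : pred I) (f : I -> 'rV[R]_d -> R) :
  (forall i : I, P i -> reg k (f i)) -> reg k (fun x => \sum_(i <- r | P i) f i x).
Proof.
move=> h; have : forall i : I, exists M, P i -> hcls D theta k M (f i).
  move=> i; case Pi : (P i); last by exists 0.
  by have [M hM] := h i Pi; exists M.
by move/choice => [M hM]; eexists; apply: hcls_sum hM.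
Qed.

Lemma reg_prod k (I : Type) (r : seq I) (P : pred I) (f : I -> 'rV[R]_d -> R) :
  (forall i : I, P i -> reg k (f i)) -> reg k (fun x => \prod_(i <- r | P i) f i x).
Proof.
move=> h; elim: r => [|i r IH].
  have -> : (fun x => \prod_(i <- [::] | P i) f i x) = (fun=> 1).
    by apply/funext => x; rewrite big_nil.
  exact: reg_cst.
case Pi : (P i); last first.
  by congr reg : IH; apply/funext => x; rewrite big_cons Pi.
have : reg k (fun x => f i x * \prod_(i <- r | P i) f i x) by apply: regM => //; apply: h.
by congr reg; apply/funext => x; rewrite big_cons Pi.
Qed.

Lemma reg_exp k n f : reg k f -> reg k (fun x => f x ^+ n).
Proof.
move=> hf; elim: n => [|n IH]; first exact: reg_cst.
have : reg k (fun x => f x * f x ^+ n) by apply: regM.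
by congr reg; apply/funext => x; rewrite exprS.
Qed.

Lemma reg_leq k k' f : (k' <= k)%N -> reg k f -> reg k' f.
Proof. by move=> kk [M hf]; exists M; apply: hcls_leq hf. Qed.

Lemma reg_ext k f g : {in D, f =1 g} -> reg k f -> reg k g.
Proof. by move=> fg [M hf]; exists M; apply: hcls_ext hf. Qed.

Lemma reg_pd k f i : reg k.+1 f -> reg k (pd i f).
Proof. by move=> [M hf]; exists M; apply: hcls_pd. Qed.

Lemma lv_inv (c : R) M f : 0 < c -> (forall x, D x -> c <= `|f x|) -> lv D theta M f ->
  lv D theta (c^-1 + M / c ^+ 2) (fun x => (f x)^-1).
Proof.
move=> c0 fc [M0 b h u].
have N x : D x -> f x != 0 by move/fc => /(lt_le_trans c0); rewrite normr_gt0.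
have fV x : D x -> `|(f x)^-1| <= c^-1.
  move=> Dx; rewrite normfV lef_pV2 ?posrE//; first exact: fc.
  by rewrite normr_gt0 N.
have E x y : D x -> D y -> `|(f x)^-1 - (f y)^-1| <= `|f x - f y| / c ^+ 2.
  move=> Dx Dy.
  have -> : (f x)^-1 - (f y)^-1 = (f y - f x) * ((f x)^-1 * (f y)^-1).
    by field; rewrite !N.
  rewrite normrM distrC expr2 invfM ler_wpM2l// normrM.
  by apply: ler_pM; rewrite ?fV.
have c2 : 0 < c ^+ 2 by rewrite exprn_gt0.
split; first by rewrite addr_ge0// ?invr_ge0 ?divr_ge0// ltW.
- by move=> x Dx; apply: le_trans (fV x Dx) _; rewrite lerDl divr_ge0// ltW.
- move=> x y Dx Dy; apply: le_trans (E x y Dx Dy) _.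
  apply: (@le_trans _ _ (M / c ^+ 2 * `|x - y| `^ theta)).
    by rewrite [leRHS]mulrAC ler_pM2r ?invr_gt0//; apply: h.
  by rewrite ler_wpM2r ?powR_ge0// lerDr invr_ge0 ltW.
- move=> e e0; have [|r r0 hr] := u (e * c ^+ 2); first by rewrite mulr_gt0.
  exists r => // x y Dx Dy xy; apply: le_lt_trans (E x y Dx Dy) _.
  by rewrite ltr_pdivrMr//; apply: hr.
Qed.

(** Induction on k: the derivative - f^-2 d_i f of the inverse involves the inverse itself only at
    order k. *)
Lemma reg_inv k (c : R) f : 0 < c -> (forall x, D x -> c <= `|f x|) -> reg k f ->
  reg k (fun x => (f x)^-1).
Proof.
move=> c0 fc; elim: k => [|k IH] rf; have [M hf] := rf.
  by exists (c^-1 + M / c ^+ 2); split => //; apply: lv_inv (hcls_lv hf).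
have rV := IH (reg_leq (leqnSn k) rf).
have : forall i, exists M', hcls D theta k M'
    (fun x => (-1) * ((f x)^-1 * (f x)^-1) * pd i f x).
  move=> i; do ?apply: regM => //; [exact: reg_cst|exact: reg_pd].
move/choice => [M' hM'].
exists ((c^-1 + M / c ^+ 2) + \sum_i `|M' i|).
have l := lv_inv c0 fc (hcls_lv hf).
apply: (@hclsS_intro _ _ _ _ oD _ _ _
  (fun i x => (-1) * ((f x)^-1 * (f x)^-1) * pd i f x)).
- by apply: lv_le l; rewrite lerDl sumr_ge0.
- move=> i x Dx; have dfx : derivable f x (axis R i) by apply: hcls_derivable hf Dx.
  have fx0 : f x != 0 by rewrite -normr_gt0 (lt_le_trans c0)// fc.
  apply: DeriveDef; first exact: derivableV.
  rewrite deriveV// pdE mulN1r /GRing.scale/= -invfM -expr2.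
  reflexivity.
- move=> i; apply: hcls_le (hM' i).
  rewrite (bigD1 i)//= addrCA; apply: le_trans (ler_norm _) _.
  rewrite lerDl addr_ge0//; last by rewrite sumr_ge0.
  by case: l.
Qed.

End Reg.

Lemma reg_theta (R : realType) d (D : set 'rV[R]_d) (theta alpha : R) k f :
  0 <= theta <= 1 -> theta <= alpha -> reg D alpha k f -> reg D theta k f.
Proof. by move=> t01 ta [M hf]; exists (2 * M); apply: hcls_theta hf. Qed.

Lemma reg_sub (R : realType) d (D D' : set 'rV[R]_d) (theta : R) k f :
  D' `<=` D -> reg D theta k f -> reg D' theta k f.
Proof. by move=> sD [M hf]; exists M; apply: hcls_sub hf. Qed.

Lemma reg_comp (R : realType) d d' (D : set 'rV[R]_d) (D' : set 'rV[R]_d') (theta L : R) k Phi f :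
  0 <= theta <= 1 -> open D -> open D' -> regmap D D' theta k L Phi ->
  reg D' theta k f -> reg D theta k (fun x => f (Phi x)).
Proof.
move=> t01 oD oD' hP [M hf]; have [C C0 h] := hcls_comp t01 oD oD' k L.
by exists (C * M); apply: h.
Qed.

(** * Truncated powers *)

Section Positive_part.
Variable R : realType.

(** The building block of the cut-offs. Only finite smoothness is asked of them, and composition
    with the truncated power of exponent k.+1 preserves class k ([reg_pospow]). *)
Definition pospow (k : nat) (t : R) : R := Num.max 0 t ^+ k.

Lemma pospow_le k (t : R) : t <= 0 -> pospow k.+1 t = 0.
Proof. by move=> t0; rewrite /pospow max_l// expr0n. Qed.

Lemma pospow_ge k (t : R) : 0 <= t -> pospow k t = t ^+ k.
Proof. by move=> t0; rewrite /pospow max_r. Qed.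

Lemma is_derive_pospow k (t : R) :
  is_derive t 1 (pospow k.+2) (k.+2%:R * pospow k.+1 t).
Proof.
case: (ltgtP t 0) => t0.
- rewrite pospow_le ?ltW// mulr0.
  apply: (@near_eq_is_derive R _ _ (fun=> 0) _ t 1 0 _ (is_derive_cst _ _ _)).
  near=> s; rewrite pospow_le//; near: s; apply: filterS (lt_nbhsl t0) => s.
  exact: ltW.
- rewrite pospow_ge ?ltW//.
  apply: (@near_eq_is_derive R R R (fun s : R => s ^+ k.+2)).
    near=> s; rewrite pospow_ge//; near: s; apply: filterS (lt_nbhsr t0) => s.
    exact: ltW.
  have -> : (fun s : R => s ^+ k.+2) = (@id R) ^+ k.+2.
    by apply/funext => s; rewrite fctE.
  have := @is_deriveX R _ (@id R) k.+2 t 1 1 _; rewrite [_ *: 1]mulr1.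
  by rewrite mulr_natl; apply.
- rewrite t0 pospow_le// mulr0.
  have C : (fun h : R => h^-1 *: ((pospow k.+2 \o shift 0) (h *: 1) - pospow k.+2 0)) @ 0^'
      --> (0 : R).
    apply/cvgr0Pnorm_le => e e0.
    near=> h.
    have h0 : h != 0 by near: h; exact: nbhs_dnbhs_neq.
    have h1 : `|h| <= 1.
      by apply: ltW; near: h; apply: dnbhs0_lt.
    rewrite /= (@pospow_le k.+1 0)// subr0 addr0 [h *: 1]mulr1 normrM normfV.
    rewrite ler_pdivrMl ?normr_gt0//.
    have he : `|h| <= e by near: h; apply: dnbhs0_le.
    rewrite mulrC; apply: (@le_trans _ _ (`|h| * `|h|)); last by rewrite ler_wpM2r.
    have [hn|hp] := leP h 0; first by rewrite pospow_le// normr0 mulr_ge0.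
    rewrite (pospow_ge _ (ltW hp)) normrX -expr2.
    by apply: ler_wiXn2l.
  by apply: DeriveDef; [apply/cvg_ex; exists 0|apply/cvg_lim].
Unshelve. all: by end_near. Qed.

Lemma is_derive_line (V : normedModType R) (f : V -> R) (x v : V) (l : R) :
  is_derive x v f l <-> is_derive (0 : R) 1 (fun h : R => f (h *: v + x)) l.
Proof.
have E : (fun h : R => h^-1 *: ((f \o shift x) (h *: v) - f x)) =
  (fun h : R => h^-1 *: (((fun h : R => f (h *: v + x)) \o shift 0) (h *: 1) -
    (fun h : R => f (h *: v + x)) 0)).
  apply/funext => h /=; congr (_ *: (f _ - f _)).
    by rewrite addr0 [h *: 1]mulr1.
  by rewrite scale0r add0r.
by split => -[d1 <-]; apply: DeriveDef; rewrite /derivable /derive ?E// -E.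
Qed.

Lemma is_derive_comp1 (V : normedModType R) (f : V -> R) (p : R -> R) (x v : V) (l dp : R) :
  is_derive x v f l -> is_derive (f x) 1 p dp ->
  is_derive x v (fun z => p (f z)) (dp * l).
Proof.
move=> /is_derive_line df dp'; apply/is_derive_line.
apply: (@is_derive1_comp R p (fun h : R => f (h *: v + x)) 0).
by rewrite scale0r add0r.
Qed.

Lemma lv_pospow1 d (D : set 'rV[R]_d) (theta M : R) f :
  lv D theta M f -> lv D theta M (fun x => pospow 1 (f x)).
Proof.
move=> [M0 b h u].
have P (a c : R) : `|pospow 1 a - pospow 1 c| <= `|a - c|.
  rewrite /pospow !expr1 /Num.max; case: ltP => a0; case: ltP => c0 //.
  - by rewrite subr0 !gtr0_norm ?lerDl ?subr_gt0 ?oppr_ge0// (le_lt_trans c0).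
  - rewrite sub0r normrN distrC !gtr0_norm ?lerDl ?subr_gt0 ?oppr_ge0//.
    exact: le_lt_trans c0.
  - by rewrite subrr normr0.
split => //.
- move=> x Dx; have := P (f x) 0; rewrite (@pospow_le 0 0)// !subr0 => h1.
  exact: le_trans h1 (b x Dx).
- by move=> x y Dx Dy; apply: le_trans (P _ _) (h x y Dx Dy).
- move=> e e0; have [r r0 hr] := u e e0; exists r => // x y Dx Dy xy.
  by apply: le_lt_trans (P _ _) _; apply: hr.
Qed.

Lemma lv_pospow d (D : set 'rV[R]_d) (theta M : R) k f :
  lv D theta M f -> exists M', lv D theta M' (fun x => pospow k.+1 (f x)).
Proof.
move=> /lv_pospow1 l; elim: k => [|k [M' IH]]; first by exists M.
exists (2 * M * M'); have := lvM l IH.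
by congr lv; apply/funext => x; rewrite /pospow expr1 -exprS.
Qed.

Lemma reg_pospow d (D : set 'rV[R]_d) (theta : R) k f : 0 <= theta <= 1 -> open D ->
  reg D theta k f -> reg D theta k (fun x => pospow k.+1 (f x)).
Proof.
move=> t01 oD; elim: k => [|k IH] rf; have [M hf] := rf.
  by exists M; split => //; apply: lv_pospow1; apply: hcls_lv hf.
have rp := IH (reg_leq (leqnSn k) rf).
have : forall i, exists M', hcls D theta k M'
    (fun x => k.+2%:R * pospow k.+1 (f x) * pd i f x).
  by move=> i; do ?apply: regM => //; [exact: reg_cst|exact: reg_pd].
move/choice => [M' hM'].
have [M1 l] := lv_pospow k.+1 (hcls_lv hf).
exists (M1 + \sum_i `|M' i|).
apply: (@hclsS_intro _ _ _ _ oD _ _ _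
  (fun i x => k.+2%:R * pospow k.+1 (f x) * pd i f x)).
- by apply: lv_le l; rewrite lerDl sumr_ge0.
- move=> i x Dx.
  have dfx : derivable f x (axis R i) by apply: hcls_derivable hf Dx.
  apply: is_derive_comp1; first exact: is_derive_pd.
  exact: is_derive_pospow.
- move=> i; apply: hcls_le (hM' i).
  rewrite (bigD1 i)//= addrCA; apply: le_trans (ler_norm _) _.
  rewrite lerDl addr_ge0//; last by rewrite sumr_ge0.
  by case: l.
Qed.

End Positive_part.

Lemma open_norm_gt (R : realType) d (x0 : 'rV[R]_d) (r : R) :
  open [set z | r < `|z - x0|].
Proof.
rewrite openE => x /= xr; apply/nbhs_ballP; exists (`|x - x0| - r); first by rewrite /= subr_gt0.
move=> y; rewrite ball_norm /= => xy; rewrite distrC in xy.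
have : `|x - x0| <= `|x - y| + `|y - x0| by rewrite -(subrKA y) ler_normD.
by lra.
Qed.

Lemma hclsB (R : realType) d (D : set 'rV[R]_d) (theta : R) k M M' (f g : 'rV[R]_d -> R) : open D ->
  hcls D theta k M f -> hcls D theta k M' g ->
  hcls D theta k (M + M') (fun x => f x - g x).
Proof.
move=> oD hf hg; have := hclsD oD hf (hclsZ oD (-1) hg).
rewrite normrN1 mul1r; apply: hcls_ext => // x _.
by rewrite mulN1r.
Qed.

(** * Extension by zero and cut-off functions *)

Section Zero_extension.
Variables (R : realType) (d : nat) (theta : R).
Hypothesis theta01 : 0 <= theta <= 1.

Lemma hcls_zero_ext k (x0 : 'rV[R]_d) (r : R) : 0 < r ->
  exists2 C, 0 <= C & forall M f, hcls (ball x0 (2 * r)) theta k M f ->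
    (forall x, r < `|x - x0| -> f x = 0) -> hcls setT theta k (C * M) f.
Proof.
move=> r0; have [th0 th1] := andP theta01.
pose s := Num.min 1 r.
have s0 : 0 < s by rewrite lt_min ltr01 r0.
have sV : 0 <= s^-1 by rewrite invr_ge0 ltW.
have sr (a : R) : r <= a -> 1 <= s^-1 * a `^ theta.
  move=> ra; rewrite ler_pdivlMl// mulr1.
  have a0 : 0 < a by apply: lt_le_trans ra.
  have [a1|/ltW a1] := leP a 1.
    by apply: le_trans (powR_ge_min theta01 (ltW a0) a1); rewrite ge_min ra orbT.
  by apply: le_trans (powR_ge1 theta01 a1); rewrite ge_min lexx.
exists (1 + s^-1); first by rewrite addr_ge0.
move=> M f.
have B x : `|x - x0| < 2 * r -> ball x0 (2 * r) x by rewrite ball_norm.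
have far x y : `|x - x0| <= r -> 2 * r <= `|y - x0| -> r <= `|x - y|.
  move=> xr yr; have : `|y - x0| <= `|x - y| + `|x - x0|.
    by rewrite -(subrKA x) distrC ler_normD.
  by lra.
have near2 x y : `|x - x0| <= r -> `|x - y| < r -> `|y - x0| < 2 * r.
  by move=> xr xy; rewrite ltNge; apply/negP => /(far _ _ xr); rewrite leNgt xy.
have r2 x : `|x - x0| <= r -> `|x - x0| < 2 * r by lra.
have L g : lv (ball x0 (2 * r)) theta M g -> (forall x, r < `|x - x0| -> g x = 0) ->
    lv setT theta ((1 + s^-1) * M) g.
  move=> [M0 b h u] g0; have MM : M <= (1 + s^-1) * M.
    by rewrite mulrDl mul1r lerDl mulr_ge0.
  have b' x : `|g x| <= M.
    have [xr|xr] := leP `|x - x0| r; first by apply: b; apply: B; apply: r2.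
    by rewrite g0// normr0.
  have h' x y : `|x - x0| <= r -> `|g x - g y| <= (1 + s^-1) * M * `|x - y| `^ theta.
    move=> xr; have [yr|yr] := ltP `|y - x0| (2 * r).
      apply: le_trans (h x y (B _ (r2 _ xr)) (B _ yr)) _.
      by rewrite ler_wpM2r// powR_ge0.
    rewrite (g0 y); last by apply: lt_le_trans yr; lra.
    rewrite subr0; apply: le_trans (b' x) _.
    rewrite mulrAC; apply: (@le_trans _ _ (1 * M)); first by rewrite mul1r.
    rewrite ler_wpM2r// mulrDl; apply: le_trans (sr _ (far _ _ xr yr)) _.
    by rewrite lerDr mul1r powR_ge0.
  split => //; first by rewrite mulr_ge0// addr_ge0.
  - by move=> x _; apply: le_trans (b' x) _.
  - move=> x y _ _; have [xr|xr] := leP `|x - x0| r; first exact: h'.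
    have [yr|yr] := leP `|y - x0| r.
      by rewrite distrC [`|x - y|]distrC; apply: h'.
    rewrite !g0// subrr normr0 !mulr_ge0 ?powR_ge0//.
    by rewrite addr_ge0.
  - move=> e e0; have [t t0 ht] := u e e0.
    exists (Num.min t r); first by rewrite lt_min t0.
    move=> x y _ _; rewrite lt_min => /andP[xt xr].
    have [xx|xx] := leP `|x - x0| r.
      by apply: ht => //; apply: B; [apply: r2|apply: near2 xx xr].
    have [yy|yy] := leP `|y - x0| r.
      apply: ht => //; apply: B; last exact: r2.
      by apply: near2 yy _; rewrite distrC.
    by rewrite !g0// subrr normr0.
elim: k f => [|k IH] f [l h] f0; (split; first exact: L) => // i.
have [h1 h2] := h i.
have oF := @open_norm_gt R d x0 r.
have E : {in [set z : 'rV[R]_d | r < `|z - x0|], (fun=> 0) =1 f}.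
  by move=> x; rewrite inE/= => xr; rewrite f0.
split.
  move=> x _; have [xr|xr] := leP `|x - x0| r; first by apply: h1; apply: B; apply: r2.
  apply: (eq_on_derivable oF E); last exact: derivable_cst.
  by [].
apply: IH => // x xr; rewrite -(eq_on_pd oF i E).
  by apply: pd_val; exact: is_derive_cst.
by rewrite inE.
Qed.

Lemma hcls_coord (D : set 'rV[R]_d) k i (M : R) : open D -> 0 <= M ->
  (forall x, D x -> `|x ord0 i| <= M) ->
  hcls D theta k (1 + 2 * M) (fun x => x ord0 i).
Proof.
move=> oD M0 b.
have l : lv D theta (1 + 2 * M) (fun x => x ord0 i).
  apply: lv_lip => // x y _ _; rewrite mul1r.
  by have := rV_norm_coord (x - y) i; rewrite !mxE.
case: k => [|k]; first by split.
apply: (@hclsS_intro _ _ _ _ oD _ _ _ (fun j x => (j == i)%:R)) => //.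
  by move=> j x Dx; rewrite -axisE; exact: is_derive_coord.
move=> j; apply: (@hcls_le _ _ _ _ _ `|(j == i)%:R|); last exact: hcls_cst.
apply: (@le_trans _ _ 1); last by rewrite lerDl mulr_ge0.
by case: eqP => _; rewrite ?normr1 ?normr0.
Qed.

Lemma bump_exists k (x0 : 'rV[R]_d) (r : R) : 0 < r ->
  exists psi : 'rV[R]_d -> R, [/\ reg setT theta k psi,
    forall x, `|x - x0| < r / 2 -> psi x = 1 &
    forall x, r < `|x - x0| -> psi x = 0].
Proof.
move=> r0.
(* With the factor 4 / 3, [t i] is at least 1 when the i-th coordinate is within r / 2 of that of
   x0, and at most 0 when it is r or more away. *)
pose t (i : 'I_d) (x : 'rV[R]_d) := (4 / 3) * (1 - (r^-1 * (x ord0 i - x0 ord0 i)) ^+ 2).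
(* Each factor is 0 for [t i x <= 0] and 1 for [t i x >= 1]. A product over coordinates suits balls
   of the sup norm. *)
pose psi (x : 'rV[R]_d) := \prod_i (1 - pospow k.+1 (1 - pospow k.+1 (t i x))).
have oB : open (ball x0 (2 * r)) by apply: ball_open; rewrite mulr_gt0.
have rp : reg (ball x0 (2 * r)) theta k psi.
  apply: reg_prod => // i _; apply: regB => //; first exact: reg_cst.
  apply: reg_pospow => //; apply: regB => //; first exact: reg_cst.
  apply: reg_pospow => //; apply: regM => //; first exact: reg_cst.
  apply: regB => //; first exact: reg_cst.
  apply: reg_exp => //; apply: regM => //; first exact: reg_cst.
  apply: regB => //; last exact: reg_cst.
  exists (1 + 2 * (`|x0| + 2 * r)); apply: hcls_coord => //.
    by rewrite addr_ge0// mulr_ge0// ltW.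
  move=> x; rewrite ball_norm => /ltW xr.
  apply: le_trans (rV_norm_coord x i) _; rewrite -[X in `|X|](subrK x0) addrC.
  by apply: le_trans (ler_normD _ _) _; rewrite lerD2l.
have psi0 x : r < `|x - x0| -> psi x = 0.
  move=> xr; have [i ri] : exists i, r < `|x ord0 i - x0 ord0 i|.
    apply: contrapT => /forallNP h; move: xr; rewrite ltNge => /negP; apply.
    apply/(rV_norm_le _ (ltW r0)) => i; rewrite !mxE leNgt; apply/negP; exact: h.
  rewrite /psi (bigD1 i)//= (@pospow_le _ _ (t i x)).
    by rewrite subr0 pospow_ge// expr1n subrr mul0r.
  rewrite /t pmulr_rle0 ?subr_le0 ?divr_gt0//.
  rewrite -real_normK ?num_real// exprn_ege1// normrM normfV (gtr0_norm r0).
  by rewrite ler_pdivlMl// mulr1 ltW.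
have [C C0 hC] := hcls_zero_ext k x0 r0.
exists psi; split => //; first by have [M hM] := rp; exists (C * M); apply: hC.
move=> x xr; rewrite /psi big1// => i _.
rewrite (@pospow_le _ _ (1 - _)) ?subr0//.
have w : (r^-1 * (x ord0 i - x0 ord0 i)) ^+ 2 <= 4^-1.
  have := le_lt_trans (rV_norm_coord (x - x0) i) xr; rewrite !mxE => /ltW h.
  rewrite -real_normK ?num_real// normrM normfV (gtr0_norm r0).
  have -> : (4^-1 : R) = (2^-1) ^+ 2 by rewrite exprVn -natrX.
  rewrite ler_sqr ?nnegrE ?mulr_ge0 ?invr_ge0 ?(ltW r0)//.
  by rewrite ler_pdivrMl.
have t1 : 1 <= t i x by rewrite /t; lra.
by rewrite subr_le0 pospow_ge ?exprn_ege1// (le_trans _ t1).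
Qed.

End Zero_extension.

(** * The lift off a hyperplane *)

Section Averages.
Variable R : realType.
Implicit Types (f g : R -> R) (Lam : (R -> R) -> R).

Definition C01 f := {within `[0, 1], continuous f}.

Lemma C01P f : C01 f <->
  (forall x : R, `[0%R, 1%R]%classic x -> f @ within `[0%R, 1%R]%classic (nbhs x) --> f x).
Proof. exact: subspace_continuousP. Qed.

Lemma C01_unif f :
  (forall e : R, 0 < e -> exists2 r : R, 0 < r & forall u v : R,
     0 <= u <= 1 -> 0 <= v <= 1 -> `|u - v| < r -> `|f u - f v| < e) -> C01 f.
Proof.
move=> h; apply/C01P => x /=; rewrite in_itv/= => x01.
apply/cvgrPdist_lt => e e0; have [r r0 hr] := h e e0.
rewrite near_withinE; near=> y; rewrite /= in_itv/= => y01.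
by apply: hr => //; near: y; apply/nbhs_ballP; exists r => // z; rewrite /ball/=.
Unshelve. all: by end_near. Qed.

Lemma C01D f g : C01 f -> C01 g -> C01 (fun u => f u + g u).
Proof. by move=> /C01P cf /C01P cg; apply/C01P => x x01; apply: cvgD; auto. Qed.

Lemma C01M f g : C01 f -> C01 g -> C01 (fun u => f u * g u).
Proof. by move=> /C01P cf /C01P cg; apply/C01P => x x01; apply: cvgM; auto. Qed.

Lemma C01_cst a : C01 (fun=> a).
Proof. by apply/C01P => x x01; apply: cvg_cst. Qed.

Lemma C01_id : C01 (fun u => u).
Proof. by apply: C01_unif => e e0; exists e. Qed.

Lemma C01_exp f n : C01 f -> C01 (fun u => f u ^+ n).
Proof.
move=> cf; elim: n => [|n IH]; first exact: C01_cst.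
have := C01M cf IH; by congr C01; apply/funext => u; rewrite exprS.
Qed.

Lemma C01_derive f (df : R -> R) :
  (forall u : R, 0 <= u <= 1 -> is_derive u 1 f (df u)) -> C01 f.
Proof.
move=> h; apply: derivable_within_continuous => x; rewrite in_itv/= => x01.
by case: (h x x01).
Qed.

(** Linear functionals of norm at most 1 on C([0, 1]). Differentiating an average in x_0 produces
    the weight u, and the fundamental theorem produces evaluation at u = 1, so one set of estimates
    has to cover [int01], [mulu int01] and [eval1]. *)
Definition avgf Lam :=
  (forall a f g, C01 f -> C01 g -> Lam (fun u => a * f u + g u) = a * Lam f + Lam g) /\
  (forall f M, C01 f -> (forall u, 0 <= u <= 1 -> `|f u| <= M) -> `|Lam f| <= M).

Lemma avgf_sub Lam a f g : avgf Lam -> C01 f -> C01 g ->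
  Lam (fun u => f u - a * g u) = Lam f - a * Lam g.
Proof.
move=> [lin _] cf cg; rewrite -mulNr addrC -lin//.
by congr Lam; apply/funext => u; rewrite addrC mulNr.
Qed.

Lemma avgf_ext Lam f g : avgf Lam -> C01 f -> C01 g ->
  (forall u, 0 <= u <= 1 -> f u = g u) -> Lam f = Lam g.
Proof.
move=> aL cf cg fg; apply/eqP; rewrite -subr_eq0 -normr_le0 -[Lam g]mul1r -avgf_sub//.
apply: aL.2.
  by apply: C01D => //; have := C01M (@C01_cst (-1)) cg; congr C01; apply/funext => u; ring.
by move=> u u01; rewrite mul1r fg// subrr normr0.
Qed.

Lemma avgf0 Lam : avgf Lam -> Lam (fun=> 0) = 0.
Proof.
move=> aL; apply/eqP; rewrite -normr_le0; apply: aL.2; first exact: C01_cst.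
by move=> u _; rewrite normr0.
Qed.

Lemma avgfZ Lam a f : avgf Lam -> C01 f -> Lam (fun u => a * f u) = a * Lam f.
Proof.
move=> aL cf; rewrite -[RHS]addr0 -(avgf0 aL) -aL.1//; last exact: C01_cst.
by congr Lam; apply/funext => u; rewrite addr0.
Qed.

Definition mulu Lam : (R -> R) -> R := fun f => Lam (fun u => u * f u).

Lemma avgf_mulu Lam : avgf Lam -> avgf (mulu Lam).
Proof.
move=> [lin bnd]; split=> [a f g cf cg|f M cf b].
  rewrite /mulu -lin; [|exact: C01M C01_id _..].
  by congr Lam; apply/funext => u; ring.
apply: bnd; first exact: C01M C01_id _.
move=> u u01; rewrite normrM -[X in _ <= X]mul1r; apply: ler_pM => //; last exact: b.
by case/andP: u01 => ? ?; rewrite ger0_norm.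
Qed.

Definition eval1 : (R -> R) -> R := fun f => f 1.

Lemma avgf_eval1 : avgf eval1.
Proof. by split => // f M _; apply; rewrite ler01 lexx. Qed.

Definition int01 : (R -> R) -> R :=
  fun f => (\int[@lebesgue_measure R]_(u in `[0%R, 1%R]) f u)%R.

Lemma C01_integrable f : C01 f ->
  (@lebesgue_measure R).-integrable `[0%R, 1%R] (EFin \o f).
Proof. by move=> cf; apply: continuous_compact_integrable => //; exact: segment_compact. Qed.

Lemma int01_derive F f : C01 f ->
  (forall u : R, 0 <= u <= 1 -> is_derive u 1 F (f u)) -> int01 f = F 1 - F 0.
Proof.
move=> cf dF; rewrite /int01 /Rintegral (@continuous_FTC2 R f F 0 1)//.
- have cF (u : R) : 0 <= u <= 1 -> F @ u --> F u.
    move=> u01; have [d _] := dF u u01.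
    exact/differentiable_continuous/derivable1_diffP.
  split.
  + by move=> u; rewrite in_itv/= => /andP[u0 u1]; have [] := dF u; rewrite ?ltW.
  + by apply: cvg_at_right_filter; apply: cF; rewrite lexx ler01.
  + by apply: cvg_at_left_filter; apply: cF; rewrite lexx ler01.
- move=> u; rewrite in_itv/= => /andP[u0 u1].
  have u01 : 0 <= u <= 1 by rewrite !ltW.
  by rewrite derive1E; have [_ ->] := dF u u01.
Qed.

Lemma int01_cst a : int01 (fun=> a) = a.
Proof.
have d (u : R) : 0 <= u <= 1 -> is_derive u 1 (fun u : R => a * u) a.
  by move=> _; have := @is_deriveZ R _ _ id a u 1 1 _; rewrite [a *: 1]mulr1; apply.
by rewrite (int01_derive (@C01_cst a) d) mulr1 mulr0 subr0.
Qed.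

Lemma avgf_int01 : avgf int01.
Proof.
split=> [a f g cf cg|f M cf b].
  have caf : C01 (fun u => a * f u) by apply: C01M => //; exact: C01_cst.
  rewrite /int01 RintegralD; [|exact: measurable_itv|exact: C01_integrable..].
  by rewrite RintegralZl; [|exact: measurable_itv|exact: C01_integrable].
apply: le_trans (le_normr_Rintegral _ _) _; first exact: measurable_itv.
  exact: C01_integrable.
have cn : C01 (fun u => `|f u|).
  by apply/C01P => x x01; apply: cvg_norm; move/C01P : cf; apply.
rewrite -[leRHS]int01_cst; apply: le_Rintegral.
- exact: measurable_itv.
- exact: C01_integrable.
- by apply: C01_integrable; exact: C01_cst.
- by move=> u; rewrite /= in_itv/= => u01; apply: b.
Qed.

(** The factor by which the normal average multiplies a q-th normal derivative on the hyperplane; it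
    cancels the factor q + 1 that multiplication by x_0 produces. *)
Lemma int01_onem_exp q : int01 (fun u => (1 - u) ^+ q) = q.+1%:R^-1.
Proof.
have d (u : R) : is_derive u 1 (fun u : R => - q.+1%:R^-1 * (1 - u) ^+ q.+1) ((1 - u) ^+ q).
  have d1 : is_derive u 1 (fun u : R => 1 - u) (-1 : R).
    by have := @is_deriveB R _ _ (cst (1 : R)) id u 1 0 1 _ _; rewrite sub0r; apply.
  have d2 := @is_deriveX R _ _ q.+1 u 1 _ d1.
  rewrite exprfctE in d2.
  have d3 := @is_deriveZ R _ _ _ (- q.+1%:R^-1) u 1 _ d2.
  apply: (is_derive_eq d3).
  by rewrite /GRing.scale/= mulrN1 mulrNN mulrA mulVf ?mul1r ?pnatr_eq0.
rewrite (int01_derive _ (fun u _ => d u)).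
  by rewrite subrr subr0 expr0n /= mulr0 expr1n mulr1 sub0r opprK.
by apply: C01_exp; apply: (C01_derive (df := fun=> -1)) => u _;
  have := @is_deriveB R _ _ (cst (1 : R)) id u 1 0 1 _ _; rewrite sub0r; apply.
Qed.

End Averages.

Lemma is_derive_eps (R : realType) (V : normedModType R) (F : V -> R) (x v : V) (l : R) :
  (forall e : R, 0 < e -> exists2 r : R, 0 < r & forall h : R, `|h| < r ->
     `|F (h *: v + x) - F x - h * l| <= e * `|h|) ->
  is_derive x v F l.
Proof.
move=> H; suff C : (fun h : R => h^-1 *: ((F \o shift x) (h *: v) - F x)) @ 0^' --> l.
  by apply: DeriveDef; [apply/cvg_ex; exists l|apply/cvg_lim].
apply/cvgrPdist_le => e e0; have [r r0 hr] := H e e0.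
near=> h.
have h0 : h != 0 by near: h; exact: nbhs_dnbhs_neq.
have hh : `|h| < r by near: h; apply: dnbhs0_lt.
rewrite /= distrC -(ler_pM2l (_ : 0 < `|h|)) ?normr_gt0// -normrM mulrBr.
rewrite [h * (_ *: _)]mulrA divff// mul1r [leRHS]mulrC.
exact: hr.
Unshelve. all: by end_near. Qed.

(** * Averages along segments that shrink at a hyperplane *)

Section Segments.
Variables (R : realType) (n : nat).
Notation pt := 'rV[R]_n.+1.
Implicit Types (f g : pt -> R) (x y z : pt) (i j : 'I_n.+1) (Lam : (R -> R) -> R).

(** Bounded in x_0, so that multiplication by x_0 is a bounded operation; unbounded in the other
    directions, so that the tangential segments stay inside. *)
Definition slab : set pt := [set x | `|x ord0 ord0| < 1].

Lemma slab_open : open slab.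
Proof.
rewrite openE => x /= x1; apply/nbhs_ballP; exists (1 - `|x ord0 ord0|).
  by rewrite /= subr_gt0.
move=> y; rewrite ball_norm /slab /= => xy.
have h := rV_norm_coord (y - x) ord0; rewrite !mxE in h.
rewrite -(subrK (x ord0 ord0) (y ord0 ord0)); apply: le_lt_trans (ler_normD _ _) _.
by rewrite -ltrBrDr; apply: le_lt_trans h xy.
Qed.

Lemma slab_boxy : boxy slab.
Proof.
move=> x y z; rewrite /slab /= => x1 y1 /(_ ord0) h.
have := @minmax_dist R (x ord0 ord0) (y ord0 ord0) (z ord0 ord0) 0
  (Num.max `|x ord0 ord0| `|y ord0 ord0|).
rewrite !subr0 => /(_ _ _ h) k; apply: le_lt_trans (k _ _) _.
- by rewrite le_max lexx.
- by rewrite le_max lexx orbT.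
- by rewrite gt_max x1 y1.
Qed.

(* The segment degenerates to the point [x] on the hyperplane [x ord0 ord0 = 0],
   so averaging along it does not change traces. *)
Definition path_pt i x (u : R) : pt := x - (x ord0 ord0 * u) *: axis R i.

Definition avg_op i Lam f : pt -> R := fun x => Lam (fun u => f (path_pt i x u)).

Lemma path_coord i x u :
  path_pt i x u ord0 ord0 = x ord0 ord0 * (1 - (i == ord0)%:R * u).
Proof. by rewrite !mxE eqxx andTb eq_sym mulrBr mulr1 mulrAC mulrA; case: eqP => _; rewrite ?mulr1 ?mul1r ?mulr0 ?mul0r. Qed.

Lemma path_slab i x u : slab x -> 0 <= u <= 1 -> slab (path_pt i x u).
Proof.
rewrite /slab /= path_coord normrM => x1 /andP[u0 u1].
apply: le_lt_trans x1; apply: ler_piMr => //.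
by case: (i == ord0) => /=; rewrite ?mul1r ?mul0r ler_norml; apply/andP; split; lra.
Qed.

Lemma path_shift i x (v : pt) u : path_pt i (v + x) u = path_pt i x u + (v - (v ord0 ord0 * u) *: axis R i).
Proof. by rewrite /path_pt !mxE mulrDl scalerDl opprD addrACA addrC. Qed.

Lemma path_shift_norm i (v : pt) (u : R) : 0 <= u <= 1 ->
  `|v - (v ord0 ord0 * u) *: axis R i| <= 2 * `|v|.
Proof.
move=> /andP[u0 u1]; apply: le_trans (ler_normB _ _) _.
rewrite normrZ norm_axis mulr1 mulr_natl mulr2n lerD2l normrM.
apply: le_trans (rV_norm_coord v ord0); apply: ler_piMr => //.
by rewrite ger0_norm.
Qed.

Lemma C01_path f i x : unifc slab f -> slab x -> C01 (fun u => f (path_pt i x u)).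
Proof.
move=> uf sx; apply: C01_unif => e e0; have [r r0 hr] := uf e e0.
exists r => // u v u01 v01 uv; apply: hr; try exact: path_slab.
rewrite /path_pt opprB addrC subrKA -scalerBl -mulrBr normrZ norm_axis mulr1 normrM.
by apply: le_lt_trans uv; rewrite distrC; apply: ler_piMl => //; apply: ltW.
Qed.

End Segments.
Arguments C01_path [R n f] i [x] _ _.

Section Averaging_operators.
Variables (R : realType) (n : nat) (theta : R).
Hypothesis theta01 : 0 <= theta <= 1.
Notation pt := 'rV[R]_n.+1.
Notation slab := (@slab R n).
Implicit Types (f g : pt -> R) (x y z : pt) (i j : 'I_n.+1) (Lam : (R -> R) -> R).

Let oS : open slab. Proof. exact: slab_open. Qed.
Let bS : boxy slab. Proof. exact: slab_boxy. Qed.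

Lemma lv_unifc M f : lv slab theta M f -> unifc slab f.
Proof. by case. Qed.

Lemma avg_op_lin i Lam a f g h M M' M'' : avgf Lam ->
  lv slab theta M f -> lv slab theta M' g -> lv slab theta M'' h ->
  (forall x, slab x -> h x = a * f x + g x) ->
  forall x, slab x -> avg_op i Lam h x = a * avg_op i Lam f x + avg_op i Lam g x.
Proof.
move=> aL /lv_unifc uf /lv_unifc ug /lv_unifc uh E x sx.
have cf := C01_path i uf sx; have cg := C01_path i ug sx; have ch := C01_path i uh sx.
rewrite /avg_op -aL.1//; apply: avgf_ext => //.
  by apply: C01D => //; apply: C01M => //; exact: C01_cst.
by move=> u u01; apply: E; apply: path_slab.
Qed.

Lemma path_dist i x y (u : R) : 0 <= u <= 1 -> `|path_pt i x u - path_pt i y u| <= 2 * `|x - y|.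
Proof.
move=> u01; rewrite -{1}(subrK y x) path_shift addKx.
exact: path_shift_norm.
Qed.

Lemma avg_op_sub i Lam f x y : avgf Lam -> unifc slab f -> slab x -> slab y ->
  forall K, (forall u, 0 <= u <= 1 -> `|f (path_pt i x u) - f (path_pt i y u)| <= K) ->
  `|avg_op i Lam f x - avg_op i Lam f y| <= K.
Proof.
move=> aL uf sx sy K h.
have cx := C01_path i uf sx; have cy := C01_path i uf sy.
rewrite /avg_op -[X in _ - X]mul1r -avgf_sub//; apply: aL.2.
  by apply: C01D => //; have := C01M (@C01_cst R (-1)) cy; congr C01; apply/funext => u; ring.
by move=> u u01; rewrite mul1r; apply: h.
Qed.

(** The factor 2 is the Lipschitz constant of x |-> [path_pt i x u], uniformly in u. *)
Lemma lv_avg_op i Lam M f : avgf Lam -> lv slab theta M f ->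
  lv slab theta (2 * M) (avg_op i Lam f).
Proof.
move=> aL [M0 b h u]; have [th0 th1] := andP theta01.
have M2 : M <= 2 * M by rewrite mulr_natl mulr2n lerDl.
split; first exact: mulr_ge0.
- move=> x sx; apply: le_trans M2; apply: aL.2; first exact: C01_path.
  by move=> v v01; apply: b; apply: path_slab.
- move=> x y sx sy; apply: avg_op_sub => // v v01.
  apply: le_trans (h _ _ (path_slab i sx v01) (path_slab i sy v01)) _.
  rewrite [2 * M]mulrC -mulrA; apply: ler_wpM2l => //.
  apply: (@le_trans _ _ ((2 * `|x - y|) `^ theta)).
    apply: ge0_ler_powR => //; rewrite ?nnegrE//.
    exact: path_dist.
  rewrite powRM//; apply: ler_wpM2r; first exact: powR_ge0.
  by apply: ler1_powR => //; rewrite ler1n.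
- move=> e e0; have e2 : 0 < e / 2 by rewrite divr_gt0.
  have [r r0 hr] := u _ e2.
  exists (r / 2); first by rewrite divr_gt0.
  move=> x y sx sy; rewrite ltr_pdivlMr// mulrC => xy.
  apply: (@le_lt_trans _ _ (e / 2)).
    apply: avg_op_sub => // v v01; apply/ltW/hr; try exact: path_slab.
    by apply: le_lt_trans (path_dist _ _ _ v01) xy.
  by rewrite ltr_pdivrMr// mulr_natr mulr2n ltrDl.
Qed.

(** Moving x by v moves the path point by v - u v_0 e_i. The first order Taylor remainder of f is
    small uniformly in u, and Lam has norm at most 1, so the expansion passes through Lam. *)
Lemma is_derive_avg_op i Lam k M f j x : avgf Lam -> hcls slab theta k.+1 M f ->
  slab x -> is_derive x (axis R j) (avg_op i Lam f)
    (avg_op i Lam (pd j f) x - (j == ord0)%:R * avg_op i (mulu Lam) (pd i f) x).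
Proof.
move=> aL hf sx; apply: is_derive_eps => e e0.
have uf := lv_unifc (hcls_lv hf).
have ud l : unifc slab (pd l f) by exact: lv_unifc (hcls_lv (hcls_pd l hf)).
pose d : R := n.+1%:R.
have d0 : 0 < d by rewrite ltr0n.
(* [taylor1] gives d * e' * |v u|, and |v u| <= 2 * |h|. The same factor 2 explains the radius r / 2
   below. *)
pose e' := e / (2 * d).
have e'0 : 0 < e' by rewrite divr_gt0// mulr_gt0.
have /choice[s hs] : forall l : 'I_n.+1, exists s : R, 0 < s /\ forall z w, slab z -> slab w ->
    `|z - w| < s -> `|pd l f z - pd l f w| < e'.
  by move=> l; have [s s0 h] := ud l e' e'0; exists s.
have [r0 r00 hr0] := open_ball oS sx.
pose r := \big[Num.min/r0]_l s l.
have r_gt0 : 0 < r by apply/bigmin_gtP; split => // l _; case: (hs l).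
exists (r / 2); first by rewrite divr_gt0.
move=> h; rewrite ltr_pdivlMr// mulrC => hr.
have hh : `|h| < r.
  by apply: le_lt_trans hr; rewrite mulr_natl mulr2n lerDl.
have sx' : slab (h *: axis R j + x).
  apply: hr0; rewrite ball_norm addrK normrZ norm_axis mulr1.
  by apply: lt_le_trans hh _; apply: bigmin_le_id.
have c1 := C01_path i uf sx'; have c2 := C01_path i uf sx.
have c3 := C01_path i (ud j) sx; have c4 := C01_path i (ud i) sx.
pose v u : pt := h *: axis R j - ((h *: axis R j) ord0 ord0 * u) *: axis R i.
pose rem u := f (path_pt i x u + v u) - f (path_pt i x u) -
  \sum_l (v u) ord0 l * pd l f (path_pt i x u).
have vn u : 0 <= u <= 1 -> `|v u| <= 2 * `|h|.
  move=> u01; apply: le_trans (path_shift_norm i (h *: axis R j) u01) _.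
  by rewrite normrZ norm_axis mulr1.
have Esum u z : \sum_l (v u) ord0 l * pd l f z =
    h * (pd j f z - (j == ord0)%:R * (u * pd i f z)).
  have E l : (v u) ord0 l * pd l f z =
      (if l == j then h * pd j f z else 0) +
      (if l == i then - (h * (j == ord0)%:R * u * pd i f z) else 0).
    rewrite /v !mxE !eqxx !andTb [ord0 == j]eq_sym.
    have P (q : 'I_n.+1) (a : R) : a * (l == q)%:R * pd l f z = if l == q then a * pd q f z else 0.
      by have [->|_] := eqVneq l q; rewrite ?mulr1// mulr0 mul0r.
    by rewrite mulrBl !P; congr (_ + _); case: (l == i); rewrite ?oppr0.
  rewrite (eq_bigr _ (fun l _ => E l)) big_split/= -!big_mkcond/= !big_pred1_eq.
  ring.
have remb u : 0 <= u <= 1 -> `|rem u| <= e * `|h|.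
  move=> u01; have T := @taylor1 R n.+1 slab f e' (path_pt i x u) (v u) bS.
  apply: (@le_trans _ _ (d * e' * `|v u|)).
    apply: T => //.
    - by move=> z l sz; apply: hcls_derivable hf sz.
    - exact: path_slab.
    - by rewrite -path_shift; apply: path_slab.
    - move=> z l sz zx; apply/ltW; apply: (hs l).2 => //; first exact: path_slab.
      apply: le_lt_trans zx (le_lt_trans (vn u u01) (lt_le_trans hr _)).
      by apply: bigmin_le_cond.
  apply: (@le_trans _ _ (d * e' * (2 * `|h|))).
    by rewrite ler_wpM2l ?vn// mulr_ge0// ltW.
  rewrite mulrA ler_wpM2r// /e'.
  by have -> : d * (e / (2 * d)) * 2 = e by field; rewrite lt0r_neq0.
have crem : C01 rem.
  have -> : rem = fun u => (f (path_pt i (h *: axis R j + x) u) + (-1) * f (path_pt i x u)) +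
     (- h * pd j f (path_pt i x u) + (h * (j == ord0)%:R) * (u * pd i f (path_pt i x u))).
    by apply/funext => u; rewrite /rem Esum -path_shift; ring.
  apply: C01D; apply: C01D => //; apply: C01M => //; try exact: C01_cst.
  by apply: C01M => //; exact: C01_id.
have -> : avg_op i Lam f (h *: axis R j + x) - avg_op i Lam f x -
    h * (avg_op i Lam (pd j f) x - (j == ord0)%:R * avg_op i (mulu Lam) (pd i f) x) = Lam rem.
  have -> : rem = fun u => 1 * f (path_pt i (h *: axis R j + x) u) +
     ((-1) * f (path_pt i x u) +
     (- h * pd j f (path_pt i x u) + (h * (j == ord0)%:R) * (u * pd i f (path_pt i x u)))).
    by apply/funext => u; rewrite /rem Esum -path_shift; ring.
  have cu : C01 (fun u => u * pd i f (path_pt i x u)) by apply: C01M => //; exact: C01_id.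
  have cu' : C01 (fun u => h * (j == ord0)%:R * (u * pd i f (path_pt i x u))).
    by apply: C01M => //; exact: C01_cst.
  have cj' : C01 (fun u => - h * pd j f (path_pt i x u)).
    by apply: C01M => //; exact: C01_cst.
  have cx' : C01 (fun u => (-1) * f (path_pt i x u)).
    by apply: C01M => //; exact: C01_cst.
  rewrite aL.1//; last by apply: C01D => //; exact: C01D.
  rewrite aL.1//; last exact: C01D.
  rewrite aL.1// avgfZ// /avg_op /mulu; ring.
exact: aL.2.
Qed.

(** The constant has to be uniform in Lam, as the induction on k passes from Lam to [mulu Lam]. *)
Lemma hcls_avg_op i k : exists2 C, 0 <= C & forall Lam, avgf Lam -> forall M f,
  hcls slab theta k M f -> hcls slab theta k (C * M) (avg_op i Lam f).
Proof.
elim: k => [|k [C C0 IH]].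
  by exists 2 => // Lam aL M f [l _]; split => //; apply: lv_avg_op.
exists (2 + 2 * C); first by rewrite addr_ge0// mulr_ge0.
move=> Lam aL M f hf; have M0 := hcls_ge0 hf.
apply: (@hclsS_intro _ _ _ _ oS _ _ _ (fun j x => avg_op i Lam (pd j f) x +
   (- (j == ord0)%:R) * avg_op i (mulu Lam) (pd i f) x)).
- apply: (@lv_le _ _ _ _ (2 * M)); first by rewrite ler_wpM2r// lerDl mulr_ge0.
  by apply: lv_avg_op => //; exact: hcls_lv hf.
- by move=> j x sx; rewrite mulNr; apply: is_derive_avg_op aL hf sx.
- move=> j; have h1 := IH _ aL _ _ (hcls_pd j hf).
  have h2 := IH _ (avgf_mulu aL) _ _ (hcls_pd i hf).
  have CM : 0 <= C * M by exact: mulr_ge0.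
  apply: hcls_le (hclsD oS h1 (hclsZ oS _ h2)).
  rewrite mulrDl [2 * C * M]mulrAC [2 * M * C]mulrAC -mulrA [2 * (C * M)]mulr_natl mulr2n.
  have : `|- (j == ord0)%:R : R| * (C * M) <= C * M.
    by apply: ler_piMl => //; case: (j == ord0); rewrite normrN ?normr1 ?normr0.
  have : 0 <= 2 * M by exact: mulr_ge0.
  by lra.
Qed.

End Averaging_operators.

(* [jet x p q b f]: at [x] the derivatives of [f] of order less than [q] vanish
   and those of order [q] are [b] times the monomials in [p]. *)
Fixpoint jet (R : realType) d (x p : 'rV[R]_d) (q : nat) (b : R) (f : 'rV[R]_d -> R) : Prop :=
  match q with
  | 0 => f x = b
  | q'.+1 => f x = 0 /\ forall j, jet x p q' (p ord0 j * b) (pd j f)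
  end.

(** * Functions flat to a given order at a point *)

Section Jets.
Variables (R : realType) (d : nat) (D : set 'rV[R]_d) (theta : R).
Hypothesis oD : open D.
Variables (x p : 'rV[R]_d).
Hypothesis Dx : D x.
Implicit Types (f g : 'rV[R]_d -> R) (q : nat).

Lemma jet_ext q b f g : {in D, f =1 g} -> jet x p q b f -> jet x p q b g.
Proof.
elim: q b f g => [|q IH] b f g fg /=; first by rewrite fg ?inE.
rewrite fg ?inE// => -[g0 h]; split => // j; apply: IH (h j).
exact: eq_on_pd.
Qed.

Lemma jet0 q : jet x p q 0 (fun=> 0).
Proof.
elim: q => [//|q IH] /=; split => // j; rewrite mulr0.
by apply: jet_ext IH => y _; rewrite (pd_val (is_derive_cst _ _ _)).
Qed.

Lemma jetD q b b' M M' f g : hcls D theta q M f -> hcls D theta q M' g ->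
  jet x p q b f -> jet x p q b' g -> jet x p q (b + b') (fun y => f y + g y).
Proof.
elim: q b b' f g => [|q IH] b b' f g hf hg /=; first by move=> -> ->.
move=> [-> jf] [-> jg]; split; first by rewrite addr0.
move=> j; rewrite mulrDr; apply: jet_ext (IH _ _ _ _ (hcls_pd j hf) (hcls_pd j hg) (jf j) (jg j)).
move=> y; rewrite inE => Dy; apply/esym/pd_val/is_derive_pdD.
  exact: hcls_derivable hf Dy.
exact: hcls_derivable hg Dy.
Qed.

Lemma jet_weak q b f : jet x p q.+1 b f -> jet x p q 0 f.
Proof.
elim: q b f => [|q IH] b f; first by case.
move=> [f0 h]; split => // j; rewrite mulr0; apply: IH (h j).
Qed.

(** In the Leibniz formula every term other than g times a top derivative of f contains a derivative
    of f of order less than q, which vanishes at x. *)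
Lemma jetM q b M M' f g : hcls D theta q M f -> hcls D theta q M' g ->
  jet x p q b f -> jet x p q (g x * b) (fun y => g y * f y).
Proof.
elim: q b f g M M' => [|q IH] b f g M M' hf hg /=; first by move=> ->.
move=> jf; have jf' := @jet_weak q b f jf; case: jf => f0 jf.
split; first by rewrite f0 mulr0.
move=> j.
have h1 := IH _ _ _ _ _ (hcls_leq (leqnSn q) hf) (hcls_pd j hg) jf'.
have h2 := IH _ _ _ _ _ (hcls_pd j hf) (hcls_leq (leqnSn q) hg) (jf j).
have h := jetD (hclsM oD (hcls_pd j hg) (hcls_leq (leqnSn q) hf))
   (hclsM oD (hcls_leq (leqnSn q) hg) (hcls_pd j hf)) h1 h2.
rewrite mulr0 add0r mulrCA in h; apply: jet_ext h.
move=> y; rewrite inE => Dy; apply/esym/pd_val/is_derive_pdM.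
  exact: hcls_derivable hg Dy.
exact: hcls_derivable hf Dy.
Qed.

End Jets.

(** * Gain of a derivative and the lift of a trace *)

Section Lift.
Variables (R : realType) (n : nat).
Notation pt := 'rV[R]_n.+1.
Notation slab := (@slab R n).
Notation e0 := (axis R (ord0 : 'I_n.+1)).
Implicit Types (f g : pt -> R) (x y z : pt) (i j : 'I_n.+1) (Lam : (R -> R) -> R).

Let oS : open slab. Proof. exact: slab_open. Qed.
Let bS : boxy slab. Proof. exact: slab_boxy. Qed.

Definition avg_tan (l : seq 'I_n) f : pt -> R :=
  foldr (fun (i : 'I_n) g => avg_op (lift ord0 i) (@int01 R) g) (avg_op ord0 (@int01 R) f) l.

Definition gain f : pt -> R := fun x => x ord0 ord0 * avg_tan (enum 'I_n) f x.

Definition tail x : 'rV[R]_n := \row_j x ord0 (lift ord0 j).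

Fixpoint trace_lift (k : nat) (h : 'rV[R]_n -> R) : pt -> R :=
  if k is k'.+1 then gain (trace_lift k' h) else fun x => h (tail x).

Section Theta.
Variable theta : R.
Hypothesis theta01 : 0 <= theta <= 1.

Lemma path0 i x : path_pt i x 0 = x.
Proof. by rewrite /path_pt mulr0 scale0r subr0. Qed.

Lemma is_derive_path i x (u : R) :
  is_derive u 1 (path_pt i x) (- (x ord0 ord0) *: axis R i).
Proof.
apply: is_derive_rV => j.
have -> : (fun u : R => path_pt i x u ord0 j) =
    (fun u : R => x ord0 j - (x ord0 ord0 * axis R i ord0 j) *: u).
  by apply/funext => v; rewrite !mxE /GRing.scale/= mulrAC.
have h := @is_deriveZ R _ _ id (x ord0 ord0 * axis R i ord0 j) u 1 1 (is_derive_id u 1).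
have := @is_deriveB R _ _ (cst (x ord0 j)) _ u 1 0 _ (is_derive_cst _ _ _) h.
rewrite sub0r [_ *: 1]mulr1.
by have -> : (- x ord0 ord0 *: axis R i) ord0 j = - (x ord0 ord0 * axis R i ord0 j) by rewrite mxE mulNr.
Qed.

Lemma is_derive_fpath k M f i x (u : R) : hcls slab theta k.+1 M f -> slab x ->
  0 <= u <= 1 -> is_derive u 1 (fun u => f (path_pt i x u))
    (- x ord0 ord0 * pd i f (path_pt i x u)).
Proof.
move=> hf sx u01.
have H := hcls_C1 oS hf (path_slab i sx u01).
have := is_derive_comp_axis H (is_derive_path i x u).
rewrite (bigD1 i)//= big1 ?addr0 => [|j ji]; last first.
  by rewrite !mxE eqxx /= (negbTE ji) mulr0 mul0r.
by rewrite !mxE !eqxx mulr1.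
Qed.

Lemma ftc1 k M f i x : hcls slab theta k.+1 M f -> slab x ->
  x ord0 ord0 * avg_op i (@int01 R) (pd i f) x = f x - avg_op i (@eval1 R) f x.
Proof.
move=> hf sx; have u1 := lv_unifc (hcls_lv (hcls_pd i hf)).
have cp := C01_path i u1 sx.
have c2 : C01 (fun u => - x ord0 ord0 * pd i f (path_pt i x u)).
  by apply: C01M => //; exact: C01_cst.
have h := int01_derive c2 (fun u u01 => is_derive_fpath i hf sx u01).
rewrite path0 avgfZ// in h; last exact: avgf_int01.
by rewrite /avg_op /eval1 -opprB -h mulNr opprK.
Qed.

(** Integration by parts: the derivative in u of u f(x - u x_0 e_i) is f - x_0 u d_i f along the
    segment. *)
Lemma ftc2 k M f i x : hcls slab theta k.+1 M f -> slab x ->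
  x ord0 ord0 * avg_op i (mulu (@int01 R)) (pd i f) x =
  avg_op i (@int01 R) f x - avg_op i (@eval1 R) f x.
Proof.
move=> hf sx; have u1 := lv_unifc (hcls_lv (hcls_pd i hf)).
have cp := C01_path i u1 sx; have cf := C01_path i (lv_unifc (hcls_lv hf)) sx.
have aI := @avgf_int01 R.
have cup : C01 (fun u => u * pd i f (path_pt i x u)) by apply: C01M => //; exact: C01_id.
have c2 : C01 (fun u => f (path_pt i x u) - x ord0 ord0 * (u * pd i f (path_pt i x u))).
  have := C01D cf (C01M (@C01_cst R (- x ord0 ord0)) cup).
  by congr C01; apply/funext => u; rewrite mulNr.
have h := int01_derive (F := fun u => u * f (path_pt i x u)) c2.
rewrite avgf_sub// in h; rewrite /avg_op /mulu /eval1.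
have {}h := h _; rewrite mul1r mul0r subr0 in h.
apply/eqP; rewrite eq_sym subr_eq addrC -subr_eq eq_sym; apply/eqP/esym; apply: h.
move=> u u01; have df := is_derive_fpath i hf sx u01.
have := @is_deriveM R _ id (fun u => f (path_pt i x u)) u 1 1 _ (is_derive_id u 1) df.
have -> : f (path_pt i x u) - x ord0 ord0 * (u * pd i f (path_pt i x u)) =
   id u *: (- x ord0 ord0 * pd i f (path_pt i x u)) + f (path_pt i x u) *: 1.
  by rewrite /GRing.scale/= mulr1; ring.
by [].
Qed.

(** A tangential segment keeps x_0 fixed, so multiplication by x_0 commutes with averaging along
    it. *)
Lemma avg_op_mulx i Lam M f x : avgf Lam -> lv slab theta M f -> slab x -> i != ord0 ->
  avg_op i Lam (fun y => y ord0 ord0 * f y) x = x ord0 ord0 * avg_op i Lam f x.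
Proof.
move=> aL /lv_unifc uf sx i0; rewrite /avg_op -avgfZ//; last exact: C01_path.
congr Lam; apply/funext => u; rewrite path_coord (negbTE i0) mul0r subr0.
by rewrite mulr1.
Qed.

(** The length of the segment also depends on x_0. The resulting error, in parentheses, is
    controlled in the class of f by [ftc2], so control of x_0 d_0 passes from f to its tangential
    average. *)
Lemma avg_op_mulx_pd0 i k M f x : i != ord0 -> hcls slab theta k.+1 M f -> slab x ->
  x ord0 ord0 * pd ord0 (avg_op i (@int01 R) f) x =
  avg_op i (@int01 R) (fun y => y ord0 ord0 * pd ord0 f y) x -
  (avg_op i (@int01 R) f x - avg_op i (@eval1 R) f x).
Proof.
move=> i0 hf sx; have aI := @avgf_int01 R.
rewrite (pd_val (is_derive_avg_op i ord0 aI hf sx)) eqxx mul1r mulrBr.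
by rewrite (ftc2 i hf sx) (avg_op_mulx aI (hcls_lv (hcls_pd ord0 hf)) sx i0).
Qed.

Lemma avg_op_mulx_pd i k M f x : i != ord0 -> hcls slab theta k.+1 M f -> slab x ->
  x ord0 ord0 * pd i (avg_op i (@int01 R) f) x = f x - avg_op i (@eval1 R) f x.
Proof.
move=> i0 hf sx; have aI := @avgf_int01 R.
rewrite (pd_val (is_derive_avg_op i i aI hf sx)) (negbTE i0) mul0r subr0.
exact: ftc1 hf sx.
Qed.

Lemma avg_op_mulx_pdC i j k M f x : i != ord0 -> j != ord0 -> hcls slab theta k.+1 M f ->
  slab x -> x ord0 ord0 * pd j (avg_op i (@int01 R) f) x =
  avg_op i (@int01 R) (fun y => y ord0 ord0 * pd j f y) x.
Proof.
move=> i0 j0 hf sx; have aI := @avgf_int01 R.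
rewrite (pd_val (is_derive_avg_op i j aI hf sx)) (negbTE j0) mul0r subr0.
by rewrite (avg_op_mulx aI (hcls_lv (hcls_pd j hf)) sx i0).
Qed.

(** Indeed x_0 A_0 f is the primitive of f in x_0 that vanishes on the hyperplane, and its
    x_0-derivative is f. *)
Lemma avg_op0_mulx_pd0 k M f x : hcls slab theta k.+1 M f -> slab x ->
  x ord0 ord0 * pd ord0 (avg_op ord0 (@int01 R) f) x = f x - avg_op ord0 (@int01 R) f x.
Proof.
move=> hf sx; have aI := @avgf_int01 R.
rewrite (pd_val (is_derive_avg_op ord0 ord0 aI hf sx)) eqxx mul1r mulrBr.
by rewrite (ftc1 ord0 hf sx) (ftc2 ord0 hf sx); ring.
Qed.

(** The normal average, applied first, brings x_0 d_0 into the class of f. Each further average in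
    direction i does so for x_0 d_i, and the commutation rules above preserve what was reached for
    d_0 and for the directions already treated. *)
Lemma hcls_avg_tan k l : exists2 C, 0 <= C & forall M f, hcls slab theta k.+1 M f ->
  [/\ hcls slab theta k.+1 (C * M) (avg_tan l f),
      hcls slab theta k.+1 (C * M) (fun x => x ord0 ord0 * pd ord0 (avg_tan l f) x) &
      forall i : 'I_n, i \in l ->
        hcls slab theta k.+1 (C * M) (fun x => x ord0 ord0 * pd (lift ord0 i) (avg_tan l f) x)].
Proof.
have aI := @avgf_int01 R; have aE := @avgf_eval1 R.
elim: l => [|i l [C C0 IH]].
  have [C C0 h] := hcls_avg_op theta01 (ord0 : 'I_n.+1) k.+1.
  exists (1 + C); first by rewrite addr_ge0.
  move=> M f hf; have M0 := hcls_ge0 hf.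
  have h1 := h _ aI _ _ hf.
  split => //; first by apply: hcls_le h1; rewrite ler_wpM2r// lerDr.
  rewrite mulrDl mul1r.
  apply: hcls_ext (hclsB oS hf h1) => // x; rewrite inE => sx.
  by rewrite /= -(avg_op0_mulx_pd0 hf sx).
have [C' C'0 h] := hcls_avg_op theta01 (lift ord0 i) k.+1.
have CC : 0 <= C' * C by exact: mulr_ge0.
(* By [avg_op_mulx_pd0] the normal direction costs three averages, each bounded by C' * (C * M); the
   new direction i costs C * M and one average. *)
exists (C + 3 * (C' * C)); first by rewrite addr_ge0// mulr_ge0.
move=> M f hf; have M0 := hcls_ge0 hf.
have [hg h0 hi] := IH M f hf.
have CM : 0 <= C * M by exact: mulr_ge0.
have CCM : 0 <= C' * (C * M) by exact: mulr_ge0.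
have h1 := h _ aI _ _ hg; have h2 := h _ aE _ _ hg.
have E : (C + 3 * (C' * C)) * M = C * M + 3 * (C' * (C * M)) by ring.
have i0 : lift ord0 i != ord0 :> 'I_n.+1 by [].
have hii : hcls slab theta k.+1 ((C + 3 * (C' * C)) * M)
    (fun x => x ord0 ord0 * pd (lift ord0 i) (avg_tan (i :: l) f) x).
  apply: (@hcls_le _ _ _ _ _ (C * M + C' * (C * M))); first by rewrite E; lra.
  apply: hcls_ext (hclsB oS hg h2) => // x; rewrite inE => sx.
  by rewrite /= -(avg_op_mulx_pd i0 hg sx).
split.
- by apply: hcls_le h1; rewrite E; lra.
- have h3 := h _ aI _ _ h0.
  apply: (@hcls_le _ _ _ _ _ (C' * (C * M) + (C' * (C * M) + C' * (C * M)))).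
    by rewrite E; lra.
  apply: hcls_ext (hclsB oS h3 (hclsB oS h1 h2)) => // x; rewrite inE => sx.
  by rewrite /= (avg_op_mulx_pd0 i0 hg sx).
- move=> j; rewrite inE => /predU1P[->//|jl].
  have h3 := h _ aI _ _ (hi j jl).
  apply: (@hcls_le _ _ _ _ _ (C' * (C * M))); first by rewrite E; lra.
  apply: hcls_ext h3 => // x; rewrite inE => sx.
  by rewrite /= (avg_op_mulx_pdC i0 _ hg sx).
Qed.

Lemma hcls_x0 k : hcls slab theta k 3 (fun x => x ord0 ord0).
Proof.
have -> : (3 : R) = 1 + 2 * 1 by rewrite mulr1 -natr1 addrC.
by apply: hcls_coord => // x /ltW.
Qed.

Lemma is_derive_mulx g j x : derivable g x (axis R j) ->
  is_derive x (axis R j) (fun y => y ord0 ord0 * g y)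
    ((ord0 == j)%:R * g x + x ord0 ord0 * pd j g x).
Proof.
move=> dg; have dx := is_derive_coord x (axis R j) (ord0 : 'I_n.+1).
rewrite axisE eq_sym in dx; rewrite -(pd_val dx); apply: is_derive_pdM => //.
Qed.

Lemma hcls_gain k : exists2 C, 0 <= C & forall M f, hcls slab theta k.+1 M f ->
  hcls slab theta k.+2 (C * M) (gain f).
Proof.
have [C C0 h] := hcls_avg_tan k (enum 'I_n).
have K0 : 0 <= (2 : R) ^+ k.+2 * 3 * C by rewrite mulr_ge0// mulr_ge0// exprn_ge0.
exists (2 * C + 2 ^+ k.+2 * 3 * C); first by rewrite addr_ge0// mulr_ge0.
move=> M f hf; have M0 := hcls_ge0 hf; have [hg h0 hi] := h M f hf.
have CM : 0 <= C * M by exact: mulr_ge0.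
apply: (@hclsS_intro _ _ _ _ oS _ _ _ (fun j x => (ord0 == j)%:R * avg_tan (enum 'I_n) f x +
    x ord0 ord0 * pd j (avg_tan (enum 'I_n) f) x)).
- have := hcls_lv (hclsM oS (hcls_x0 k.+1) hg); apply: lv_le.
  by rewrite mulrA ler_wpM2r// lerDr mulr_ge0.
- by move=> j x sx; apply: is_derive_mulx; apply: hcls_derivable hg sx.
- move=> j.
  have hj : hcls slab theta k.+1 (C * M) (fun x => x ord0 ord0 * pd j (avg_tan (enum 'I_n) f) x).
    by case: (unliftP ord0 j) => [i|] ->//; apply: hi; rewrite mem_enum.
  apply: hcls_le (hclsD oS (hclsZ oS _ hg) hj).
  have : `|(ord0 == j)%:R : R| * (C * M) <= C * M.
    by apply: ler_piMl => //; case: (_ == _); rewrite ?normr1 ?normr0.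
  have : 0 <= 2 ^+ k.+2 * 3 * C * M by exact: mulr_ge0.
  by rewrite mulrDl -(mulrA 2); lra.
Qed.

Lemma regmap_tail k : regmap slab setT theta k 1 tail.
Proof.
split => //; first by move=> x y _ _; rewrite mul1r; apply/rV_norm_le => // j;
  rewrite !mxE; have := rV_norm_coord (x - y) (lift ord0 j); rewrite !mxE.
case: k => // k i j.
have E : (fun z => tail z ord0 j) = (fun z : pt => z ord0 (lift ord0 j)).
  by apply/funext => z; rewrite mxE.
rewrite E; split.
  by move=> x _; have [] := is_derive_coord x (axis R i) (lift ord0 j).
apply: (@hcls_ext _ _ _ _ oS _ _ (fun=> (i == lift ord0 j)%:R)).
  by move=> x _; rewrite -axisE; apply/esym/pd_val/is_derive_coord.
apply: hcls_le (hcls_cst _ oS _ _).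
by case: (_ == _); rewrite ?normr1 ?normr0.
Qed.

(** Order l.+1, because the identities behind [gain] differentiate their argument. The data of an
    operator of order [mo j] have class [K - mo j], which is at least 1. *)
Lemma hcls_trace_lift l k : exists2 C, 0 <= C & forall M h,
  hcls setT theta l.+1 M h -> hcls slab theta (k + l.+1) (C * M) (trace_lift k h).
Proof.
elim: k => [|k [C C0 IH]] /=.
  have [C C0 h] := hcls_comp theta01 oS (@openT 'rV[R]_n) l.+1 1.
  by exists C => // M f hf; apply: h => //; exact: regmap_tail.
have [C' C'0 h] := hcls_gain (k + l).
exists (C' * C); first exact: mulr_ge0.
move=> M f hf; rewrite -mulrA addSn addnS; apply: h.
by rewrite -addnS; apply: IH.
Qed.

(** The integral is additive on integrable functions, so linearity is claimed on the regularity
    classes; the estimates keep the iterated averages within them. *)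
Lemma avg_tan_lin l k M M' M'' a f g h :
  hcls slab theta k.+1 M f -> hcls slab theta k.+1 M' g -> hcls slab theta k.+1 M'' h ->
  (forall x, slab x -> h x = a * f x + g x) ->
  forall x, slab x -> avg_tan l h x = a * avg_tan l f x + avg_tan l g x.
Proof.
have aI := @avgf_int01 R => hf hg hh E; elim: l => [|i l IH] x sx /=.
  exact: avg_op_lin aI (hcls_lv hf) (hcls_lv hg) (hcls_lv hh) E x sx.
have [C C0 H] := hcls_avg_tan k l.
have [hf' _ _] := H _ _ hf; have [hg' _ _] := H _ _ hg; have [hh' _ _] := H _ _ hh.
exact: avg_op_lin aI (hcls_lv hf') (hcls_lv hg') (hcls_lv hh') IH x sx.
Qed.

Lemma trace_lift_lin l k M M' M'' a (f g h : 'rV[R]_n -> R) :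
 
  hcls setT theta l.+1 M f -> hcls setT theta l.+1 M' g -> hcls setT theta l.+1 M'' h ->
  (forall x : 'rV[R]_n, h x = a * f x + g x) ->
  forall x, slab x -> trace_lift k h x = a * trace_lift k f x + trace_lift k g x.
Proof.
move=> hf hg hh E; elim: k => [|k IH] x sx /=; first exact: E.
have [C C0 H] := hcls_trace_lift l k.
have := H _ _ hh; have := H _ _ hg; have := H _ _ hf; rewrite !addnS => hf' hg' hh'.
by rewrite /gain (avg_tan_lin (enum 'I_n) hf' hg' hh' IH sx); ring.
Qed.

(** A q-th normal derivative is multiplied by (1 - u)^q along the normal segment and by 1 along a
    tangential one. The induction step is (1 - u)^(q+1) = (1 - u)^q - u (1 - u)^q, matching the two
    terms of [is_derive_avg_op]. *)
Lemma jet_avg_op i Lam q M b f x : avgf Lam -> slab x -> x ord0 ord0 = 0 ->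
  hcls slab theta q M f -> jet x e0 q b f ->
  jet x e0 q (b * Lam (fun u => (1 - (i == ord0)%:R * u) ^+ q)) (avg_op i Lam f).
Proof.
move=> aL sx x0; elim: q b f Lam aL => [|q IH] b f Lam aL hf /=.
  move=> <-; rewrite -avgfZ//; last by have := @C01_cst R 1; congr C01.
  rewrite /avg_op; congr Lam; apply/funext => u.
  by rewrite /path_pt x0 mul0r scale0r subr0 mulr1.
move=> [f0 jf]; split.
  rewrite /avg_op -[RHS](avgf0 aL); congr Lam; apply/funext => u.
  by rewrite /path_pt x0 mul0r scale0r subr0.
move=> j.
have [C C0 H] := hcls_avg_op theta01 i q.
have h1 := H _ aL _ _ (hcls_pd j hf).
have h2 := H _ (avgf_mulu aL) _ _ (hcls_pd i hf).
have j1 := IH _ _ _ aL (hcls_pd j hf) (jf j).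
have j2 := IH _ _ _ (avgf_mulu aL) (hcls_pd i hf) (jf i).
have cc := hcls_cst theta oS q (- (j == ord0)%:R).
have j3 := jetM oS sx h2 cc j2.
have j4 := jetD oS sx h1 (hclsM oS cc h2) j1 j3.
rewrite !axisE in j4.
pose w := fun u : R => (1 - (i == ord0)%:R * u) ^+ q.
have cw : C01 w.
  apply: C01_exp; have := C01D (@C01_cst R 1) (C01M (@C01_cst R (- (i == ord0)%:R)) (@C01_id R)).
  by congr C01; apply/funext => u; rewrite mulNr.
have cuw : C01 (fun u => u * w u) by apply: C01M => //; exact: C01_id.
have -> : e0 ord0 j * (b * Lam (fun u => (1 - (i == ord0)%:R * u) ^+ q.+1)) =
  (ord0 == j)%:R * b * Lam w + - (j == ord0)%:R * ((ord0 == i)%:R * b * mulu Lam w).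
  have -> : (fun u => (1 - (i == ord0)%:R * u) ^+ q.+1) =
      (fun u => w u - (i == ord0)%:R * (u * w u)).
    by apply/funext => u; rewrite /w exprS; ring.
  rewrite avgf_sub// axisE /mulu [ord0 == i]eq_sym [ord0 == j]eq_sym; ring.
apply: (jet_ext oS sx _ j4) => y; rewrite inE => sy.
by rewrite /= (pd_val (is_derive_avg_op i j aL hf sy)) mulNr.
Qed.

Lemma jet_avg_tan l q k M b f x : slab x -> x ord0 ord0 = 0 ->
  hcls slab theta k.+1 M f -> (q <= k.+1)%N -> jet x e0 q b f ->
  jet x e0 q (b * q.+1%:R^-1) (avg_tan l f).
Proof.
have aI := @avgf_int01 R => sx x0 hf qk jf; elim: l => [|i l IH] /=.
  have := jet_avg_op ord0 aI sx x0 (hcls_leq qk hf) jf.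
  have -> : (fun u : R => (1 - (ord0 == ord0 :> 'I_n.+1)%:R * u) ^+ q) = (fun u => (1 - u) ^+ q).
    by apply/funext => u; rewrite mul1r.
  by rewrite int01_onem_exp.
have [C C0 H] := hcls_avg_tan k l; have [hg _ _] := H _ _ hf.
have := jet_avg_op (lift ord0 i) aI sx x0 (hcls_leq qk hg) IH.
have -> : (fun u : R => (1 - (lift ord0 i == ord0 :> 'I_n.+1)%:R * u) ^+ q) = (fun=> 1).
  by apply/funext => u; rewrite mul0r subr0 expr1n.
by rewrite int01_cst mulr1.
Qed.

Lemma jet_mulx q M b f x : slab x -> x ord0 ord0 = 0 -> hcls slab theta q.+1 M f ->
  jet x e0 q b f -> jet x e0 q.+1 (q.+1%:R * b) (fun y => y ord0 ord0 * f y).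
Proof.
move=> sx x0.
have dx g k M1 j y : hcls slab theta k.+1 M1 g -> slab y ->
    pd j (fun y => y ord0 ord0 * g y) y = (ord0 == j)%:R * g y + y ord0 ord0 * pd j g y.
  by move=> hg sy; apply: pd_val; apply: is_derive_mulx; apply: hcls_derivable hg sy.
elim: q b f => [|q IH] b f hf jf; (split; first by rewrite x0 mul0r) => j.
  by rewrite /= (dx _ _ _ j x hf sx) jf x0 mul0r addr0 mul1r axisE.
have j1 := IH _ _ (hcls_pd j hf) (jf.2 j).
have cc := hcls_cst theta oS q.+1 (ord0 == j)%:R.
have hf' := hcls_leq (leqnSn _) hf.
have j2 := jetM oS sx hf' cc jf.
have j3 := jetD oS sx (hclsM oS cc hf') (hclsM oS (hcls_x0 q.+1) (hcls_pd j hf)) j2 j1.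
rewrite axisE in j3 *.
have -> : (ord0 == j)%:R * (q.+2%:R * b) =
    (ord0 == j)%:R * b + q.+1%:R * ((ord0 == j)%:R * b).
  by rewrite -[q.+2%:R]natr1; ring.
apply: (jet_ext oS sx _ j3) => y; rewrite inE => sy.
by rewrite /= (dx _ _ _ j y hf sy).
Qed.

(** Each [gain] raises the order of the jet by one and keeps its coefficient: the 1 / (k + 1) of the
    normal average cancels against the k + 1 of [jet_mulx]. *)
Lemma jet_trace_lift l k M h x : slab x -> x ord0 ord0 = 0 ->
  hcls setT theta l.+1 M h -> jet x e0 k (h (tail x)) (trace_lift k h).
Proof.
move=> sx x0 hh; elim: k => [//|k IH].
have [C C0 H] := hcls_trace_lift l k; have h1 := H _ _ hh.
rewrite addnS in h1.
have kl : (k <= (k + l).+1)%N by rewrite -addnS leq_addr.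
have j1 := jet_avg_tan (enum 'I_n) sx x0 h1 kl IH.
have [C' C'0 H'] := hcls_avg_tan (k + l) (enum 'I_n); have [h2 _ _] := H' _ _ h1.
have kl' : (k.+1 <= (k + l).+1)%N by rewrite ltnS leq_addr.
have := jet_mulx sx x0 (hcls_leq kl' h2) j1.
by rewrite mulrCA mulfV ?mulr1// pnatr_eq0.
Qed.

End Theta.
End Lift.

(** * Classical Hoelder norms *)

Section Linear_image.
Variables (R : realType) (d : nat) (V : normedModType R) (ell : V -> R).
Hypothesis ell_lin : forall a u v, ell (a *: u + v) = a * ell u + ell v.
Hypothesis ell_norm : forall v, `|ell v| <= `|v|.
Implicit Types (u : 'rV[R]_d -> V).

Lemma ell0 : ell 0 = 0.
Proof. by apply/eqP; rewrite -normr_le0; apply: le_trans (ell_norm 0) _; rewrite normr0. Qed.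

Lemma ellZ a v : ell (a *: v) = a * ell v.
Proof. by rewrite -[a *: v]addr0 ell_lin ell0 addr0. Qed.

Lemma ellB v w : ell (v - w) = ell v - ell w.
Proof. by rewrite addrC -scaleN1r ell_lin mulN1r addrC. Qed.

(** [ell] will be a coordinate of a chart, an entry of a coefficient row, or the identity on R;
    through it the vector-valued spaces of the statement are reduced to scalar functions. *)
Lemma is_derive_ell u x (v : 'rV[R]_d) : derivable u x v ->
  is_derive x v (fun y => ell (u y)) (ell ('D_v u x)).
Proof.
move=> du; suff C : (fun h : R => h^-1 *: (((fun y => ell (u y)) \o shift x) (h *: v) -
    ell (u x))) @ 0^' --> ell ('D_v u x).
  by apply: DeriveDef; [apply/cvg_ex; eexists; exact: C|apply/cvg_lim].
have du' : (fun h : R => h^-1 *: ((u \o shift x) (h *: v) - u x)) @ 0^' --> 'D_v u x.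
  exact: du.
apply/cvgrPdist_lt => e e0; move/cvgrPdist_lt : du' => /(_ e e0).
apply: filterS => h; apply: le_lt_trans.
by rewrite [_ *: _]/GRing.scale/= -ellB -ellZ -ellB; apply: ell_norm.
Qed.

Lemma pder_ell (D : set 'rV[R]_d) k u : open D ->
  (forall s (i : 'I_d) x, (size s < k)%N -> D x -> derivable (pder s u) x (delta_mx ord0 i)) ->
  forall s, (size s <= k)%N -> {in D, pder s (fun y => ell (u y)) =1 (fun y => ell (pder s u y))}.
Proof.
move=> oD du; elim=> [//|i s IH] sk x; rewrite inE => Dx /=.
have Es := IH (ltnW sk).
have [_ E] := is_derive_ell (du s i x sk Dx); rewrite -E.
by apply: near_eq_derive; exact: (eq_on_near oD Es Dx).
Qed.

Lemma derivable_pder_ell (D : set 'rV[R]_d) k u : open D ->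
  (forall s (i : 'I_d) x, (size s < k)%N -> D x -> derivable (pder s u) x (delta_mx ord0 i)) ->
  forall s (i : 'I_d) x, (size s < k)%N -> D x ->
    derivable (pder s (fun y => ell (u y))) x (delta_mx ord0 i).
Proof.
move=> oD du s i x sk Dx.
have Es := pder_ell oD du (ltnW sk).
have Es' : {in D, (fun y => ell (pder s u y)) =1 pder s (fun y => ell (u y))}.
  by move=> y Dy; rewrite Es.
apply: (eq_on_derivable oD Es' Dx).
by have [] := is_derive_ell (du s i x sk Dx).
Qed.

End Linear_image.

(** * Independence of the order of differentiation *)

Section Symmetry.
Variables (R : realType) (d : nat) (D : set 'rV[R]_d) (k : nat) (f : 'rV[R]_d -> R).
Hypothesis oD : open D.
Hypothesis df : forall s (i : 'I_d) x, (size s < k)%N -> D x ->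
  derivable (pder s f) x (axis R i).
Hypothesis cf : forall s, (size s <= k)%N -> forall x, D x -> forall e : R, 0 < e ->
  exists2 r : R, 0 < r & forall y, D y -> ball x r y -> `|pder s f x - pder s f y| < e.

Lemma pder_cons i s (g : 'rV[R]_d -> R) : pder (i :: s) g = pd i (pder s g).
Proof. by apply/funext => x; rewrite pdE. Qed.

Lemma pder_swap i j s x : ((size s).+2 <= k)%N -> D x ->
  pder (i :: j :: s) f x = pder (j :: i :: s) f x.
Proof.
move=> sk Dx; rewrite !pder_cons; apply: schwarz => e e0.
have [r1 r10 h1] := cf (s := i :: j :: s) sk Dx e0.
have [r2 r20 h2] := cf (s := j :: i :: s) sk Dx e0.
have [r3 r30 h3] := open_ball oD Dx.
exists (Num.min r1 (Num.min r2 r3)); first by rewrite !lt_min r10 r20.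
move=> z; rewrite ball_norm !lt_min => /andP[z1 /andP[z2 z3]].
have Dz : D z by apply: h3; rewrite ball_norm.
have sk1 : (size s < k)%N by apply: ltn_trans sk.
split; first by split; rewrite -?pder_cons; apply: df.
by rewrite -!pder_cons; split; [apply: h1|apply: h2] => //; rewrite ball_norm.
Qed.

Lemma pder_move i t1 t2 x : (size (t1 ++ t2) < k)%N -> D x ->
  pder (i :: t1 ++ t2) f x = pder (t1 ++ i :: t2) f x.
Proof.
elim: t1 x => [//|j t1 IH] x sk Dx; rewrite cat_cons pder_swap//.
have E : {in D, pder (i :: t1 ++ t2) f =1 pder (t1 ++ i :: t2) f}.
  by move=> y; rewrite inE => Dy; apply: IH => //; apply: ltn_trans sk; rewrite /= ltnS.
by rewrite cat_cons (pder_cons j (i :: _)) (pder_cons j (t1 ++ _)); apply: (eq_on_pd oD _ E); rewrite inE.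
Qed.

(** The norms see derivatives in the sorted order [mseq b] only, whereas [hcls] differentiates in
    every order; this reconciles the two. *)
Lemma pder_perm s t : perm_eq s t -> (size s <= k)%N -> {in D, pder s f =1 pder t f}.
Proof.
elim: s t => [|i s IH] t st sk x.
  by move: st; rewrite perm_sym => /perm_nilP ->.
rewrite inE => Dx.
have it : i \in t by rewrite -(perm_mem st) mem_head.
case/splitPr: it st => t1 t2 st.
have st' : perm_eq s (t1 ++ t2).
  by move: st; rewrite -[i :: t2]cat1s perm_sym perm_catCA /= perm_cons perm_sym.
rewrite -pder_move//; last by rewrite -(perm_size st').
have E := IH _ st' (ltnW sk).
by rewrite !pder_cons; apply: (eq_on_pd oD _ E); rewrite inE.
Qed.

End Symmetry.

(** Compactness as an induction principle. It serves for uniform continuity and for gluing the local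
    solutions along the boundary. *)
Lemma compact_union_ind (T : ptopologicalType) (K : set T) (P : set T -> Prop) :
  compact K -> P set0 -> (forall A B, P A -> P B -> P (A `|` B)) ->
  (forall A B, A `<=` B -> P B -> P A) ->
  (forall x, K x -> exists2 U, open U & U x /\ P U) -> P K.
Proof.
move=> cK P0 PU PS H.
have /choice[U hU] : forall x, exists U, K x -> open U /\ U x /\ P U.
  move=> x; have [Kx|nKx] := pselect (K x); last by exists set0.
  by have [U oU [Ux PU']] := H x Kx; exists U.
move: cK; rewrite compact_cover => /(_ _ K U).
case=> [x Kx|x Kx|D' D'K KD].
- by case: (hU x Kx).
- by exists x => //; case: (hU x Kx) => _ [].
apply: PS KD _; rewrite /cover bigcup_fset big_seq.
apply: (big_ind P) => // x xD; have /D'K := xD; rewrite inE => /hU.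
by case=> _ [].
Qed.

Lemma compact_unifc (R : realType) d (K A : set 'rV[R]_d) (f : 'rV[R]_d -> R) :
  compact K -> K `<=` A -> {within A, continuous f} -> unifc K f.
Proof.
move=> cK KA /subspace_continuousP cf e e0.
have e2 : 0 < e / 2 by rewrite divr_gt0.
pose P (U : set 'rV[R]_d) := exists2 del, 0 < del &
    forall x y, U x -> K x -> K y -> `|x - y| < del -> `|f x - f y| < e.
suff [r r0 hr] : P K by exists r => // x y Kx Ky; apply: hr.
apply: (compact_union_ind (P := P)) cK _ _ _ _.
- by exists 1.
- move=> B C [r r0 hr] [s s0 hs]; exists (Num.min r s); first by rewrite lt_min r0.
  move=> x y [Bx|Cx] Kx Ky; rewrite lt_min => /andP[xr xs].
    exact: hr.
  exact: hs.
- move=> B C BC [r r0 hr]; exists r => // x y /BC; exact: hr.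
- move=> x Kx; have /cvgrPdist_lt/(_ _ e2) := cf x (KA x Kx).
  rewrite near_withinE => /nbhs_ballP[r /= r0 hr].
  exists (ball x (r / 2)); first by apply: ball_open; rewrite divr_gt0.
  split; first by apply: ballxx; rewrite divr_gt0.
  exists (r / 2); first by rewrite divr_gt0.
  move=> y z /ball_norm yx Ky Kz yz.
  have h1 : `|f x - f y| < e / 2.
    by apply: hr (KA _ Ky); rewrite ball_norm; lra.
  have h2 : `|f x - f z| < e / 2.
    apply: hr (KA _ Kz); rewrite ball_norm.
    have : `|z - x| <= `|z - y| + `|y - x| by rewrite -(subrKA y) ler_normD.
    by rewrite distrC in yz; lra.
  rewrite -(subrKA (f x)) (splitr e); apply: le_lt_trans (ler_normD _ _) _.
  by apply: ltrD => //; rewrite distrC.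
Qed.

(** * Multi-indices and words of derivatives *)

Section Multi_index.
Variables (d K : nat).

(** For a word longer than K, [inord] may fall back on its default value; the lemmas assume
    [size s <= K]. *)
Definition mindex_of (s : seq 'I_d) : mindex d K := [ffun i => inord (count_mem i s)].

Lemma count_mseq (b : mindex d K) i : count_mem i (mseq b) = b i.
Proof.
rewrite /mseq count_flatten -map_comp sumnE big_map big_enum /=.
rewrite (bigD1 i)//= count_nseq /= eqxx mul1n big1 ?addn0// => j ji.
by rewrite count_nseq /= (negbTE ji).
Qed.

Lemma perm_mindex_of (s : seq 'I_d) : (size s <= K)%N -> perm_eq s (mseq (mindex_of s)).
Proof.
move=> sK; apply/allP => i _ /=; apply/eqP; rewrite count_mseq ffunE inordK//.
by rewrite ltnS; apply: leq_trans (count_size _ _) sK.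
Qed.

Lemma size_mseq (b : mindex d K) : size (mseq b) = mlen b.
Proof.
rewrite /mseq size_flatten /shape -map_comp sumnE big_map big_enum /= /mlen.
by apply: eq_bigr => i _; rewrite size_nseq.
Qed.

Lemma mlen_mindex_of (s : seq 'I_d) : (size s <= K)%N -> mlen (mindex_of s) = size s.
Proof. by move=> sK; rewrite -size_mseq -(perm_size (perm_mindex_of sK)). Qed.

Lemma mpow_mseq (R : realType) (v : 'rV[R]_d) (b : mindex d K) :
  mpow v b = \prod_(i <- mseq b) v ord0 i.
Proof.
rewrite /mpow /mseq big_flatten big_map big_enum /=.
by apply: eq_bigr => i _; rewrite big_nseq iter_mulr_1.
Qed.

End Multi_index.

Section Holder_norm.
Variables (R : realType) (d : nat) (V : normedModType R) (D : set 'rV[R]_d).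
Variables (k : nat) (theta : R) (u : 'rV[R]_d -> V).
Hypothesis D0 : D !=set0.
Hypothesis uN : (holder_norm D k theta u < +oo)%E.

Let M := fine (holder_norm D k theta u).

Lemma sup_norm_ge0 (f : 'rV[R]_d -> V) : (0 <= sup_norm D f)%E.
Proof.
case: D0 => x Dx; apply: (@le_trans _ _ (`|f x|%:E)); first by rewrite lee_fin.
by apply: ereal_sup_ubound; exists x.
Qed.

Lemma hseminorm_ge0 (f : 'rV[R]_d -> V) : (0 <= hseminorm D theta f)%E.
Proof.
case: D0 => x Dx; apply: ereal_sup_ubound; exists (x, x) => //=.
by rewrite subrr normr0 mul0r.
Qed.

Lemma holder_norm_parts_ge0 :
  (0 <= \sum_(b : mindex d k | (mlen b <= k)%N) sup_norm D (pder (mseq b) u))%E /\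
  (0 <= (if theta == 0%R then 0
    else \sum_(b : mindex d k | mlen b == k) hseminorm D theta (pder (mseq b) u)))%E.
Proof.
split; first by apply: sume_ge0 => b _; exact: sup_norm_ge0.
by case: ifP => // _; apply: sume_ge0 => b _; exact: hseminorm_ge0.
Qed.

Lemma holder_norm_fineK : holder_norm D k theta u = M%:E.
Proof.
rewrite /M fineK// ge0_fin_numE//; have [h1 h2] := holder_norm_parts_ge0.
exact: adde_ge0.
Qed.

Lemma holder_norm_fine_ge0 : 0 <= M.
Proof.
rewrite -lee_fin -holder_norm_fineK; have [h1 h2] := holder_norm_parts_ge0.
exact: adde_ge0.
Qed.

Lemma holder_norm_sup (b : mindex d k) x : (mlen b <= k)%N -> D x ->
  `|pder (mseq b) u x| <= M.
Proof.
move=> bk Dx; rewrite -lee_fin -holder_norm_fineK; have [h1 h2] := holder_norm_parts_ge0.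
apply: (@le_trans _ _ (sup_norm D (pder (mseq b) u))).
  by apply: ereal_sup_ubound; exists x.
rewrite /holder_norm (bigD1 b)//= -addeA leeDl// adde_ge0//.
by apply: sume_ge0 => c _; exact: sup_norm_ge0.
Qed.

Lemma holder_norm_holder (b : mindex d k) x y : theta != 0 -> mlen b = k -> D x -> D y ->
  `|pder (mseq b) u x - pder (mseq b) u y| <= M * `|x - y| `^ theta.
Proof.
move=> t0 bk Dx Dy.
have [->|xy] := eqVneq x y; first by rewrite !subrr normr0 mulr_ge0 ?powR_ge0// holder_norm_fine_ge0.
have xy0 : 0 < `|x - y| `^ theta by rewrite powR_gt0// normr_gt0 subr_eq0.
rewrite -ler_pdivrMr// -lee_fin -holder_norm_fineK; have [h1 h2] := holder_norm_parts_ge0.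
apply: (@le_trans _ _ (hseminorm D theta (pder (mseq b) u))).
  by apply: ereal_sup_ubound; exists (x, y).
rewrite /holder_norm (negbTE t0) [X in (_ <= _ + X)%E](bigD1 b)/=; last by rewrite bk.
rewrite addeCA leeDl// adde_ge0//.
by apply: sume_ge0 => c _; exact: hseminorm_ge0.
Qed.

End Holder_norm.

Lemma hcls_of_pder (R : realType) d (B : set 'rV[R]_d) (theta M : R) k (f : 'rV[R]_d -> R) :
  (forall s (i : 'I_d) x, (size s < k)%N -> B x -> derivable (pder s f) x (axis R i)) ->
  (forall s, (size s <= k)%N -> lv B theta M (pder s f)) -> hcls B theta k M f.
Proof.
elim: k f => [|k IH] f df lf; (split; first exact: (lf [::])) => // i.
split; first by move=> x Bx; apply: (df [::]).
have E s : pder s (pd i f) = pder (rcons s i) f.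
  elim: s => [|j s IHs]; first by apply/funext => x; rewrite /= pdE.
  by rewrite rcons_cons !pder_cons IHs.
apply: IH => [s j x sk Bx|s sk]; rewrite E; [apply: df|apply: lf] => //;
  by rewrite size_rcons.
Qed.

(** * From classical norms to the quantitative classes *)

Section Holder_hcls.
Variables (R : realType) (d : nat) (V : normedModType R) (ell : V -> R).
Hypothesis ell_lin : forall a u v, ell (a *: u + v) = a * ell u + ell v.
Hypothesis ell_norm : forall v, `|ell v| <= `|v|.

(** The classical norm has Hoelder quotients at top order only. Below it, the next derivatives are
    bounded and B is boxy, so [box_lip] and [lv_lip] apply and give d + 2. Uniform continuity comes
    from the continuous extensions of the derivatives to the compact closure of B. *)
Lemma holder_hcls (D B : set 'rV[R]_d) k (theta : R) (u : 'rV[R]_d -> V) :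
  0 <= theta <= 1 -> open D -> open B -> boxy B -> B `<=` D ->
  (exists rho : R, forall x, B x -> `|x| <= rho) ->
  D !=set0 -> holder D k theta u ->
  hcls B theta k ((d%:R + 2) * fine (holder_norm D k theta u)) (fun x => ell (u x)).
Proof.
move=> t01 oD oB bB BD [rho hrho] D0 [[cu du eu] uN]; set M := fine _.
have M0 : 0 <= M by apply: holder_norm_fine_ge0.
have cK : compact (closure B).
  apply: bounded_closed_compact; last exact: closed_closure.
  have cl : closed [set x : 'rV[R]_d | `|x| <= rho].
    rewrite -openC; have := @open_norm_gt R d 0 rho; congr open.
    apply/seteqP; split => x /=; rewrite subr0; first by rewrite ltNge => /negP.
    by move/negP; rewrite -ltNge.
  exists rho; split; first exact: num_real.
  move=> r rr x Bx; apply: le_trans (ltW rr).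
  have H : closure B `<=` closure [set x : 'rV[R]_d | `|x| <= rho] := closure_subset hrho.
  by move: (H x Bx); rewrite -((closure_id _).1 cl).
pose f x := ell (u x).
have Ef s : (size s <= k)%N -> {in D, pder s f =1 (fun y => ell (pder s u y))}.
  exact: pder_ell.
have df s (i : 'I_d) x : (size s < k)%N -> D x -> derivable (pder s f) x (axis R i).
  exact: derivable_pder_ell.
have ellBn v w : `|ell v - ell w| <= `|v - w| by rewrite -ellB.
have cf s : (size s <= k)%N -> exists2 g, {within closure D, continuous g} &
    forall x, D x -> g x = pder s f x.
  move=> sk; have [g cg gE] := eu s sk; exists (fun x => ell (g x)).
    apply/subspace_continuousP => x Dx; move/subspace_continuousP: cg => /(_ x Dx) h.
    apply/cvgrPdist_lt => e e0; move/cvgrPdist_lt: h => /(_ e e0).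
    by apply: filterS => y; exact: le_lt_trans (ellBn _ _).
  by move=> x Dx; rewrite gE// Ef ?inE.
have uf s : (size s <= k)%N -> unifc B (pder s f).
  move=> sk e e0; have [g cg gE] := cf s sk.
  have [r r0 hr] := compact_unifc cK (closure_subset BD) cg e0.
  exists r => // x y Bx By xy; rewrite -!gE; try exact: BD.
  by apply: hr => //; apply: subset_closure.
have pf s : (size s <= k)%N -> forall x, D x -> forall e : R, 0 < e ->
    exists2 r : R, 0 < r & forall y, D y -> ball x r y -> `|pder s f x - pder s f y| < e.
  move=> sk x Dx e e0; have [g /subspace_continuousP cg gE] := cf s sk.
  have /cvgrPdist_lt/(_ _ e0) := cg x (subset_closure Dx).
  rewrite near_withinE => /nbhs_ballP[r /= r0 hr].
  by exists r => // y Dy xy; rewrite -!gE//; apply: hr => //; apply: subset_closure.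
have perm s : (size s <= k)%N -> {in D, pder s f =1 pder (mseq (mindex_of k s)) f}.
  by move=> sk; apply: (pder_perm oD df pf) => //; apply: perm_mindex_of.
have msk (s : seq 'I_d) : (size s <= k)%N -> (size (mseq (mindex_of k s)) <= k)%N.
  by move=> sk; rewrite size_mseq mlen_mindex_of.
have bf s x : (size s <= k)%N -> D x -> `|pder s f x| <= M.
  move=> sk Dx; rewrite perm ?inE// Ef ?inE ?msk//.
  apply: le_trans (ell_norm _) _; apply: holder_norm_sup => //.
  by rewrite mlen_mindex_of.
have M2 : 2 * M <= (d%:R + 2) * M by rewrite ler_wpM2r// lerDr.
have M1 : M <= (d%:R + 2) * M.
  by apply: le_trans M2; rewrite mulr_natl mulr2n lerDl.
apply: hcls_of_pder.
  by move=> s i x sk Bx; apply: df => //; apply: BD.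
move=> s sk; have [sk'|sk'] := ltnP (size s) k.
  rewrite mulrDl; apply: lv_lip => //; first by rewrite mulr_ge0.
    by move=> x Bx; apply: bf => //; apply: BD.
  apply: box_lip => // z i Bz; split; first by apply: df => //; apply: BD.
  by rewrite -pder_cons; apply: bf => //; apply: BD.
split.
- by rewrite mulr_ge0// addr_ge0.
- by move=> x Bx; apply: le_trans M1; apply: bf => //; apply: BD.
(* For theta = 0 the norm has no seminorm part, but then the power of |x - y| is 1 and the
   oscillation 2 * M serves. *)
- have [t0|t0] := eqVneq theta 0.
    move=> x y Bx By; rewrite t0 powRr0 mulr1; apply: le_trans M2.
    apply: le_trans (ler_normB _ _) _; rewrite mulr_natl mulr2n.
    by apply: lerD; apply: bf => //; apply: BD.
  move=> x y Bx By; have Dx := BD _ Bx; have Dy := BD _ By.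
  have Dx' : x \in D by rewrite inE.
  have Dy' : y \in D by rewrite inE.
  rewrite (perm s sk x Dx') (perm s sk y Dy') (Ef _ (msk s sk) x Dx') (Ef _ (msk s sk) y Dy').
  apply: le_trans (ellBn _ _) _; apply: (@le_trans _ _ (M * `|x - y| `^ theta)).
    apply: holder_norm_holder => //; rewrite mlen_mindex_of//.
    by apply/eqP; rewrite eqn_leq sk.
  by rewrite ler_wpM2r// powR_ge0.
- exact: uf.
Qed.

End Holder_hcls.

(** * Back to classical norms for column-valued functions *)

Section Column_output.
Variables (R : realType) (d N : nat).

Lemma colV_norm_le (v : 'cV[R]_N) (r : R) : 0 <= r ->
  `|v| <= r <-> forall l, `|v l ord0| <= r.
Proof.
move=> r0; split=> [vr l|h].
  apply: le_trans vr; rewrite [leRHS]/Num.Def.normr/= mx_normrE.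
  by apply: le_trans; last exact: (@le_bigmax _ _ _ _ _ (l, ord0)).
rewrite /Num.Def.normr/= mx_normrE (bigmax_le _ r0)//= => -[l a] _.
by rewrite /= ord1.
Qed.

Variables (k : nat) (theta M : R) (w : 'I_N -> 'rV[R]_d -> R).
Hypothesis M0 : 0 <= M.
Hypothesis hw : forall l, hcls setT theta k M (w l).

Definition colfun : 'rV[R]_d -> 'cV[R]_N := fun x => \col_l w l x.

Lemma hcls_pder (D : set 'rV[R]_d) (f : 'rV[R]_d -> R) k' s : (size s <= k')%N ->
  hcls D theta k' M f -> hcls D theta (k' - size s) M (pder s f).
Proof.
elim: s => [|i s IH] sk hf; first by rewrite subn0.
rewrite pder_cons; apply: hcls_pd; rewrite /= -subSn//.
by apply: IH => //; exact: ltnW.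
Qed.

Lemma pder_colfun s : (size s <= k)%N ->
  pder s colfun = (fun x => \col_l pder s (w l) x) /\
  ((size s < k)%N -> forall x (i : 'I_d), derivable (pder s colfun) x (delta_mx ord0 i)).
Proof.
have dcol (g : 'I_N -> 'rV[R]_d -> R) x i : (forall l, derivable (g l) x (axis R i)) ->
    derivable (fun y => \col_l g l y) x (delta_mx ord0 i) /\
    'D_(delta_mx ord0 i) (fun y => \col_l g l y) x = \col_l pd i (g l) x.
  move=> dg; have dM : derivable (fun y => \col_l g l y) x (delta_mx ord0 i).
    apply/derivable_mxP => l j.
    have -> : (fun y => (\col_l g l y) l j) = g l by apply/funext => y; rewrite mxE.
    exact: dg.
  split => //; rewrite derive_mx//; apply/colP => l; rewrite [RHS]mxE pdE mxE.
  have -> // : (fun y => (fun y => \col_l g l y) y l ord0) = g l.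
  by apply/funext => y; rewrite mxE.
have dw s' l x i : (size s' < k)%N -> derivable (pder s' (w l)) x (axis R i).
  move=> sk; have := hcls_pder (ltnW sk) (hw l); rewrite -(subSS (size s')) subSn//.
  by move/hcls_derivable => h; apply: h.
elim: s => [_|i s IH sk]; first by split => // k0 x i; exact: (dcol w x i (fun l => dw [::] l x i k0)).1.
have [E _] := IH (ltnW sk).
have E' : pder (i :: s) colfun = (fun x => \col_l pder (i :: s) (w l) x).
  apply/funext => x; rewrite [LHS]/= E.
  rewrite (dcol (fun l => pder s (w l)) x i (fun l => dw s l x i sk)).2.
  by apply/colP => l; rewrite !mxE pder_cons.
split => // sk' x j; rewrite E'.
exact: (dcol (fun l => pder (i :: s) (w l)) x j (fun l => dw (i :: s) l x j sk')).1.
Qed.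

Lemma unifc_continuous (f : 'rV[R]_d -> 'cV[R]_N) :
  (forall l, unifc setT (fun x => f x l ord0)) -> continuous f.
Proof.
move=> uf x.
apply/(@cvgrPdist_le R 'cV[R]_N _ (nbhs x) (nbhs_filter x) f (f x)) => e e0.
have /choice[s hs] : forall l : 'I_N, exists s : R, 0 < s /\ forall y, `|x - y| < s ->
    `|f x l ord0 - f y l ord0| < e.
  by move=> l; have [s s0 h] := uf l e e0; exists s; split => // y; apply: h.
pose r := \big[Num.min/1]_l s l.
have r_gt0 : 0 < r by apply/bigmin_gtP; split => // l _; case: (hs l).
apply/nbhs_ballP; exists r => // y; rewrite -ball_normE /= => xy.
apply/colV_norm_le; first exact: ltW.
move=> l; rewrite !mxE; apply/ltW; apply: (hs l).2; apply: lt_le_trans xy _.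
exact: bigmin_le_cond.
Qed.

Lemma pder_colfun_continuous s : (size s <= k)%N -> continuous (pder s colfun).
Proof.
move=> sk; rewrite (pder_colfun sk).1; apply: unifc_continuous => l.
have [_ _ _ u] := hcls_lv (hcls_pder sk (hw l)).
by move=> e e0; have [r r0 hr] := u e e0; exists r => // x y _ _ xy; rewrite !mxE; apply: hr.
Qed.

(** The components are regular across the boundary, so the limit from inside is the value of the
    derivative. *)
Lemma bder_colfun (D : set 'rV[R]_d) s x : (size s <= k)%N -> closure D x ->
  bder D s colfun x = \col_l pder s (w l) x.
Proof.
move=> sk Dx; rewrite /bder; have c := pder_colfun_continuous sk (x := x).
rewrite (pder_colfun sk).1 in c *.
have PF : ProperFilter (within D (nbhs x)).
  exact: within_nbhs_proper.
by apply: cvg_lim => //; exact: cvg_within_filter.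
Qed.

(** At most M per multi-index, once for the sup norms and once for the seminorms. *)
Lemma holder_colfun (D : set 'rV[R]_d) : D !=set0 ->
  holder D k theta colfun /\
  (holder_norm D k theta colfun <= (2 * #|mindex d k|%:R * M)%:E)%E.
Proof.
move=> D0; have bnd (s : seq 'I_d) x : (size s <= k)%N -> `|pder s colfun x| <= M.
  move=> sk; rewrite (pder_colfun sk).1; apply/colV_norm_le => // l; rewrite mxE.
  by apply: hcls_bound (hcls_pder sk (hw l)) _.
have hld (s : seq 'I_d) x y : (size s <= k)%N ->
    `|pder s colfun x - pder s colfun y| <= M * `|x - y| `^ theta.
  move=> sk; rewrite (pder_colfun sk).1.
  apply/colV_norm_le; first by rewrite mulr_ge0// powR_ge0.
  move=> l; rewrite !mxE; have [_ _ h _] := hcls_lv (hcls_pder sk (hw l)).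
  exact: h.
have sumM (P : pred (mindex d k)) (F : mindex d k -> \bar R) :
    (forall b, P b -> (F b <= M%:E)%E) ->
    (\sum_(b | P b) F b <= (#|mindex d k|%:R * M)%:E)%E.
  move=> h; apply: (@le_trans _ _ (\sum_(b : mindex d k | P b) M%:E)%E); first exact: lee_sum.
  rewrite sumEFin lee_fin; apply: (@le_trans _ _ (\sum_(b : mindex d k) M)).
    by rewrite big_mkcond/=; apply: ler_sum => b _; case: (P b).
  by rewrite sumr_const mulr_natl.
have nb : (holder_norm D k theta colfun <= (2 * #|mindex d k|%:R * M)%:E)%E.
  have -> : 2 * #|mindex d k|%:R * M = #|mindex d k|%:R * M + #|mindex d k|%:R * M.
    by rewrite -mulrA mulr_natl mulr2n.
  rewrite /holder_norm EFinD; apply: leeD.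
    apply: sumM => b bk; apply: ge_ereal_sup => _ [x Dx <-].
    by rewrite lee_fin; apply: bnd; rewrite size_mseq.
  case: ifP => t0; first by rewrite lee_fin mulr_ge0.
  apply: sumM => b /eqP bk; apply: ge_ereal_sup => _ [[x y] [Dx Dy] <-] /=.
  rewrite lee_fin; have [->|xy] := eqVneq x y; first by rewrite subrr normr0 mul0r.
  rewrite ler_pdivrMr; last by rewrite powR_gt0// normr_gt0 subr_eq0.
  by apply: hld; rewrite size_mseq bk.
split => //; split; last by apply: le_lt_trans nb _; rewrite ltry.
split.
- by apply: continuous_subspaceT; exact: (pder_colfun_continuous (s := [::])).
- by move=> s i x sk _; apply: (pder_colfun (ltnW sk)).2.
- move=> s sk; exists (pder s colfun) => //.
  by apply: continuous_subspaceT; exact: pder_colfun_continuous.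
Qed.

End Column_output.

(** * Boundary charts *)

Section Jets_and_derivatives.
Variables (R : realType).

Lemma pder_pd d (s : seq 'I_d) i (f : 'rV[R]_d -> R) : pder s (pd i f) = pder (rcons s i) f.
Proof.
elim: s => [|j s IHs]; first by apply/funext => x; rewrite /= pdE.
by rewrite rcons_cons !pder_cons IHs.
Qed.

Lemma jet_pder d (x p : 'rV[R]_d) q b f (s : seq 'I_d) : jet x p q b f -> (size s <= q)%N ->
  pder s f x = if size s == q then b * \prod_(i <- s) p ord0 i else 0.
Proof.
elim/last_ind: s q b f => [|s i IH] [|q] b f //=.
- by move=> ->; rewrite big_nil mulr1.
- by case.
- by rewrite size_rcons.
move=> [f0 jf]; rewrite size_rcons eqSS ltnS => sq.
rewrite -pder_pd (IH q _ _ (jf i) sq); case: ifP => // _.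
by rewrite -cats1 big_cat big_seq1 /=; ring.
Qed.

Lemma jet_sum d (D : set 'rV[R]_d) (theta : R) (x p : 'rV[R]_d) q N (M b : 'I_N -> R)
    (f : 'I_N -> 'rV[R]_d -> R) : open D -> D x ->
  (forall i, hcls D theta q (M i) (f i)) -> (forall i, jet x p q (b i) (f i)) ->
  jet x p q (\sum_i b i) (fun y => \sum_i f i y).
Proof.
move=> oD Dx hf jf; rewrite -!/(index_enum _).
suff : jet x p q (\sum_(i <- index_enum 'I_N) b i) (fun y => \sum_(i <- index_enum 'I_N) f i y) by [].
elim: (index_enum 'I_N) => [|i r IH].
  rewrite big_nil; have j0 := jet0 oD p Dx q; apply: (jet_ext oD Dx _ j0) => y _.
  by rewrite big_nil.
rewrite big_cons.
have h : hcls D theta q (\sum_(i <- r) M i) (fun y => \sum_(i <- r) f i y) by apply: hcls_sum.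
apply: (jet_ext oD Dx _ (jetD oD Dx (hf i) h (jf i) IH)) => y _.
by rewrite big_cons.
Qed.

(** In the chain rule all derivatives of f of order less than q drop out, and those of order q see
    e_0 only. What survives of Phi is the gradient of its 0-th coordinate; for a chart this is a
    conormal. *)
Lemma jet_comp d d' (D : set 'rV[R]_d) (D' : set 'rV[R]_d'.+1) (theta L : R)
    (Phi : 'rV[R]_d -> 'rV[R]_d'.+1) (x : 'rV[R]_d) q M b f :
  0 <= theta <= 1 -> open D -> open D' -> D x ->
  regmap D D' theta q L Phi -> hcls D' theta q M f ->
  jet (Phi x) (axis R ord0) q b f ->
  jet x (\row_i pd i (fun z => Phi z ord0 ord0) x) q b (fun y => f (Phi y)).
Proof.
move=> t01 oD oD' Dx; elim: q b f => [//|q IH] b f hP hf [f0 jf]; split => // i.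
have hP' := regmap_leq hP.
have [C C0 H] := hcls_comp t01 oD oD' q L.
have hj j := IH _ _ hP' (hcls_pd j hf) (jf j).
have hPj j : hcls D theta q L (pd i (fun z => Phi z ord0 j)) by case: hP => _ _ _ /(_ i j)[].
have hfj j := H _ _ _ hP' (hcls_pd j hf).
have js := jet_sum oD Dx (fun j => hclsM oD (hPj j) (hfj j))
  (fun j => jetM oD Dx (hfj j) (hPj j) (hj j)).
have -> : (\row_i pd i (fun z => Phi z ord0 ord0) x) ord0 i * b =
    \sum_j pd i (fun z => Phi z ord0 j) x * (axis R ord0 ord0 j * b).
  rewrite (bigD1 ord0)//= big1 => [|j j0].
    by rewrite axisE eqxx mul1r addr0 mxE.
  by rewrite axisE eq_sym (negbTE j0) mul0r mulr0.
apply: (jet_ext oD Dx _ js) => y; rewrite inE => Dy.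
rewrite (pd_val (is_derive_comp oD' i hP hf Dy)).
by apply: eq_bigr => j _; rewrite mulrC.
Qed.

Lemma regmap_of_reg d d' (D : set 'rV[R]_d) (D' : set 'rV[R]_d') (theta : R) k
    (Phi : 'rV[R]_d -> 'rV[R]_d') : boxy D ->
  (forall j, reg D theta k.+1 (fun x => Phi x ord0 j)) -> (forall x, D x -> D' (Phi x)) ->
  exists L, regmap D D' theta k.+1 L Phi.
Proof.
move=> bD /choice[M hM] mP.
have M0 j : 0 <= `|M j| by [].
pose S := \sum_j `|M j|.
have MS j : M j <= S.
  apply: le_trans (ler_norm _) _; rewrite /S (bigD1 j)//= lerDl sumr_ge0//.
have S0 : 0 <= S by apply: sumr_ge0.
have dS : S <= (d.+1)%:R * S by rewrite -[X in X <= _]mul1r ler_wpM2r// ler1n.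
(* The constant must dominate both the Lipschitz bound d * S and the derivative bound S, also for d
   = 0. *)
exists (d.+1%:R * S); split => //; first by rewrite mulr_ge0.
  move=> x y Dx Dy; apply/rV_norm_le; first by rewrite !mulr_ge0.
  move=> j; rewrite !mxE; apply: le_trans (hcls_lipschitz bD (hM j) Dx Dy) _.
  rewrite ler_wpM2r//; apply: (@le_trans _ _ (d%:R * S)); first by rewrite ler_wpM2l.
  by rewrite ler_wpM2r// ler_nat.
move=> i j; split; first by move=> x Dx; exact: hcls_derivable (hM j) Dx.
by apply: hcls_le (hcls_pd i (hM j)); apply: le_trans dS.
Qed.

End Jets_and_derivatives.

(** * The cell and its flat face *)

Section Coordinates.
Variables (R : realType) (n : nat).

Lemma rV_subE d (u v : 'rV[R]_d) i : (u - v) ord0 i = u ord0 i - v ord0 i.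
Proof. by rewrite !mxE. Qed.

Definition face (y : 'rV[R]_n) : 'rV[R]_n.+1 := row_mx (0 : 'rV[R]_1) y.

Lemma face0 y : face y ord0 ord0 = 0.
Proof.
rewrite /face; have -> : (ord0 : 'I_n.+1) = lshift n (ord0 : 'I_1) by apply/val_inj.
by apply: etrans (row_mxEl _ _ _ _) _; rewrite mxE.
Qed.

Lemma faceS y j : face y ord0 (lift ord0 j) = y ord0 j.
Proof.
rewrite /face; have -> : lift ord0 j = rshift 1 j :> 'I_(1 + n) by apply/val_inj.
by apply: etrans (row_mxEr _ _ _ _) _.
Qed.

Lemma face_tail (z : 'rV[R]_n.+1) : z ord0 ord0 = 0 -> face (tail z) = z.
Proof.
move=> z0; apply/rowP => i; case: (unliftP ord0 i) => [j|] ->.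
  by rewrite faceS mxE.
by rewrite face0.
Qed.

Lemma cell_norm d (x : 'rV[R]_d) : @cell R d x <-> `|x| < 1.
Proof. by rewrite /cell ball_norm subr0. Qed.

Lemma cell_open d : open (@cell R d).
Proof. exact: ball_open. Qed.

Lemma cell_boxy d : boxy (@cell R d).
Proof. exact: boxy_ball. Qed.

Lemma norm_tail (z : 'rV[R]_n.+1) : `|tail z| <= `|z|.
Proof. by apply/rV_norm_le => // j; rewrite mxE; exact: rV_norm_coord. Qed.

Lemma norm_tailB (z w : 'rV[R]_n.+1) : `|tail z - tail w| <= `|z - w|.
Proof.
by apply/rV_norm_le => // j; rewrite !mxE; have := rV_norm_coord (z - w) (lift ord0 j); rewrite !mxE.
Qed.

Lemma face_cell y : @cell R n y -> @cell R n.+1 (face y).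
Proof.
move=> /cell_norm y1; apply/cell_norm; apply: le_lt_trans y1.
apply/rV_norm_le => // i; case: (unliftP ord0 i) => [j|] ->.
  by rewrite faceS; exact: rV_norm_coord.
by rewrite face0 normr0.
Qed.

Lemma tail_cell z : @cell R n.+1 z -> @cell R n (tail z).
Proof. by move=> /cell_norm z1; apply/cell_norm; apply: le_lt_trans z1; exact: norm_tail. Qed.

Lemma cell_slab z : @cell R n.+1 z -> slab z.
Proof. by move=> /cell_norm z1; apply: le_lt_trans z1; exact: rV_norm_coord. Qed.

Lemma regmap_face (theta : R) k : 0 <= theta <= 1 -> regmap (@cell R n) (@cell R n.+1) theta k 1 face.
Proof.
move=> t01; have oc := @cell_open n; split => //; first exact: face_cell.
  move=> x y _ _; rewrite mul1r; apply/rV_norm_le => // i; rewrite rV_subE.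
  case: (unliftP ord0 i) => [j|] ->.
    by rewrite !faceS -rV_subE; exact: rV_norm_coord.
  by rewrite !face0 subrr normr0.
case: k => // k i j.
have [l dl hl] : exists2 l : R, (forall x, is_derive x (axis R i) (fun z => face z ord0 j) l) & `|l| <= 1.
  case: (unliftP ord0 j) => [j'|] ->.
    exists (i == j')%:R; last by case: (_ == _); rewrite ?normr1 ?normr0.
    move=> x; have -> : (fun z => face z ord0 (lift ord0 j')) = (fun z : 'rV[R]_n => z ord0 j').
      by apply/funext => z; rewrite faceS.
    by rewrite -axisE; exact: is_derive_coord.
  exists 0; last by rewrite normr0.
  move=> x; have -> : (fun z => face z ord0 ord0) = (fun z : 'rV[R]_n => (0 : R)).
    by apply/funext => z; rewrite face0.
  exact: is_derive_cst.
split; first by move=> x _; case: (dl x).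
apply: (hcls_ext oc (f := fun=> l)); first by move=> x _; rewrite (pd_val (dl x)).
exact: hcls_le (hcls_cst _ oc _ _).
Qed.

End Coordinates.

Section Chart.
Variables (R : realType) (n : nat) (Omega : set 'rV[R]_n.+1) (K : nat) (alpha : R).
Hypothesis oOmega : open Omega.
Hypothesis alpha01 : 0 <= alpha <= 1.
Variable c : chart R n.
Hypothesis cc : is_chart Omega K.+1 alpha c.
Notation pt := 'rV[R]_n.+1.

Let oc : open (cdom c). Proof. by case: cc. Qed.

Lemma cell_nonempty d : @cell R d !=set0.
Proof. by exists 0; apply/cell_norm; rewrite normr0. Qed.

Lemma coord_lin d (i : 'I_d) (a : R) (u v : 'rV[R]_d) :
  (a *: u + v) ord0 i = a * u ord0 i + v ord0 i.
Proof. by rewrite !mxE. Qed.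

Lemma cinv_reg i : reg (@cell R n.+1) alpha K.+1 (fun y => cinv c y ord0 i).
Proof.
case: cc => _ _ _ [_ hi] _.
eexists; apply: (holder_hcls (ell := fun v : pt => v ord0 i)) hi => //.
- by move=> a u v; apply: coord_lin.
- by move=> v; apply: rV_norm_coord.
- exact: cell_open.
- exact: cell_open.
- exact: cell_boxy.
- by exists 1 => x /cell_norm /ltW.
- exact: cell_nonempty.
Qed.

Lemma cmap_reg x0 (rho : R) i : 0 < rho -> (ball x0 rho `<=` cdom c) -> cdom c x0 ->
  reg (ball x0 rho) alpha K.+1 (fun y => cmap c y ord0 i).
Proof.
move=> r0 sub dx0; case: cc => _ _ _ [hm _] _.
eexists; apply: (holder_hcls (ell := fun v : pt => v ord0 i)) hm => //.
- by move=> a u v; apply: coord_lin.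
- by move=> v; apply: rV_norm_coord.
- exact: ball_open.
- exact: boxy_ball.
- exists (`|x0| + rho) => x /ball_norm xr.
  rewrite -(subrK x0 x) addrC; apply: le_trans (ler_normD _ _) _.
  by rewrite lerD2l ltW.
- by exists x0.
Qed.

(** A positive 0-th coordinate would put x in Omega. A negative one stays negative near x, so Omega
    would have no points there, although x is in its closure. *)
Lemma chart_bdry x : cdom c x -> bdry Omega x -> cmap c x ord0 ord0 = 0.
Proof.
move=> dx [clx nx]; case: cc => _ h1 _ _ h5.
have nO : ~ Omega x by move=> Ox; apply: nx; apply: open_nbhs_nbhs.
have le0 : cmap c x ord0 ord0 <= 0.
  by rewrite leNgt; apply/negP => /(h5 x dx).2.
apply/eqP; rewrite eq_le le0 leNgt; apply/negP => lt0.
have [rho rho0 hrho] := open_ball oc dx.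
have oB : open (ball x rho) by exact: ball_open.
have [M hM] := cmap_reg ord0 rho0 hrho dx.
have [_ _ _ u] := hcls_lv hM.
have [|r r0 hr] := u (- cmap c x ord0 ord0); first by rewrite oppr_gt0.
have mr0 : 0 < Num.min r rho by rewrite lt_min r0.
have [y [Oy]] := clx (ball x (Num.min r rho)) (nbhsx_ballx _ _ mr0).
rewrite ball_norm lt_min => /andP[yr yrho].
have dy : ball x rho y by rewrite ball_norm.
have := hr x y (ballxx _ rho0) dy; rewrite distrC => /(_ yr).
have := (h5 y (hrho _ dy)).1 Oy.
by rewrite ltr_norml => y0 /andP[]; rewrite opprK; lra.
Qed.

(** The image of a face point lies outside Omega, and it is the limit of the images of
    [face y + t *: axis R ord0] for small t > 0, which lie in Omega. *)
Lemma face_bdry y : @cell R n y -> bdry Omega (cinv c (face y)) /\ cdom c (cinv c (face y)).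
Proof.
move=> cy; case: cc => _ h1 h2 _ h5; have cf := face_cell cy.
have [dx E] := h2 _ cf; split => //; split; last first.
  by move/interior_subset => /(h5 _ dx).1; rewrite E face0 ltxx.
have /choice[M hM] := cinv_reg.
move=> U /nbhs_ballP[e /= e0 hU].
pose f (t : R) : pt := face y + t *: axis R ord0.
have /choice[s hs] : forall i : 'I_n.+1, exists s : R, 0 < s /\ forall z, @cell R n.+1 z ->
    `|face y - z| < s -> `|cinv c (face y) ord0 i - cinv c z ord0 i| < e / 2.
  move=> i; have e2 : 0 < e / 2 by rewrite divr_gt0.
  have [_ _ _ u] := hcls_lv (hM i); have [s s0 h] := u _ e2.
  by exists s; split => // z cz; apply: h.
have [r1 r10 hr1] := open_ball (@cell_open R n.+1) cf.
pose r := \big[Num.min/r1]_i s i.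
have r0 : 0 < r by apply/bigmin_gtP; split => // i _; case: (hs i).
have fr : `|face y - f (r / 2)| < r.
  rewrite /f opprD addNKr normrN normrZ norm_axis mulr1 gtr0_norm ?divr_gt0//; lra.
have cz : @cell R n.+1 (f (r / 2)).
  apply: hr1; rewrite ball_norm distrC; apply: lt_le_trans fr _.
  exact: bigmin_le_id.
exists (cinv c (f (r / 2))); split.
  have [dz Ez] := h2 _ cz; apply/(h5 _ dz); rewrite Ez /f mxE face0 add0r mxE axisE.
  by rewrite eqxx mulr1 divr_gt0.
apply: hU; rewrite ball_norm distrC; apply: (@le_lt_trans _ _ (e / 2)); last by lra.
apply/rV_norm_le; first by rewrite divr_ge0// ltW.
move=> i; rewrite rV_subE; apply/ltW; apply: (hs i).2 => //.
apply: lt_le_trans fr _; exact: bigmin_le_cond.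
Qed.

Lemma chart_face x : cdom c x -> cmap c x ord0 ord0 = 0 ->
  cinv c (face (tail (cmap c x))) = x /\ @cell R n (tail (cmap c x)).
Proof.
move=> dx x0; case: cc => _ h1 _ _ _; have [cx E] := h1 _ dx.
by rewrite face_tail//; split => //; apply: tail_cell.
Qed.

End Chart.

(** * The normal in a chart *)

Section Normal.
Variables (R : realType) (n : nat) (Omega : set 'rV[R]_n.+1) (K : nat) (alpha : R).
Hypothesis oOmega : open Omega.
Hypothesis alpha01 : 0 <= alpha <= 1.
Variable c : chart R n.
Hypothesis cc : is_chart Omega K.+1 alpha c.
Notation pt := 'rV[R]_n.+1.
Variables (x0 nu : pt).
Hypotheses (dx0 : cdom c x0) (bx0 : bdry Omega x0).
Hypothesis nu_normal : outer_unit_normal Omega x0 nu.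

Let y0 := cmap c x0.
Let cy0 : @cell R n.+1 y0. Proof. by case: cc => _ h _ _ _; case: (h _ dx0). Qed.
Let Ey0 : cinv c y0 = x0. Proof. by case: cc => _ h _ _ _; case: (h _ dx0). Qed.
Let y00 : y0 ord0 ord0 = 0.
Proof. by have H := chart_bdry oOmega alpha01 cc; have := H x0 dx0 bx0. Qed.

Definition chart_grad x : pt := \row_i pd i (fun z => cmap c z ord0 ord0) x.

Lemma chart_jacobians :
  (\matrix_(i, l) pd i (fun z => cinv c z ord0 l) y0 : 'M[R]_n.+1) *m
  (\matrix_(l, q) pd l (fun z => cmap c z ord0 q) x0) = 1%:M.
Proof.
have oC := @cell_open R n.+1; have oc : open (cdom c) by case: cc.
have [rho rho0 hrho] := open_ball oc dx0.
have /choice[Mi hMi] := cinv_reg alpha01 cc.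
have /choice[Mm hMm] := fun q => cmap_reg alpha01 cc q rho0 hrho dx0.
apply/matrixP => i q; rewrite !mxE.
have dinv : is_derive y0 (axis R i) (cinv c) (\row_l pd i (fun z => cinv c z ord0 l) y0).
  apply: is_derive_rV => l; rewrite mxE; apply: is_derive_pd.
  exact: hcls_derivable (hMi l) cy0.
have bx : ball x0 rho (cinv c y0) by rewrite Ey0; exact: ballxx.
have oB : open (ball x0 rho) by exact: ball_open.
have H := is_derive_comp_axis (hcls_C1 oB (hMm q) bx) dinv.
rewrite Ey0 in H.
have E : {in @cell R n.+1, (fun z => cmap c (cinv c z) ord0 q) =1 (fun z : pt => z ord0 q)}.
  by move=> z; rewrite inE => cz; case: cc => _ _ h _ _; case: (h z cz) => _ ->.
have H' := near_eq_is_derive (eq_on_near oC E cy0) H.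
have := pd_val H'; rewrite (pd_val (is_derive_coord _ _ _)) axisE => ->.
by apply: eq_bigr => l _; rewrite !mxE.
Qed.

(** The images of the face axes are curves in the boundary. Orthogonality to them says that the
    Jacobian A of [cinv] maps nu to a multiple of e_0; applying the inverse Jacobian B turns e_0
    into the gradient of the 0-th coordinate. *)
Lemma normal_parallel : exists kappa, nu = kappa *: chart_grad x0.
Proof.
case: nu_normal => _ hcurve _.
have oC := @cell_open R n.+1.
have /choice[Mi hMi] := cinv_reg alpha01 cc.
set A : 'M[R]_n.+1 := \matrix_(i, l) pd i (fun z => cinv c z ord0 l) y0.
set B : 'M[R]_n.+1 := \matrix_(l, q) pd l (fun z => cmap c z ord0 q) x0.
have AB : A *m B = 1%:M := chart_jacobians.
have BA := mulmx1C AB.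
have Ai (j : 'I_n) : \sum_l A (lift ord0 j) l * nu ord0 l = 0.
  set i := lift ord0 j.
  pose gam (t : R) : pt := cinv c (y0 + t *: axis R i).
  have dgam : is_derive (0 : R) 1 gam (\row_l pd i (fun z => cinv c z ord0 l) y0).
    apply: is_derive_rV => l; rewrite mxE.
    have := @line_is_derive R n.+1 (fun z => cinv c z ord0 l) y0 i 0.
    rewrite scale0r addr0; apply.
    exact: hcls_derivable (hMi l) cy0.
  have := hcurve gam; rewrite /gam scale0r addr0 => /(_ Ey0) H.
  have [dg Eg] := dgam.
  rewrite -[RHS](H _ dg).
    rewrite Eg /dotv; apply: eq_bigr => l _; rewrite !mxE; exact: mulrC.
  have [r r0 hr] := open_ball oC cy0.
  apply/nbhs_ballP; exists r => // t; rewrite /ball /= sub0r normrN => tr.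
  have cz : @cell R n.+1 (y0 + t *: axis R i).
    by apply: hr; rewrite ball_norm addKx normrZ norm_axis mulr1.
  have z0 : (y0 + t *: axis R i) ord0 ord0 = 0.
    by rewrite mxE y00 add0r mxE axisE /i eq_sym (negbTE (neq_lift _ _)) mulr0.
  by rewrite -(face_tail z0); apply: (face_bdry alpha01 cc (tail_cell cz)).1.
exists (\sum_l A ord0 l * nu ord0 l).
have E : A *m nu^T = (\sum_l A ord0 l * nu ord0 l) *: (axis R ord0)^T.
  apply/colP => i; rewrite [RHS]mxE [(axis R ord0)^T _ _]mxE axisE mxE.
  case: (unliftP ord0 i) => [j|] ->.
    rewrite mulr0 -[RHS](Ai j); apply: eq_bigr => l _; by rewrite [nu^T _ _]mxE.
  by rewrite mulr1; apply: eq_bigr => l _; rewrite [nu^T _ _]mxE.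
have : nu^T = (\sum_l A ord0 l * nu ord0 l) *: (B *m (axis R ord0)^T).
  by rewrite scalemxAr -E mulmxA BA mul1mx.
move=> /(congr1 trmx); rewrite trmxK => {1}->.
rewrite [LHS]linearZ /=; congr (_ *: _); apply/rowP => i.
rewrite mxE [RHS]mxE mxE (bigD1 ord0)//= big1 => [|l l0].
  by rewrite [X in _ * X]mxE axisE eqxx mulr1 addr0 mxE.
by rewrite [X in _ * X]mxE axisE eq_sym (negbTE l0) mulr0.
Qed.

End Normal.

(** * Gluing the local solutions *)

Section Products.
Variables (R : realType) (d : nat).
Notation pt := 'rV[R]_d.

Lemma pder_lin (theta M M' a : R) k (f g : pt -> R) (s : seq 'I_d) :
  hcls setT theta k M f -> hcls setT theta k M' g -> (size s <= k)%N ->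
  pder s (fun x => a * f x + g x) = (fun x => a * pder s f x + pder s g x).
Proof.
move=> hf hg; elim: s => [//|i s IH] sk; have sk' := ltnW sk.
rewrite !pder_cons IH//; apply/funext => x.
have hf' := hcls_pder sk' hf; have hg' := hcls_pder sk' hg.
rewrite -subnSK// in hf' hg'.
have df := is_derive_pd (hcls_derivable (i := i) hf' (I : [set: pt] x)).
have dg := is_derive_pd (hcls_derivable (i := i) hg' (I : [set: pt] x)).
exact: pd_val.
Qed.

(** Leibniz as in [jetM]: the other terms contain derivatives of g of order less than q. A cut-off
    thus acts on a flat function as multiplication by its value. *)
Lemma pder_mul_flat (theta M M' : R) q (f g : pt -> R) (x : pt) (s : seq 'I_d) :
  hcls setT theta q M f -> hcls setT theta q M' g ->
  (forall s, (size s < q)%N -> pder s g x = 0) -> (size s <= q)%N ->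
  pder s (fun y => f y * g y) x = f x * pder s g x.
Proof.
elim: q M M' f g s => [|q IH] M M' f g s hf hg g0.
  by rewrite leqn0 size_eq0 => /eqP ->.
case/lastP: s => [//|s i]; rewrite size_rcons ltnS => sq.
rewrite -pder_pd.
have -> : pd i (fun y => f y * g y) = (fun y => 1 * (pd i f y * g y) + f y * pd i g y).
  apply/funext => y; apply: pd_val.
  have df := is_derive_pd (hcls_derivable (i := i) hf (I : [set: pt] y)).
  have dg := is_derive_pd (hcls_derivable (i := i) hg (I : [set: pt] y)).
  by apply: is_derive_eq; rewrite /GRing.scale /=; ring.
have hf' := hcls_leq (leqnSn q) hf; have hg' := hcls_leq (leqnSn q) hg.
rewrite (pder_lin 1 (hclsM openT (hcls_pd i hf) hg') (hclsM openT hf' (hcls_pd i hg)) sq).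
rewrite (IH _ _ _ _ _ (hcls_pd i hf) hg' _ sq); last first.
  by move=> t tq; apply: g0; exact: ltnW.
rewrite (IH _ _ _ _ _ hf' (hcls_pd i hg) _ sq); last first.
  by move=> t tq; rewrite pder_pd; apply: g0; rewrite size_rcons.
by rewrite g0 ?ltnS// pder_pd; ring.
Qed.

Lemma reg_det (D : set pt) (theta : R) k p (T : pt -> 'M[R]_p) : open D ->
  (forall i j, reg D theta k (fun y => T y i j)) -> reg D theta k (fun y => \det (T y)).
Proof.
move=> oD hT; apply: reg_sum => // s _; apply: regM => //; first exact: reg_cst.
by apply: reg_prod => // i _.
Qed.

Lemma reg_adj (D : set pt) (theta : R) k p (T : pt -> 'M[R]_p) i j : open D ->
  (forall i j, reg D theta k (fun y => T y i j)) -> reg D theta k (fun y => (\adj (T y)) i j).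
Proof.
move=> oD hT.
apply: (reg_ext oD (f := fun y => (-1) ^+ (j + i) * \det (row' j (col' i (T y))))).
  by move=> y _; rewrite [RHS]mxE.
apply: regM => //; first exact: reg_cst.
apply: reg_det => // i' j'; apply: (reg_ext oD (f := fun y => T y (lift j i') (lift i j'))) => //.
by move=> y _; rewrite !mxE.
Qed.

Lemma mpow_scale K (a : R) (v : pt) (b : mindex d K) : mpow (a *: v) b = a ^+ mlen b * mpow v b.
Proof.
rewrite /mpow /mlen -prodrXr -big_split /=; apply: eq_bigr => i _.
by rewrite mxE exprMn.
Qed.

Lemma reg_bound (D : set pt) (theta e : R) k (f : pt -> R) (x : pt) :
  open D -> reg D theta k f -> D x -> 0 < e ->
  exists2 r : R, 0 < r & forall y, `|y - x| < r -> D y /\ `|f y - f x| < e.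
Proof.
move=> oD [M hf] Dx e0; have [_ _ _ u] := hcls_lv hf.
have [r r0 hr] := open_ball oD Dx; have [s s0 hs] := u e e0.
exists (Num.min r s) => [|y]; first by rewrite lt_min r0.
rewrite lt_min => /andP[yr ys]; have Dy : D y by apply: hr; rewrite ball_norm.
by split => //; exact: hs.
Qed.

End Products.

Lemma regmap_leqn (R : realType) d d' (D : set 'rV[R]_d) (D' : set 'rV[R]_d') (theta L : R)
  k k' (Phi : 'rV[R]_d -> 'rV[R]_d') : (k' <= k)%N ->
  regmap D D' theta k L Phi -> regmap D D' theta k' L Phi.
Proof.
elim: k => [|k IH]; first by rewrite leqn0 => /eqP ->.
rewrite leq_eqVlt => /orP[/eqP -> //|]; rewrite ltnS => kk /regmap_leq.
exact: IH.
Qed.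

(** * Local solutions, gluing and recursion on the order *)

Section Patches.
Variables (R : realType) (n K N J : nat) (alpha : R) (Omega : set 'rV[R]_n.+1).
Notation pt := 'rV[R]_n.+1.
Hypothesis K_gt0 : (0 < K)%N.
Hypothesis alpha01 : 0 <= alpha <= 1.
Hypothesis oOmega : open Omega.
Variables (p : nat) (c : 'I_p -> chart R n).
Hypothesis cc : forall i, is_chart Omega K alpha (c i).
Variables (mo : 'I_J -> nat) (b : 'I_J -> mindex n.+1 K -> pt -> 'rV[R]_N).
Hypothesis mo_lt : forall j, (mo j < K)%N.
Hypothesis b_reg : forall (j : 'I_J) (beta : mindex n.+1 K),
  (mlen beta <= mo j)%N -> holder_bdry c (K - mo j) alpha (b j beta).

Let cc' i : is_chart Omega K.-1.+1 alpha (c i). Proof. by rewrite prednK. Qed.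

(** With explicit bounds M on data and on solutions, boundedness of a composite operator is
    multiplication of constants. *)
Definition bdata theta (M : R) (g : 'I_J -> pt -> R) := 0 <= M /\
  forall i j, hcls (@cell R n) theta (K - mo j) M (local_rep (c i) (g j)).

Definition states theta (M : R) (u : 'I_N -> pt -> R) := 0 <= M /\
  forall l, hcls setT theta K M (u l).

(* [bdry_op] on the components of a function that is smooth across the boundary. *)
Definition bdop j (u : 'I_N -> pt -> R) (x : pt) : R :=
  \sum_(beta : mindex n.+1 K | (mlen beta <= mo j)%N)
    \sum_l b j beta x ord0 l * pder (mseq beta) (u l) x.

(** W is chosen before theta, while C may depend on theta. Linearity presupposes a relation on the
    boundary only, so on data W depends on boundary values alone. *)
Definition extension_op (W : ('I_J -> pt -> R) -> 'I_N -> pt -> R) :=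
  forall theta, 0 <= theta <= alpha ->
  (exists2 C : R, 0 <= C & forall M g, bdata theta M g -> states theta (C * M) (W g)) /\
  forall (a M M' M'' : R) g h r, bdata theta M g -> bdata theta M' h -> bdata theta M'' r ->
    (forall j x, bdry Omega x -> r j x = a * g j x + h j x) ->
    forall l x, W r l x = a * W g l x + W h l x.

(** The equation has right-hand side psi * g_j on the whole boundary, instead of g_j on U only. The
    remaining defect (1 - psi) * g_j is then explicit, and a second solution can absorb it. *)
Definition solved_on k (U : set pt) :=
  exists (psi : pt -> R) W, [/\ reg setT alpha K psi, forall x, U x -> psi x = 1,
    extension_op W &
    forall theta M g x, 0 <= theta <= alpha -> bdata theta M g -> bdry Omega x ->
      (forall l s, (size s < k)%N -> pder s (W g l) x = 0) /\
      forall j, mo j = k -> bdop j (W g) x = psi x * g j x].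

Let th01 theta : 0 <= theta <= alpha -> 0 <= theta <= 1.
Proof. by case/andP: alpha01 => _ a1 /andP[-> /le_trans ->]. Qed.

Let oT : open [set: pt]. Proof. exact: openT. Qed.

Let tha theta : 0 <= theta <= alpha -> theta <= alpha. Proof. by case/andP. Qed.

Lemma chart_param_regmap theta i : 0 <= theta <= alpha -> exists L,
  regmap (@cell R n) setT theta K L (fun y => cinv (c i) (face y)).
Proof.
move=> ta; suff : exists L, regmap (@cell R n) setT theta K.-1.+1 L (fun y => cinv (c i) (face y)).
  by rewrite prednK.
apply: regmap_of_reg => //; first exact: cell_boxy.
move=> q; apply: (reg_theta (th01 ta) (tha ta)).
apply: (reg_comp (f := fun z => cinv (c i) z ord0 q) alpha01 (@cell_open R n) (@cell_open R n.+1)).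
  exact: regmap_face.
exact: (cinv_reg alpha01 (cc' i)).
Qed.

Lemma coef_reg i j beta l : (mlen beta <= mo j)%N ->
  reg (@cell R n) alpha (K - mo j) (fun y => b j beta (cinv (c i) (face y)) ord0 l).
Proof.
move=> hb; have h := b_reg hb i.
eexists; apply: (holder_hcls (ell := fun v : 'rV[R]_N => v ord0 l)) h => //.
- by move=> a u v; apply: coord_lin.
- by move=> v; apply: rV_norm_coord.
- exact: cell_open.
- exact: cell_open.
- exact: cell_boxy.
- by exists 1 => x /cell_norm /ltW.
- exact: cell_nonempty.
Qed.

(** Derivatives of order at most [mo j] of a state still have class [K - mo j] on the boundary,
    which is also the class of the coefficients. *)
Lemma bdop_bounded theta : 0 <= theta <= alpha ->
  exists2 C : R, 0 <= C & forall M u, states theta M u -> bdata theta (C * M) (bdop^~ u).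
Proof.
move=> ta; have t01 := th01 ta.
have oc := @cell_open R n.
suff /choice[C hC] : forall ij : 'I_p * 'I_J, exists C : R, 0 <= C /\ forall M u,
    states theta M u ->
    hcls (@cell R n) theta (K - mo ij.2) (C * M) (local_rep (c ij.1) (bdop ij.2 u)).
  have S0 : 0 <= \sum_ij C ij by apply: sumr_ge0 => ij _; case: (hC ij).
  exists (\sum_ij C ij) => // M u hu; have [M0 hl] := hu; split; first exact: mulr_ge0.
  move=> i j; have [C0 h] := hC (i, j); apply: hcls_le (h _ _ hu).
  apply: ler_wpM2r => //; rewrite (bigD1 (i, j))//= lerDl sumr_ge0// => ij _.
  by case: (hC ij).
case=> i j /=.
have /choice[Mb hMb] : forall bl : mindex n.+1 K * 'I_N, exists Mb : R, 0 <= Mb /\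
   ((mlen bl.1 <= mo j)%N ->
   hcls (@cell R n) theta (K - mo j) Mb (fun y => b j bl.1 (cinv (c i) (face y)) ord0 bl.2)).
  case=> beta l /=; have [hb|] := boolP (mlen beta <= mo j)%N; last by exists 0.
  have [Q hQ] := reg_theta t01 (tha ta) (coef_reg i l hb).
  by exists Q; split => //; exact: hcls_ge0 hQ.
have [L hL] := chart_param_regmap i ta.
have [Cc Cc0 hCc] := hcls_comp t01 oc oT (K - mo j) L.
pose Q bl : R := 2 ^+ (K - mo j).+1 * Mb bl * Cc.
have Q0 bl : 0 <= Q bl.
  by rewrite /Q !mulr_ge0// ?exprn_ge0//; case: (hMb bl).
exists (\sum_(beta : mindex n.+1 K | (mlen beta <= mo j)%N) \sum_l Q (beta, l)); split.
  by apply: sumr_ge0 => beta _; apply: sumr_ge0.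
move=> M u [M0 hu]; rewrite mulr_suml; apply: hcls_sum => // beta hb.
rewrite mulr_suml; apply: hcls_sum => // l _.
rewrite /Q -mulrA; apply: hclsM => //; first by case: (hMb (beta, l)) => _; apply.
apply: (hCc M (pder (mseq beta) (u l))); first exact: regmap_leqn (leq_subr _ _) hL.
apply: (hcls_leq (k := K - size (mseq beta))).
  by rewrite size_mseq leq_sub2l.
by apply: hcls_pder => //; rewrite size_mseq; apply: leq_trans hb (ltnW (mo_lt j)).
Qed.

(** The relation is between derivatives at a single point, so that a can be the value of a cut-off
    there. *)
Lemma bdop_comb j (a : R) u v w x :
  (forall (beta : mindex n.+1 K) l, (mlen beta <= mo j)%N -> pder (mseq beta) (w l) x =
     a * pder (mseq beta) (u l) x + pder (mseq beta) (v l) x) ->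
  bdop j w x = a * bdop j u x + bdop j v x.
Proof.
move=> h; rewrite /bdop mulr_sumr -big_split /=; apply: eq_bigr => beta hb.
by rewrite mulr_sumr -big_split /=; apply: eq_bigr => l _; rewrite h//; ring.
Qed.

Lemma bdop_lin theta M M' j (a : R) u v w x : states theta M u -> states theta M' v ->
  (forall l y, w l y = a * u l y + v l y) -> bdop j w x = a * bdop j u x + bdop j v x.
Proof.
move=> [_ hu] [_ hv] hw; apply: bdop_comb => beta l hb.
have -> : w l = (fun y => a * u l y + v l y) by apply/funext.
rewrite (pder_lin a (hu l) (hv l))// size_mseq.
exact: leq_trans hb (ltnW (mo_lt j)).
Qed.

Lemma solved_on0 k : solved_on k set0.
Proof.
exists (fun=> 0), (fun _ _ _ => 0); split => //; first exact: reg_cst oT _ _.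
  move=> theta ta; split.
    exists 0 => // M g _; split; first by rewrite mul0r.
    by move=> l; have := hcls_cst theta oT K 0; rewrite normr0 mul0r.
  by move=> a M M' M'' g h r _ _ _ _ l x; rewrite mulr0 addr0.
move=> theta M g x ta hg bx.
have p0 s : pder s (fun _ : pt => (0 : R)) = (fun=> 0).
  elim: s => //= i s ->; apply/funext => y; rewrite derive_cst//.
split=> [l s _|j _]; first by rewrite p0.
rewrite mul0r /bdop big1// => beta _; rewrite big1// => l _.
by rewrite p0 mulr0.
Qed.

Lemma solved_on_sub k (U V : set pt) : U `<=` V -> solved_on k V -> solved_on k U.
Proof. by move=> UV [psi [W [h1 h2 h3 h4]]]; exists psi, W; split => // x /UV; exact: h2. Qed.

(* The derivatives of [W2 g] of order less than [k] vanish on the boundary, so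
   there the factor [1 - psi1] only scales those of order [k]. *)
Lemma solved_onU k (U V : set pt) : (k < K)%N ->
  solved_on k U -> solved_on k V -> solved_on k (U `|` V).
Proof.
move=> kK [psi1 [W1 [r1 e1 b1 s1]]] [psi2 [W2 [r2 e2 b2 s2]]].
pose chi x := 1 - psi1 x.
have rchi : reg setT alpha K chi by apply: regB => //; exact: reg_cst oT _ _.
exists (fun x => psi1 x + chi x * psi2 x).
exists (fun g l x => 1 * (chi x * W2 g l x) + W1 g l x); split.
- by apply: regD => //; apply: regM.
- by move=> x [/e1|/e2] E; rewrite /chi E; ring.
- move=> theta ta; have [[C1 C10 h1] l1] := b1 _ ta; have [[C2 C20 h2] l2] := b2 _ ta.
  have [Q hQ] := reg_theta (th01 ta) (tha ta) rchi; have Q0 := hcls_ge0 hQ.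
  split.
    exists (1 * (2 ^+ K.+1 * Q * C2) + C1).
      by rewrite addr_ge0// mul1r !mulr_ge0// exprn_ge0.
    move=> M g hg; have M0 := hg.1; split.
      by rewrite mulr_ge0// addr_ge0// mul1r !mulr_ge0// exprn_ge0.
    move=> l; have [_ /(_ l) u1] := h1 _ _ hg; have [_ /(_ l) u2] := h2 _ _ hg.
    have := hclsD oT (hclsZ oT 1 (hclsM oT hQ u2)) u1.
    by rewrite normr1 mulrDl !mulrA.
  move=> a M M' M'' g h r hg hh hr E l x.
  by rewrite (l1 _ _ _ _ _ _ _ hg hh hr E) (l2 _ _ _ _ _ _ _ hg hh hr E); ring.
- move=> theta M g x ta hg bx.
  have [[C1 _ h1] _] := b1 _ ta; have [[C2 _ h2] _] := b2 _ ta.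
  have [_ {}h1] := h1 _ _ hg; have [_ {}h2] := h2 _ _ hg.
  have [f1 B1] := s1 _ _ _ _ ta hg bx; have [f2 B2] := s2 _ _ _ _ ta hg bx.
  have [Q hQ] := reg_theta (th01 ta) (tha ta) rchi.
  have kK' := ltnW kK.
  have P l s : (size s <= k)%N ->
      pder s (fun x => 1 * (chi x * W2 g l x) + W1 g l x) x =
      chi x * pder s (W2 g l) x + pder s (W1 g l) x.
    move=> sk; rewrite (pder_lin 1 (hclsM oT hQ (h2 l)) (h1 l)) ?(leq_trans sk)// mul1r.
    by rewrite (pder_mul_flat (hcls_leq kK' hQ) (hcls_leq kK' (h2 l)) (f2 l) sk).
  split=> [l s sk|j jk].
    by rewrite P ?(ltnW sk)// f1// f2// mulr0 addr0.
  rewrite (@bdop_comb j (chi x) (W2 g) (W1 g)); last first.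
    by move=> beta l hb; rewrite P// size_mseq -jk.
  by rewrite B1// B2//; ring.
Qed.

Variable nu : pt -> pt.
Hypothesis nu_normal : forall x, bdry Omega x -> outer_unit_normal Omega x (nu x).
Hypothesis normal_inverse : forall k x, (k < K)%N -> bdry Omega x ->
  exists v : 'I_J -> 'I_N -> R, forall j j', mo j = k -> mo j' = k ->
    \sum_l (\sum_(beta : mindex n.+1 K | mlen beta == k)
       mpow (nu x) beta * b j beta x ord0 l) * v j' l = (j == j')%:R.

Lemma reg_op theta k d B q (f : 'rV[R]_d -> R) : 0 <= theta <= alpha -> open B ->
  reg B alpha k f -> (q <= k)%N -> exists2 C : R, 0 <= C & forall M g,
    hcls B theta q M g -> hcls B theta q (C * M) (fun y => f y * g y).
Proof.
move=> ta oB /(reg_theta (th01 ta) (tha ta))[Q hQ] qk.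
exists (2 ^+ q.+1 * Q) => [|M g hg]; last exact: (hclsM oB (hcls_leq qk hQ)).
by rewrite mulr_ge0 ?exprn_ge0//; exact: hcls_ge0 hQ.
Qed.

Section Patch.
Variables (k : nat) (x0 : pt) (i : 'I_p).
Hypotheses (kK : (k < K)%N) (dx0 : cdom (c i) x0) (bx0 : bdry Omega x0).
Notation par y := (cinv (c i) (face y)).
Let y0 := tail (cmap (c i) x0).

(** The principal symbol at the gradient of the chart. This gradient is of class K - 1, while nu is
    given only pointwise. *)
Definition symb j l y : R := \sum_(beta : mindex n.+1 K | mlen beta == mo j)
  mpow (chart_grad (c i) (par y)) beta * b j beta (par y) ord0 l.

Let cmap0 x : cdom (c i) x -> bdry Omega x -> cmap (c i) x ord0 ord0 = 0.
Proof. exact: (chart_bdry oOmega alpha01 (cc' i)). Qed.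

Let par_y0 : par y0 = x0 /\ @cell R n y0.
Proof. by have H := chart_face (cc' i); have := H _ dx0 (cmap0 dx0 bx0). Qed.

Let chart_ball : exists2 rho : R, 0 < rho & ball x0 rho `<=` cdom (c i).
Proof. by case: (cc i) => oc _ _ _ _; have [r r0 h] := open_ball oc dx0; exists r. Qed.

Lemma regmap_sub d d' (D D1 : set 'rV[R]_d) (D' D1' : set 'rV[R]_d') (theta L : R) q Phi :
  D1 `<=` D -> (forall x, D1 x -> D1' (Phi x)) ->
  regmap D D' theta q L Phi -> regmap D1 D1' theta q L Phi.
Proof.
move=> sD sD' [L0 _ lip h]; split => //; first by move=> x y /sD Dx /sD; exact: lip.
case: q h => // q h i1 j1; have [h1 h2] := h i1 j1.
by split; [move=> x /sD; exact: h1|exact: hcls_sub h2].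
Qed.

Lemma symb_reg : exists2 r : R, 0 < r & ball y0 r `<=` @cell R n /\
  forall j l, reg (ball y0 r) alpha (K - mo j) (symb j l).
Proof.
have [rho rho0 hrho] := chart_ball.
have aa : 0 <= alpha <= alpha by case/andP: alpha01 => -> _; rewrite lexx.
have [L hL] := chart_param_regmap i aa.
have [Ey0 cy0] := par_y0.
have oc := @cell_open R n.
have [r1 r10 hr1] := open_ball oc cy0.
have [L0 _ lip _] := hL.
have L1 : 0 < L + 1 by rewrite ltr_wpDl.
pose r := Num.min r1 (rho / (L + 1)).
have r0 : 0 < r by rewrite lt_min r10 divr_gt0.
have sr : ball y0 r `<=` @cell R n.
  by move=> y; rewrite ball_norm lt_min => /andP[yr _]; apply: hr1; rewrite ball_norm.
have hP : regmap (ball y0 r) (ball x0 rho) alpha K L (fun y => par y).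
  apply: regmap_sub hL => // y yr; rewrite ball_norm -{1}Ey0.
  apply: (le_lt_trans (lip _ _ (sr _ yr) cy0)).
  move: yr; rewrite ball_norm lt_min => /andP[_]; rewrite ltr_pdivlMr// => H.
  by apply: le_lt_trans H; rewrite mulrC ler_wpM2l// lerDl.
have oB : open (ball y0 r) by exact: ball_open.
have oB' : open (ball x0 rho) by exact: ball_open.
exists r => //; split => // j l.
apply: reg_sum => // beta /eqP hb.
apply: regM => //; last first.
  by apply: reg_sub sr _; apply: coef_reg; rewrite hb.
(* For [mo j = 0] the class K exceeds that of the gradient, but the monomial is then the constant
   1. *)
have [j0|jpos] := posnP (mo j).
  apply: (reg_ext oB (f := fun=> 1)); last exact: reg_cst.
  move=> y _; rewrite mpow_mseq.
  have : size (mseq beta) == 0%N by rewrite size_mseq hb j0.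
  by rewrite size_eq0 => /eqP ->; rewrite big_nil.
apply: reg_prod => // q _; apply: reg_exp => //.
apply: (reg_ext oB (f := fun y => pd q (fun z => cmap (c i) z ord0 ord0) (par y))).
  by move=> y _; rewrite mxE.
apply: (reg_comp (f := pd q (fun z => cmap (c i) z ord0 ord0)) alpha01 oB oB').
  exact: regmap_leqn (leq_subr _ _) hP.
apply: (reg_leq (k := K.-1)); first by rewrite -subn1 leq_sub2l.
by apply: reg_pd; apply: (cmap_reg alpha01 (cc' i) ord0 rho0 hrho dx0).
Qed.

(** A right inverse v at y0 is kept constant and corrected by the inverse of T = symbol times v. As
    T is the identity at y0, its determinant stays above 1 / 2 nearby, and adjugate over determinant
    has the regularity of T. *)
Lemma symb_right_inverse : exists2 r : R, 0 < r &
  exists Q : 'I_N -> 'I_J -> 'rV[R]_n -> R,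
  [/\ ball y0 r `<=` @cell R n, forall l j, reg (ball y0 r) alpha (K - k) (Q l j) &
   forall y j j', ball y0 r y -> mo j = k -> mo j' = k ->
     \sum_l symb j l y * Q l j' y = (j == j')%:R].
Proof.
have [r1 r10 [sr1 hS]] := symb_reg.
have [Ey0 cy0] := par_y0.
have [kap hkap] := normal_parallel oOmega alpha01 (cc' i) dx0 bx0 (nu_normal bx0).
have [v0 hv0] := normal_inverse kK bx0.
(* The symbol is homogeneous of degree k, so the factor [kap ^+ k] relating the normal to the
   gradient moves into the right inverse. *)
pose v j l := kap ^+ k * v0 j l.
have hv j j' : mo j = k -> mo j' = k -> \sum_l symb j l y0 * v j' l = (j == j')%:R.
  move=> jk jk'; rewrite -(hv0 j j' jk jk'); apply: eq_bigr => l _.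
  rewrite /v mulrA; congr (_ * _); rewrite mulr_suml /symb Ey0 jk.
  apply: eq_bigr => beta /eqP hb; rewrite hkap mpow_scale hb; ring.
(* The symbol times its right inverse at [y0], completed by the identity outside
   the rows and columns of order [k] to avoid matrices of dependent size. *)
pose T y : 'M[R]_J := \matrix_(j, j') if (mo j == k) && (mo j' == k)
  then \sum_l symb j l y * v j' l else (j == j')%:R.
have oB : open (ball y0 r1) by exact: ball_open.
have T1 : T y0 = 1%:M.
  apply/matrixP => j j'; rewrite !mxE; case: ifP => // /andP[/eqP jk /eqP jk'].
  exact: hv.
have regT j j' : reg (ball y0 r1) alpha (K - k) (fun y => T y j j').
  have [/andP[/eqP jk /eqP jk']|nk] := boolP ((mo j == k) && (mo j' == k)).
    apply: (reg_ext oB (f := fun y => \sum_l symb j l y * v j' l)).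
      by move=> y _; rewrite mxE jk jk' eqxx.
    by apply: reg_sum => // l _; apply: regM => //; [rewrite -jk|exact: reg_cst].
  apply: (reg_ext oB (f := fun=> (j == j')%:R)); last exact: reg_cst.
  by move=> y _; rewrite mxE (negbTE nk).
have regD' := reg_det oB regT.
have half0 : 0 < 1 / 2 :> R by rewrite divr_gt0.
have [r r0 hr] := reg_bound oB regD' (ballxx _ r10) half0.
have sr : ball y0 r `<=` ball y0 r1.
  by move=> y; rewrite ball_norm => /hr[].
have oBr : open (ball y0 r) by exact: ball_open.
have det_lb y : ball y0 r y -> 1 / 2 <= `|\det (T y)|.
  rewrite ball_norm => /hr[_]; rewrite T1 det1 => /ltW h.
  have : `|1 : R| <= `|\det (T y)| + `|\det (T y) - 1|.
    rewrite -{1}(subKr (\det (T y)) 1); exact: ler_normB.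
  by rewrite normr1; lra.
exists r => //; exists (fun l j y => \sum_(j' | mo j' == k)
  v j' l * ((\adj (T y)) j' j * (\det (T y))^-1)); split.
- exact: subset_trans sr sr1.
- move=> l j; apply: reg_sum => // j' _; apply: regM => //; first exact: reg_cst.
  apply: regM => //.
    by apply: reg_adj => // a a'; exact: reg_sub sr (regT a a').
  by apply: (reg_inv oBr half0) => //; exact: reg_sub sr regD'.
move=> y j j' yr jk jk'.
have dT : \det (T y) != 0.
  by rewrite -normr_gt0; apply: lt_le_trans (det_lb _ yr).
under eq_bigr => l _ do rewrite mulr_sumr.
rewrite exchange_big /=.
have -> : (j == j')%:R = (T y *m \adj (T y)) j j' * (\det (T y))^-1.
  by rewrite mul_mx_adj mxE; case: (j == j'); rewrite ?mulfV// mulr0n mul0r.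
(* Row j has order k, so in columns of another order T has the entries of the identity, which vanish
   there. *)
rewrite mxE mulr_suml [RHS](bigID (fun j'' => mo j'' == k)) /= [X in _ + X]big1 ?addr0; last first.
  move=> j'' nk; rewrite [T y j j'']mxE jk eqxx (negbTE nk) /=.
  by case: eqP => [E|]; [move: nk; rewrite -E jk eqxx|rewrite !mul0r].
apply: eq_bigr => j'' k''; rewrite [T y j j'']mxE jk k'' eqxx /= -mulrA mulr_suml.
by apply: eq_bigr => l _; rewrite !mulrA.
Qed.

(** The cut-off zeta extends H g by zero to all of R^n, where the lift operates; the symbol equation
    then holds only near y0. *)
Lemma symb_lift : exists2 r : R, 0 < r &
  exists H : ('I_J -> pt -> R) -> 'I_N -> 'rV[R]_n -> R,
  [/\ forall theta, 0 <= theta <= alpha -> exists2 C : R, 0 <= C & forall M g l,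
        bdata theta M g -> hcls setT theta (K - k) (C * M) (H g l),
   forall (a : R) g h s, (forall j x, bdry Omega x -> s j x = a * g j x + h j x) ->
     forall l y, H s l y = a * H g l y + H h l y &
   forall g j y, ball y0 r y -> mo j = k ->
     \sum_l symb j l y * H g l y = g j (par y)].
Proof.
have [r r0 [Q [sr hQ QE]]] := symb_right_inverse.
have r2 : 0 < r / 2 by rewrite divr_gt0.
have rr : 2 * (r / 2) = r by rewrite mulrC divfK.
have oB : open (ball y0 r) by exact: ball_open.
(* Radius r / 2, as the extension by zero uses regularity on the ball of twice this radius; zeta is
   1 within r / 4. *)
have [zeta [zr z1 z0]] := bump_exists alpha01 (K - k) y0 r2.
pose H (g : 'I_J -> pt -> R) l y := zeta y * \sum_(j | mo j == k) Q l j y * g j (par y).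
exists (r / 2 / 2); first by rewrite divr_gt0.
exists H; split.
- move=> theta ta; have t01 := th01 ta.
  have [C0 C00 hC0] := hcls_zero_ext t01 (K - k) y0 r2.
  have /choice[C1 hC1] : forall lj : 'I_N * 'I_J, exists C : R, 0 <= C /\ forall M g,
      hcls (ball y0 r) theta (K - k) M g ->
      hcls (ball y0 r) theta (K - k) (C * M) (fun y => Q lj.1 lj.2 y * g y).
    by case=> l j; have [C ? ?] := reg_op ta oB (hQ l j) (leqnn _); exists C.
  have [C2 C20 hC2] := reg_op ta oB (reg_sub (@subsetT _ _) zr) (leqnn _).
  have C10 lj : 0 <= C1 lj by case: (hC1 lj).
  exists (C0 * (C2 * \sum_l \sum_j C1 (l, j))).
    by rewrite !mulr_ge0// sumr_ge0// => l _; apply: sumr_ge0.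
  move=> M g l [M0 hg]; rewrite -!mulrA; apply: hC0; last first.
    by move=> y /z0 zy; rewrite /H zy mul0r.
  rewrite rr; apply: hC2.
  apply: (@hcls_le _ _ _ _ _ (\sum_(j | mo j == k) C1 (l, j) * M)).
    rewrite -mulr_suml ler_wpM2r//.
    apply: (@le_trans _ _ (\sum_j C1 (l, j))).
      by rewrite [leRHS](bigID (fun j => mo j == k)) /= lerDl sumr_ge0.
    by rewrite [leRHS](bigD1 l)//= lerDl sumr_ge0// => l' _; apply: sumr_ge0.
  apply: hcls_sum => // j /eqP jk; apply: (hC1 (l, j)).2.
  by rewrite -jk; apply: hcls_sub sr _; exact: hg.
- move=> a g h s E l y; rewrite /H.
  have [yr|] := boolP (`|y - y0| < r); last first.
    rewrite -leNgt => yr; rewrite z0 ?mul0r ?mulr0 ?addr0//.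
    by apply: lt_le_trans yr; rewrite ltr_pdivrMr// mulr2n mulrDr mulr1 ltrDl.
  have cy : @cell R n y by apply: sr; rewrite ball_norm.
  have bp := (face_bdry alpha01 (cc' i) cy).1.
  rewrite mulrCA -mulrDr; congr (_ * _); rewrite mulr_sumr -big_split /=.
  by apply: eq_bigr => j _; rewrite E//; ring.
- move=> g j y; rewrite ball_norm => yr jk.
  have yr' : ball y0 r y by rewrite ball_norm; lra.
  rewrite /H z1//; under eq_bigr => l _ do rewrite mul1r mulr_sumr.
  rewrite exchange_big /=.
  rewrite (bigD1 j) ?jk//= [X in _ + X]big1 ?addr0; last first.
    move=> j' /andP[/eqP jk' jj']; under eq_bigr => l _ do rewrite mulrA.
    by rewrite -mulr_suml QE// eq_sym (negbTE jj') mul0r.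
  under eq_bigr => l _ do rewrite mulrA.
  by rewrite -mulr_suml QE// eqxx mul1r.
Qed.

(** W g is psi times the lift of H g pulled back by the chart. At a boundary point its k-th order
    derivatives are psi * H g times monomials in the conormal; contracting them with the
    coefficients of B_j gives psi times the symbol applied to H g, hence psi * g_j. *)
Lemma solved_near : exists2 U, open U /\ U x0 & solved_on k U.
Proof.
have [r r0 [H [Hb Hl HE]]] := symb_lift.
have [rho rho0 hrho] := chart_ball.
have cellc x : cdom (c i) x -> @cell R n.+1 (cmap (c i) x).
  by case: (cc i) => _ h _ _ _ /h[].
have [L hL] : exists L, regmap (ball x0 rho) (@slab R n) alpha K L (cmap (c i)).
  rewrite -(prednK K_gt0); apply: regmap_of_reg; first exact: boxy_ball.
    by move=> q; apply: (cmap_reg alpha01 (cc' i) q rho0 hrho dx0).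
  by move=> x /hrho dx; apply: cell_slab; exact: cellc.
have [L0 _ lip _] := hL; have L1 : 0 < L + 1 by rewrite ltr_wpDl.
(* By the Lipschitz bound the tangential part of the chart maps the q-ball into the ball about y0
   where H g solves the symbol equation. *)
pose q := Num.min rho (r / (L + 1)).
have q0 : 0 < q by rewrite lt_min rho0 divr_gt0.
pose t := q / 2; have t0 : 0 < t by rewrite divr_gt0.
have Eq : 2 * t = q by rewrite mulrC divfK.
have tq : t < q by rewrite -Eq mulr2n mulrDl mul1r ltrDl.
pose D : set pt := ball x0 q; have oD : open D by exact: ball_open.
have Drho x : D x -> ball x0 rho x by rewrite /D /= !ball_norm lt_min => /andP[].
have Dc x : D x -> cdom (c i) x by move=> /Drho /hrho.
have Dr x : D x -> ball y0 r (tail (cmap (c i) x)).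
  move=> Dx; rewrite ball_norm; apply: le_lt_trans (norm_tailB _ _) _.
  apply: le_lt_trans (lip _ _ (Drho _ Dx) (ballxx _ rho0)) _.
  move: Dx; rewrite /D /= ball_norm lt_min => /andP[_]; rewrite ltr_pdivlMr// => h.
  by apply: le_lt_trans h; rewrite mulrC ler_wpM2l// lerDl.
have [psi [rpsi p1 p0]] := bump_exists alpha01 K x0 t0.
pose W (g : 'I_J -> pt -> R) l x := psi x * trace_lift k (H g l) (cmap (c i) x).
(* Since k < K, the class of H g has at least the one order that the lift asks for. *)
have [e Ee] : exists e, (K - k = e.+1)%N by exists (K - k.+1)%N; rewrite subnSK.
have kK' : (k + e.+1 = K)%N by rewrite -Ee subnKC// ltnW.
have nD x : ~ D x -> psi x = 0.
  move=> nDx; apply: p0; rewrite ltNge; apply/negP => xt; apply: nDx.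
  by rewrite /D /= ball_norm; exact: le_lt_trans tq.
have hP theta : 0 <= theta <= alpha -> exists L, regmap D (@slab R n) theta K L (cmap (c i)).
  move=> ta; suff : exists L, regmap D (@slab R n) theta K.-1.+1 L (cmap (c i)).
    by rewrite prednK.
  apply: regmap_of_reg; first exact: boxy_ball.
    move=> a; apply: (reg_theta (th01 ta) (tha ta)).
    by apply: reg_sub Drho _; apply: (cmap_reg alpha01 (cc' i) a rho0 hrho dx0).
  by move=> x /Dc dx; apply: cell_slab; exact: cellc.
exists (ball x0 (t / 2)).
  by split; [apply: ball_open|apply: ballxx]; rewrite divr_gt0.
exists psi, W; split => //.
- by move=> x; rewrite ball_norm => /p1.
- move=> theta ta; have t01 := th01 ta.
  have [C1 C10 h1] := Hb _ ta; rewrite Ee in h1.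
  split.
    have [L' hL'] := hP _ ta.
    have [C2 C20 h2] := hcls_trace_lift n t01 e k.
    have [C3 C30 h3] := hcls_comp t01 oD (@slab_open R n) K L'.
    have [C4 C40 h4] := reg_op ta oD (reg_sub (@subsetT _ _) rpsi) (leqnn _).
    have [C5 C50 h5] := hcls_zero_ext t01 K x0 t0.
    exists (C5 * (C4 * (C3 * (C2 * C1)))); first by rewrite !mulr_ge0.
    move=> M g hg; have M0 := hg.1; split; first by rewrite !mulr_ge0.
    move=> l; rewrite -!mulrA; apply: h5; last first.
      by move=> x /p0 px; rewrite /W px mul0r.
    rewrite Eq; apply: h4; apply: (h3 _ (trace_lift k (H g l))) => //.
    by rewrite -kK'; apply: h2; exact: h1.
  move=> a M M' M'' g h s hg hh hs E l x; rewrite /W.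
  have [Dx|/nD ->] := pselect (D x); last by rewrite !mul0r mulr0 addr0.
  have sx : slab (cmap (c i) x) by apply: cell_slab; apply: cellc; exact: Dc.
  rewrite (trace_lift_lin t01 k (h1 _ _ l hg) (h1 _ _ l hh) (h1 _ _ l hs) (Hl _ _ _ _ E l) sx).
  ring.
- move=> theta M g x ta hg bx; have t01 := th01 ta.
  have [C1 C10 h1] := Hb _ ta; rewrite Ee in h1.
  (* Off D the cut-off psi vanishes on a whole neighbourhood, and so do all derivatives of W g. *)
  have [Dx|nDx] := pselect (D x); last first.
    have oN : open [set z : pt | t < `|z - x0|] := open_norm_gt (x0 := x0) (r := t).
    have xN : [set z : pt | t < `|z - x0|] x.
      by rewrite /= ltNge; apply/negP => xt; apply: nDx; rewrite /D /= ball_norm; exact: le_lt_trans tq.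
    have pW l s : (size s <= k)%N -> pder s (W g l) x = 0.
      move=> sk; have j0 := jet0 oN (0 : pt) xN k.
      have jW : jet x 0 k 0 (W g l).
        by apply: (jet_ext oN xN _ j0) => z; rewrite inE /= /W => /p0 ->; rewrite mul0r.
      by rewrite (jet_pder jW sk); case: ifP => // _; rewrite mul0r.
    split=> [l s sk|j jk]; first by rewrite pW// ltnW.
    rewrite nD// mul0r /bdop big1// => beta hb; rewrite big1// => l _.
    by rewrite pW ?mulr0// size_mseq -jk.
  have dx := Dc _ Dx; pose y := tail (cmap (c i) x).
  have [Ey cy] : par y = x /\ @cell R n y.
    by have F := chart_face (cc' i); have := F _ dx (cmap0 dx bx).
  have sx : slab (cmap (c i) x) by apply: cell_slab; exact: cellc.
  have [L' hL'] := hP _ ta.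
  (* The lift has leading coefficient H g at y; the chart replaces e_0 by its gradient, and psi
     multiplies the coefficient. *)
  have pW l s : (size s <= k)%N -> pder s (W g l) x =
      if size s == k then psi x * H g l y * \prod_(a <- s) chart_grad (c i) x ord0 a else 0.
    have hT := hcls_trace_lift n t01 e k.
    case: hT => C2 _ h2; have {}h2 := h2 _ _ (h1 _ _ l hg).
    have h2' := hcls_leq (leq_addr _ _) h2.
    have hLk := regmap_leqn (ltnW kK) hL'.
    have jt := jet_trace_lift t01 k sx (cmap0 dx bx) (h1 _ _ l hg).
    have jc := jet_comp t01 oD (@slab_open R n) Dx hLk h2' jt.
    have [C3 _ h3] := hcls_comp t01 oD (@slab_open R n) k L'.
    have [Mp hpsi] := reg_theta t01 (tha ta) (reg_sub (@subsetT _ D) rpsi).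
    have jW := jetM oD Dx (h3 _ _ _ hLk h2') (hcls_leq (ltnW kK) hpsi) jc.
    exact: (jet_pder jW).
  split=> [l s sk|j jk]; first by rewrite pW 1?ltnW// (ltn_eqF sk).
  have -> : g j x = \sum_l symb j l y * H g l y by rewrite HE ?Ey//; exact: Dr.
  rewrite /bdop (bigID (fun beta => mlen beta == mo j)) /= [X in _ + X]big1 ?addr0; last first.
    move=> beta /andP[hb nb]; rewrite big1// => l _.
    by rewrite pW size_mseq -jk// (negbTE nb) mulr0.
  rewrite mulr_sumr; under [RHS]eq_bigr => l _ do rewrite /symb mulr_suml mulr_sumr.
  rewrite [RHS]exchange_big /=; apply: eq_big => [beta|beta].
    by rewrite andbC; case: eqP => //= ->; rewrite leqnn.
  case/andP => hb /eqP Eb; apply: eq_bigr => l _.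
  rewrite pW size_mseq -jk// Eb eqxx -mpow_mseq Ey; ring.
Qed.

End Patch.

Hypothesis chart_cover : forall x, bdry Omega x -> exists i, cdom (c i) x.
Hypothesis Omega_bounded : bounded_set Omega.

Lemma bdry_compact : compact (bdry Omega).
Proof.
apply: bounded_closed_compact; last first.
  by rewrite /bdry setDE; apply: closedI; [exact: closed_closure|apply: open_closedC; exact: open_interior].
have [rho [_ hrho]] := Omega_bounded.
exists (rho + 1); split=> [|r rr]; first exact: num_real.
move=> x [clx _]; rewrite /= leNgt; apply/negP => xr.
have oN : open [set z : pt | r < `|z - 0|] := open_norm_gt (x0 := 0) (r := r).
have [|z [Oz]] := clx [set z : pt | r < `|z - 0|].
  by apply: open_nbhs_nbhs; split => //=; rewrite subr0.
rewrite /= subr0 ltNge => /negP; apply; apply: hrho Oz.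
by apply: lt_trans rr; rewrite ltrDl.
Qed.

Lemma solved_bdry k : (k < K)%N -> solved_on k (bdry Omega).
Proof.
move=> kK; apply: (compact_union_ind bdry_compact (P := solved_on k)).
- exact: solved_on0.
- by move=> U V; exact: solved_onU.
- by move=> U V; exact: solved_on_sub.
- move=> x bx; have [i dx] := chart_cover bx.
  by have [U [oU Ux] sU] := solved_near kK dx bx; exists U.
Qed.

Lemma bdata_sub theta M M' g h : bdata theta M g -> bdata theta M' h ->
  bdata theta (M + M') (fun j x => g j x - h j x).
Proof.
move=> [M0 hg] [M0' hh]; split; first exact: addr_ge0.
by move=> i j; apply: (hclsB (@cell_open R n) (hg i j) (hh i j)).
Qed.

Lemma extension_step q : (q <= K)%N -> exists2 E, extension_op E &
  forall theta M g j x, 0 <= theta <= alpha -> bdata theta M g -> bdry Omega x ->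
    (mo j < q)%N -> bdop j (E g) x = g j x.
Proof.
elim: q => [_|q IH qK].
  (* Any extension operator can start the recursion, as no order is less than 0. *)
  by have [psi [W [_ _ bW _]]] := solved_on0 0; exists W.
have [E bE sE] := IH (ltnW qK); have [psi [W [_ p1 bW sW]]] := solved_bdry qK.
pose res (g : 'I_J -> pt -> R) j x := g j x - bdop j (E g) x.
have hres theta : 0 <= theta <= alpha -> exists2 C : R, 0 <= C & forall M g,
    bdata theta M g -> bdata theta (C * M) (res g).
  move=> ta; have [[C1 C10 h1] _] := bE _ ta; have [C2 C20 h2] := bdop_bounded ta.
  exists (1 + C2 * C1) => [|M g hg]; first by rewrite addr_ge0// mulr_ge0.
  by rewrite mulrDl mul1r -mulrA; exact: (bdata_sub hg (h2 _ _ (h1 _ _ hg))).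
exists (fun g l x => 1 * E g l x + W (res g) l x).
  move=> theta ta; have [[C1 C10 h1] l1] := bE _ ta; have [[C2 C20 h2] l2] := bW _ ta.
  have [C3 C30 h3] := hres _ ta; split.
    exists (C1 + C2 * C3) => [|M g hg]; first by rewrite addr_ge0// mulr_ge0.
    have [M1 u1] := h1 _ _ hg; have [M2 u2] := h2 _ _ (h3 _ _ hg).
    rewrite mulrDl -mulrA; split=> [|l]; first exact: addr_ge0.
    by have := hclsD oT (hclsZ oT 1 (u1 l)) (u2 l); rewrite normr1 mul1r.
  move=> a M M' M'' g h s hg hh hs Es l x.
  rewrite (l1 _ _ _ _ _ _ _ hg hh hs Es).
  rewrite (l2 a _ _ _ _ _ _ (h3 _ _ hg) (h3 _ _ hh) (h3 _ _ hs)) ?mul1r; last first.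
    move=> j y by_; rewrite /res Es//.
    rewrite (bdop_lin j (a := a) y (h1 _ _ hg) (h1 _ _ hh) (l1 _ _ _ _ _ _ _ hg hh hs Es)); ring.
  ring.
move=> theta M g j x ta hg bx jq.
have [C3 C30 h3] := hres _ ta.
have [[C1 C10 h1] _] := bE _ ta; have [[C2 C20 h2] _] := bW _ ta.
rewrite (bdop_lin j (a := 1) x (h1 _ _ hg) (h2 _ _ (h3 _ _ hg)))// mul1r.
have [f0 fk] := sW _ _ _ _ ta (h3 _ _ hg) bx.
move: jq; rewrite ltnS leq_eqVlt => /orP[/eqP jq|jq].
  by rewrite fk// p1// mul1r /res addrC subrK.
rewrite (sE _ _ _ _ _ ta hg bx jq) /bdop big1 ?addr0// => beta hb.
rewrite big1// => l _; rewrite f0 ?mulr0// size_mseq.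
exact: leq_ltn_trans hb jq.
Qed.

End Patches.

(** * From normality and classical data to the construction *)

(** Surjectivity applied to unit vectors gives the columns of a right inverse; indexing them by all
    of ['I_(m * N)] avoids matrices whose size depends on k. *)
Lemma normality_inverse (R : realType) (m n N : nat) (D : set 'rV[R]_n)
    (mo : 'I_(m * N) -> nat) b nu : @normality R m n N D mo b nu ->
  forall k x, (k < 2 * m)%N -> bdry D x ->
  exists v : 'I_(m * N) -> 'I_N -> R, forall j j', mo j = k -> mo j' = k ->
    \sum_l (\sum_(beta : mindex n (2 * m) | mlen beta == k)
       mpow (nu x) beta * b j beta x ord0 l) * v j' l = (j == j')%:R.
Proof.
move=> hn k x kK bx.
have /choice[v hv] : forall j', exists v : 'cV[R]_N, normal_mx mo b nu k x *m v =
    \col_i (enum_val i == j')%:R by move=> j'; exact: hn.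
exists (fun j' l => v j' l ord0) => j j' jk _.
have hj : j \in [pred j | mo j == k] by rewrite inE jk.
have := congr1 (fun w : 'cV[R]__ => w (enum_rank_in hj j) ord0) (hv j').
rewrite /= [RHS]mxE enum_rankK_in// => <-; rewrite mxE; apply: eq_bigr => l _.
congr (_ * _); rewrite mxE summxE; apply: eq_bigr => beta _.
by rewrite enum_rankK_in// mxE.
Qed.

(** S is the sum of all boundary norms over operators and charts; n + 2 is the constant of
    [holder_hcls] on the n-dimensional cell. *)
Lemma bdry_data_bound (R : realType) (n K J p : nat) (c : 'I_p -> chart R n)
    (mo : 'I_J -> nat) (theta : R) (g : 'I_J -> 'rV[R]_n.+1 -> R) : 0 <= theta <= 1 ->
  (forall j, holder_bdry c (K - mo j) theta (g j)) ->
  exists S : R, bdata K c mo theta ((n%:R + 2) * S) g /\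
    (\sum_j holder_bdry_norm c (K - mo j) theta (g j))%E = S%:E.
Proof.
move=> t01 hg.
pose F j i := fine (holder_norm (@cell R n) (K - mo j) theta (local_rep (c i) (g j))).
have F0 j i : 0 <= F j i by apply: holder_norm_fine_ge0; [exact: cell_nonempty|exact: (hg j i).2].
have n2 : 0 <= n%:R + 2 :> R by rewrite addr_ge0.
exists (\sum_j \sum_i F j i); split.
  split; first by rewrite mulr_ge0// sumr_ge0// => j _; rewrite sumr_ge0.
  move=> i j; apply: (@hcls_le _ _ _ _ _ ((n%:R + 2) * F j i)).
    rewrite ler_wpM2l// (bigD1 j)//= (bigD1 i)//= -addrA lerDl.
    by rewrite addr_ge0// sumr_ge0// => j' _; rewrite sumr_ge0.
  apply: (holder_hcls (ell := fun v : R => v)) (hg j i) => //.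
  - exact: cell_open.
  - exact: cell_open.
  - exact: cell_boxy.
  - by exists 1 => x /cell_norm /ltW.
  - exact: cell_nonempty.
rewrite -sumEFin; apply: eq_bigr => j _; rewrite -sumEFin; apply: eq_bigr => i _.
exact: (holder_norm_fineK (@cell_nonempty _ _) (hg j i).2).
Qed.

(* The dimension of the space is n.+1 >= 1. *)
Theorem theorem5p3 (R : realType) (m n N : nat) (m_gt0 : (0 < m)%N)
  (N_gt0 : (0 < N)%N) (alpha : R) (alpha_gt0 : 0 < alpha) (alpha_lt1 : alpha < 1)
  (Omega : set 'rV[R]_n.+1) (Omega_dom : bounded_domain Omega)
  (p : nat) (c : 'I_p -> chart R n)
  (Omega_class : is_atlas Omega (2 * m) alpha c)
  (nu : 'rV[R]_n.+1 -> 'rV[R]_n.+1)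
  (nu_normal : forall x, bdry Omega x -> outer_unit_normal Omega x (nu x))
  (mo : 'I_(m * N) -> nat)
  (mo_mono : forall i j : 'I_(m * N), (i <= j)%N -> (mo i <= mo j)%N)
  (mo_le : forall j : 'I_(m * N), (mo j <= 2 * m - 1)%N)
  (b : 'I_(m * N) -> mindex n.+1 (2 * m) -> 'rV[R]_n.+1 -> 'rV[R]_N)
  (b_reg : forall (j : 'I_(m * N)) (beta : mindex n.+1 (2 * m)),
    (mlen beta <= mo j)%N -> holder_bdry c (2 * m - mo j) alpha (b j beta))
  (b_normal : normality Omega mo b nu) :
  exists E : ('I_(m * N) -> 'rV[R]_n.+1 -> R) -> ('rV[R]_n.+1 -> 'cV[R]_N),
  forall theta : R, 0 <= theta <= alpha ->
  let data := [set g : 'I_(m * N) -> 'rV[R]_n.+1 -> R |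
    forall j, holder_bdry c (2 * m - mo j) theta (g j)] in
  [/\ forall g, data g -> holder Omega (2 * m) theta (E g),
      forall (a : R) g h, data g -> data h ->
        forall x, closure Omega x ->
        E (fun j y => a * g j y + h j y) x = a *: E g x + E h x,
      exists C : R, forall g, data g ->
        (holder_norm Omega (2 * m) theta (E g) <=
         C%:E * \sum_(j < m * N)
           holder_bdry_norm c (2 * m - mo j) theta (g j))%E &
      forall g, data g -> forall (j : 'I_(m * N)) x, bdry Omega x ->
        bdry_op Omega mo b j (E g) x = g j x].
Proof.
have a01 : 0 <= alpha <= 1 by rewrite (ltW alpha_gt0) ltW.
have K_gt0 : (0 < 2 * m)%N by rewrite muln_gt0.
have mo_lt j : (mo j < 2 * m)%N by apply: leq_ltn_trans (mo_le j) _; rewrite subn1 prednK.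
have [oO _ O0 bO] := Omega_dom; have [cc cover] := Omega_class.
(* Every order [mo j] is less than 2 * m, so the recursion is complete at q = 2 * m. *)
have [E bE sE] := extension_step K_gt0 a01 oO cc mo_lt b_reg nu_normal
  (normality_inverse b_normal) cover bO (leqnn _).
exists (fun g => colfun (E g)) => theta ta data.
have t01 : 0 <= theta <= 1.
  by case/andP: ta => -> /= /le_trans -> //; exact: ltW.
have [[C C0 hE] lE] := bE _ ta.
split.
- move=> g hg; have [S [hS _]] := bdry_data_bound t01 hg.
  have [M0 hu] := hE _ _ hS; exact: (holder_colfun M0 hu O0).1.
- move=> a g h hg hh x _.
  have [S [hS _]] := bdry_data_bound t01 hg; have [S' [hS' _]] := bdry_data_bound t01 hh.
  have hr : bdata (2 * m) c mo theta (`|a| * ((n%:R + 2) * S) + (n%:R + 2) * S')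
      (fun j y => a * g j y + h j y).
    have [M0 h1] := hS; have [M0' h2] := hS'; split; first by rewrite addr_ge0// mulr_ge0.
    by move=> i j; apply: (hclsD (@cell_open R n) (hclsZ (@cell_open R n) a (h1 i j)) (h2 i j)).
  apply/colP => l; rewrite !mxE.
  exact: (lE a _ _ _ _ _ _ hS hS' hr).
(* The three factors: passage from components to the classical norm, the bound of E, and passage
   from the boundary norms to [bdata]. *)
- exists (2 * #|mindex n.+1 (2 * m)|%:R * (C * (n%:R + 2))) => g hg.
  have [S [hS ->]] := bdry_data_bound t01 hg; have [M0 hu] := hE _ _ hS.
  apply: le_trans (holder_colfun M0 hu O0).2 _.
  by rewrite -EFinM lee_fin !mulrA.
- move=> g hg j x bx; have [S [hS _]] := bdry_data_bound t01 hg.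
  have [M0 hu] := hE _ _ hS.
  rewrite -(sE _ _ _ _ _ ta hS bx (mo_lt j)) /bdry_op /bdop.
  apply: eq_bigr => beta hb; rewrite (bder_colfun hu); last 2 first.
  + by rewrite size_mseq; apply: leq_trans hb (ltnW (mo_lt j)).
  + by case: bx.
  by rewrite mxE; apply: eq_bigr => l _; rewrite !mxE.
Qed.
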